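(* Let $\Delta$ be an ordered Euclidean building and let $\mathcal{C}$ be the combing of $\Delta$ associated with the ordering (defined in the context). Then $\mathcal{C}$ satisfies the fellow traveller property: there is $k>0$ such that if $\alpha,\beta\in\mathcal{C}$ begin and end at a distance at most one apart, then $$d_1(\alpha(t),\beta(t))\le k\quad\text{for all } t\ge 0,$$ where $d_1$ is the graph metric on $\Delta^{(1)}$. The same is true for the combing $\mathcal{C}_{spec}$ on the graph $\Delta^{(1)}_{spec}$ (with the graph metric of $\Delta^{(1)}_{spec}$).
   Context: **Root systems and Coxeter complexes.** Let $\Phi$ be a reduced, irreducible, crystallographic root system spanning a Euclidean space $V$ of dimension $n$, with Weyl group $W$. Let $\mathbb{Z}\Phi^\#=\{\lambda\in V: (\lambda,\alpha)\in\mathbb{Z}\ \forall \alpha\in\Phi\}$ be the coweight lattice. For $\alpha\in\Phi,k\in\mathbb{Z}$ let $H_{\alpha,k}=\{\lambda\in V:(\lambda,\alpha)=k\}$ (the walls). The walls triangulate $V$; the resulting piecewise Euclidean simplicial complex is $\Sigma_\Phi$, and its top-dimensional closed simplices are called alcoves. The extended affine Weyl group $\widehat{W_a}=\mathbb{Z}\Phi^\#\rtimes W$ acts on $\Sigma_\Phi$ by simplicial isometries. A Euclidean Coxeter complex is a simplicial structure $\Sigma$ on a Euclidean space $V'$ that is the image of some $\Sigma_\Phi$ under an affine isometry $V\to V'$; all notions are transported by this isometry. A vertex $x$ is special if for every wall there is a parallel wall passing through $x$. **Buildings.** A Euclidean building is a simplicial piecewise Euclidean complex $\Delta$ that is the union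 of a family of subcomplexes (apartments) such that: (B0) there is a Euclidean Coxeter complex $\Sigma_0$ such that each apartment is simplicially isometric to $\Sigma_0$; (B1) any two simplices of $\Delta$ lie in a common apartment; (B2) if two apartments $\Sigma,\Sigma'$ share a top-dimensional simplex, there is an isomorphism (simplicial isometry) $\Sigma\to\Sigma'$ fixing $\Sigma\cap\Sigma'$ pointwise. A vertex of $\Delta$ is special if it is special in some (equivalently any) apartment containing it. **Orderings.** A directed edge of $\Delta^{(1)}$ is special if its origin is a special vertex, and quasi-special if it lies on a line segment $[x,y]\subset\Delta^{(1)}$ with $x,y$ special vertices. Special edges are quasi-special. An ordering of a Euclidean Coxeter complex $\Sigma$ of dimension $n$ is a function $\tau$ from the set of quasi-special edges to $\{1,\dots,n\}$ such that: 1) for each alcove $\langle x,x_1,\dots,x_n\rangle$ with $x$ a special vertex, $\tau$ is bijective on $\{[x,x_1],\dots,[x,x_n]\}$; 2) $\tau$ is $\widehat{W_a}$-invariant; 3) for any line segment $[x,y]\subset\Sigma^{(1)}$ with special end points, $\tau$ is constant on the quasi-special edges lying on $[x,y]$ and directed from $x$ to $y$. An ordering of a Euclidean building $\Delta$ of dimension $n$ is a function from its quasi-special edges to $\{1,\dots,n\}$ restricting to an ordering on each apartment. The value $\tau(e)$ is called the type of $e$. An ordered building is a building with a fixed ordering. **The combing $\mathcal{C}$.** An edge path in a graph is a map $\alpha$ from $\{0,\dots,N\}$ to its vertices such that $\alpha(i),\alpha(i+1)$ are the end points of an edge for each $i$; it is extended by $\alpha(t)=\alpha(N)$ for $t\ge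 N$. Let $x,y$ be special vertices of $\Delta$. Choose an apartment $\Sigma$ containing $x,y$ and regard it as a vector space with origin $x$. The walls through $x$ cut $\Sigma$ into closed simplicial cones (sectors) based at $x$; choose a sector $S$ containing $y$. Let $\langle x,x_1,\dots,x_n\rangle$ be the unique alcove in $S$ having $x$ as a vertex, numbered so that the edge $e_i=[x,x_i]$ has type $i$. The vectors $e_1,\dots,e_n$ form a basis, $S=\sum\mathbb{R}_+e_i$, and $y=\sum m_ie_i$ with all $m_i\ge0$. Let $\alpha_{xy}$ be the concatenation, in this order, of the segments $[0,m_1e_1],[m_1e_1,m_1e_1+m_2e_2],\dots,[\sum_{i\le n-1}m_ie_i,\sum_{i\le n}m_ie_i]$. It is an edge path in $\Delta^{(1)}$ depending only on $x,y$. The combing $\mathcal{C}$ consists of all paths $\alpha_{xy}$ ($x,y$ special vertices) together with all their prefix subpaths in $\Delta^{(1)}$. **The graph $\Delta^{(1)}_{spec}$ and $\mathcal{C}_{spec}$.** The vertices of $\Delta^{(1)}_{spec}$ are the special vertices of $\Delta$; two special vertices $x,y$ are joined by an edge (the line segment $[x,y]$) if $[x,y]$ lies in $\Delta^{(1)}$ and there are no other special vertices between $x$ and $y$. $\mathcal{C}_{spec}$ is the subfamily of $\mathcal{C}$ of those paths connecting special vertices, regarded as edge paths in $\Delta^{(1)}_{spec}$. *)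

(* Defs.v *)
From HB Require Import structures.
From mathcomp Require Import all_boot all_order all_algebra finmap.
From mathcomp Require Import all_classical all_reals ereal.

Set Implicit Arguments.
Unset Strict Implicit.
Unset Printing Implicit Defensive.

Import Order.TTheory GRing.Theory Num.Theory.
Local Open Scope card_scope.
Local Open Scope classical_set_scope.
Local Open Scope ring_scope.

(** * Euclidean space and root systems *)

Section RootSystems.
Variables (R : realType) (n : nat).
Implicit Types (Phi : {fset 'rV[R]_n}) (u v x y p a b : 'rV[R]_n).

Definition dot u v : R := (u *m v^T) 0 0.

Definition edist u v : R := Num.sqrt (dot (u - v) (u - v)).

Definition segment x y : set 'rV[R]_n :=
  [set x + t *: (y - x) | t in [set t : R | 0 <= t <= 1]].

Definition reflection a v : 'rV[R]_n := v - (2 * dot v a / dot a a) *: a.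

Record root_system Phi : Prop := RootSystem {
  root_neq0 : 0 \notin Phi;
  root_span : <<Phi>>%VS = fullv;
  root_reflection : forall a b, a \in Phi -> b \in Phi ->
    reflection a b \in Phi;
  root_crystallographic : forall a b, a \in Phi -> b \in Phi ->
    2 * dot b a / dot a a \is a Num.int;
  root_reduced : forall a (c : R), a \in Phi -> c *: a \in Phi ->
    c = 1 \/ c = -1;
  root_nonempty : Phi != fset0;
  root_irreducible : forall A B : {fset 'rV[R]_n}, Phi = (A `|` B)%fset ->
    (forall a b, a \in A -> b \in B -> dot a b = 0) -> A = fset0 \/ B = fset0
}.

Definition coweight Phi v : Prop := forall a, a \in Phi -> dot v a \is a Num.int.

Inductive weyl Phi : ('rV[R]_n -> 'rV[R]_n) -> Prop :=
| weyl_id : weyl Phi id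
| weyl_reflection a w : a \in Phi -> weyl Phi w -> weyl Phi (reflection a \o w).

Definition extended_affine_weyl Phi (g : 'rV[R]_n -> 'rV[R]_n) : Prop :=
  exists w l, [/\ weyl Phi w, coweight Phi l & g = (fun v => w v + l)].

End RootSystems.

(** * Simplicial complexes

   A simplicial complex is encoded by the set [K] of the vertex sets of its
   simplices.  A piecewise Euclidean structure is encoded by the edge lengths
   [len]: they determine the metric of every simplex, and a simplicial map is an
   isometry on every simplex exactly when it preserves them. *)

Section Complexes.
Variables (R : realType).

Definition vertices (T : Type) (K : set (set T)) : set T := [set v | K [set v]].

Definition edge (T : Type) (K : set (set T)) (u v : T) : Prop :=
  u <> v /\ K [set u; v].

Definition face_closed (T : Type) (K : set (set T)) : Prop :=
  forall s r : set T, K s -> r `<=` s -> r !=set0 -> K r.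

(* Every simplex is finite, nonempty, and is isometric to a nondegenerate
   Euclidean simplex, spanned by the points [p 0, ..., p m] of R^m. *)
Definition piecewise_euclidean (T : Type) (K : set (set T)) (len : T -> T -> R)
    : Prop :=
  forall s, K s -> exists (m : nat) (v : 'I_m.+1 -> T) (p : 'I_m.+1 -> 'rV[R]_m),
    [/\ s = range v,
        row_free (\matrix_(i < m) (p (lift ord0 i) - p ord0))
      & forall i j, len (v i) (v j) = edist (p i) (p j)].

Record simplicial_isometry (T T' : Type) (K : set (set T)) (len : T -> T -> R)
    (K' : set (set T')) (len' : T' -> T' -> R) (f : T -> T') : Prop :=
  SimplicialIsometry {
    isometry_bij : set_bij (vertices K) (vertices K') f;
    isometry_simplex : forall s, s `<=` vertices K -> (K s <-> K' (f @` s));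
    isometry_len : forall u v, edge K u v -> len' (f u) (f v) = len u v
  }.

End Complexes.

(** * The complex of a root system *)

Section CoxeterComplex.
Variables (R : realType) (n : nat).
Implicit Types (Phi : {fset 'rV[R]_n}) (u v x y p a : 'rV[R]_n).

Definition hyperplane a (k : int) : set 'rV[R]_n := [set v | dot v a = k%:~R].

Definition wall Phi (H : set 'rV[R]_n) : Prop :=
  exists a k, a \in Phi /\ H = hyperplane a k.

Definition parallel (H H' : set 'rV[R]_n) : Prop :=
  exists t : 'rV[R]_n, H' = [set v + t | v in H].

(* The intersection of all the closed half-spaces that contain [p] and are
   bounded by a wall (taking [a] and [- a] gives both sides of each wall).  It is
   the closed simplex of the triangulation that has [p] in its relative
   interior, and all closed simplices have this form. *)
Definition closed_cell Phi p : set 'rV[R]_n :=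
  [set v | forall a (k : int), a \in Phi -> k%:~R <= dot p a -> k%:~R <= dot v a].

Definition cell_vertex Phi v : Prop := closed_cell Phi v = [set v].

Definition coxeter_complex Phi : set (set 'rV[R]_n) :=
  [set s | exists p, s = closed_cell Phi p `&` cell_vertex Phi].

Definition special_point Phi x : Prop :=
  vertices (coxeter_complex Phi) x /\
  forall H, wall Phi H -> exists H', [/\ wall Phi H', parallel H H' & H' x].

Definition skeleton1 Phi : set 'rV[R]_n :=
  [set z | exists u v, coxeter_complex Phi [set u; v] /\ segment u v z].

Definition alcove Phi (s : set 'rV[R]_n) : Prop :=
  coxeter_complex Phi s /\ s #= `I_n.+1.

(* [u, v] is an edge lying on the segment [x, y] and directed from x to y. *)
Definition edge_along Phi x y u v : Prop :=
  edge (coxeter_complex Phi) u v /\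
  exists s t : R, [/\ 0 <= s, s < t, t <= 1,
    u = x + s *: (y - x) & v = x + t *: (y - x)].

Definition special_segment Phi x y : Prop :=
  [/\ special_point Phi x, special_point Phi y & segment x y `<=` skeleton1 Phi].

(* Exchanging x and y reverses the edges, so both directions are covered. *)
Definition quasi_special_edge Phi u v : Prop :=
  exists x y, special_segment Phi x y /\ edge_along Phi x y u v.

(* The types 1, ..., n are represented by ['I_n], in the same order.  The
   function [tau] is total, but only its values on quasi-special edges matter. *)
Record coxeter_ordering Phi (tau : 'rV[R]_n -> 'rV[R]_n -> 'I_n) : Prop :=
  CoxeterOrdering {
    ordering_alcove : forall x s, special_point Phi x -> alcove Phi s -> s x ->
      set_bij (s `\ x) [set: 'I_n] (tau x);
    ordering_invariant : forall g u v, extended_affine_weyl Phi g ->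
      quasi_special_edge Phi u v -> tau (g u) (g v) = tau u v;
    ordering_segment : forall x y u v u' v', special_segment Phi x y ->
      edge_along Phi x y u v -> edge_along Phi x y u' v' -> tau u v = tau u' v'
  }.

(* A sector based at [x] is the closure of the component, containing some [p], of
   the complement of the walls through [x]. *)
Definition sector Phi x (S : set 'rV[R]_n) : Prop :=
  exists p,
    (forall H, wall Phi H -> H x -> ~ H p) /\
    S = [set v | forall a (k : int), a \in Phi -> hyperplane a k x ->
                 k%:~R <= dot p a -> k%:~R <= dot v a].

(* [x :: q] is the edge path that runs straight along the segment [x, y]; it is
   constant when x = y. *)
Definition segment_path Phi x y (q : seq 'rV[R]_n) : Prop :=
  path (fun u v => `[< edge_along Phi x y u v >]) x q /\ last x q = y.

End CoxeterComplex.

(** * Buildings *)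

(* A complex is simplicially isometric to a Euclidean Coxeter complex, i.e. to an
   image of some [coxeter_complex Phi] under an affine isometry, exactly when it
   is simplicially isometric to [coxeter_complex Phi] itself. *)
Record euclidean_building (R : realType) (n : nat) := EuclideanBuilding {
  vert : Type;
  simplex : set (set vert);
  len : vert -> vert -> R;
  apartment : set (set (set vert));
  root_set : {fset 'rV[R]_n};
  building_roots : root_system root_set;
  building_vertices : vertices simplex = setT;
  building_faces : face_closed simplex;
  building_euclidean : piecewise_euclidean simplex len;
  building_subcomplex : forall A, apartment A -> A `<=` simplex /\ face_closed A;
  building_union : simplex = \bigcup_(A in apartment) A;
  building_B0 : forall A, apartment A -> exists f : vert -> 'rV[R]_n,
    simplicial_isometry A len (coxeter_complex root_set) (@edist R n) f;
  building_B1 : forall s r, simplex s -> simplex r ->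
    exists A, [/\ apartment A, A s & A r];
  (* A point of A `&` A' lies in a common simplex of A and A', hence it is
     enough that the isomorphism fixes the common vertices. *)
  building_B2 : forall A A' s, apartment A -> apartment A' ->
    A s -> A' s -> s #= `I_n.+1 ->
    exists f : vert -> vert, simplicial_isometry A len A' len f /\
      forall v, vertices A v -> vertices A' v -> f v = v
}.

Section Combing.
Variables (R : realType) (n : nat) (Delta : euclidean_building R n).
Implicit Types (A : set (set (vert Delta))) (x y u v : vert Delta).
Implicit Types (f : vert Delta -> 'rV[R]_n).
Implicit Types (tau : vert Delta -> vert Delta -> 'I_n).

(* An apartment together with an isometry onto the model complex, through which
   the notions of the model are transported. *)
Definition chart A f : Prop :=
  apartment A /\
  simplicial_isometry A (@len _ _ Delta) (coxeter_complex (root_set Delta))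
    (@edist R n) f.

Definition special x : Prop :=
  exists A f, [/\ chart A f, vertices A x & special_point (root_set Delta) (f x)].

Definition ordering tau : Prop :=
  forall A, apartment A -> exists f sigma,
    [/\ chart A f, coxeter_ordering (root_set Delta) sigma
      & forall u v, vertices A u -> vertices A v ->
          quasi_special_edge (root_set Delta) (f u) (f v) ->
          tau u v = sigma (f u) (f v)].

(* [x :: p] is the path alpha_xy.  The alcove of the sector S at x has vertices x
   and [xs i], and [q i] is the piece of the path, without its origin, along
   e_i = f (xs i) - f x. *)
Definition combing_path tau x y (p : seq (vert Delta)) : Prop :=
  exists A f (S : set 'rV[R]_n) (xs : 'I_n -> vert Delta) (m : 'I_n -> R)
         (q : 'I_n -> seq 'rV[R]_n),
    let s := [set x] `|` range xs in
    let e i := f (xs i) - f x in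
    let corner (i : nat) := f x + \sum_(j < n | (j < i)%N) m j *: e j in
    [/\ chart A f, vertices A x & vertices A y] /\
    [/\ sector (root_set Delta) (f x) S & S (f y)] /\
    [/\ A s, s #= `I_n.+1, f @` s `<=` S & forall i, tau x (xs i) = i] /\
    [/\ forall i, 0 <= m i & f y = corner n] /\
    [/\ forall i : 'I_n,
          segment_path (root_set Delta) (corner i) (corner i.+1) (q i),
        all (fun v => `[< vertices A v >]) p
      & [seq f v | v <- p] = flatten [seq q i | i <- enum 'I_n]].

(* A nonempty finite path is a pair (origin, remaining vertices). *)
Definition combing tau : set (vert Delta * seq (vert Delta)) :=
  [set c | exists y p k, [/\ special c.1, special y, combing_path tau c.1 y p
                           & c.2 = take k p]].

(* Regarding such a path as a path between special vertices amounts to keeping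
   only the special vertices it visits. *)
Definition combing_spec tau : set (vert Delta * seq (vert Delta)) :=
  [set (c.1, [seq v <- c.2 | `[< special v >]]) |
     c in [set c | [/\ combing tau c, special c.1 & special (last c.1 c.2)]]].

Definition adjacent x y : Prop := edge (@simplex _ _ Delta) x y.

Definition adjacent_spec x y : Prop :=
  x <> y /\
  exists A f, [/\ chart A f, vertices A x, vertices A y,
    special_segment (root_set Delta) (f x) (f y)
  & forall z, special_point (root_set Delta) z -> segment (f x) (f y) z ->
      z = f x \/ z = f y].

End Combing.

(** * Fellow travellers *)

Section FellowTraveller.
Variables (R : realType) (T : Type) (adj : T -> T -> Prop).

(* The value is +oo when no edge path joins x to y. *)
Definition graph_dist (x y : T) : \bar R :=
  ereal_inf [set ((size p)%:R)%:E |
    p in [set p | path (fun u v => `[< adj u v >]) x p /\ last x p = y]].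

Definition path_at (c : T * seq T) (t : nat) : T :=
  nth (last c.1 c.2) (c.1 :: c.2) t.

Definition fellow_traveller (C : set (T * seq T)) : Prop :=
  exists k : R, 0 < k /\
    forall c d, C c -> C d ->
      (graph_dist c.1 d.1 <= 1%:E)%E ->
      (graph_dist (last c.1 c.2) (last d.1 d.2) <= 1%:E)%E ->
      forall t, (graph_dist (path_at c t) (path_at d t) <= k%:E)%E.

End FellowTraveller.

(* Main.v *)
(* In suitable charts every path of the combing runs through the fixed basis e_1,
   ..., e_n of edges of one alcove, one direction after the other. Retract one
   of two such paths onto an apartment containing the other: distances do not
   grow and edge types are kept, so each step m e_l becomes m w(e_l) with w in
   the Weyl group. The e_l being dominant, e_l - w(e_l) is a combination of
   positive roots with nonnegative coefficients; all the defects thus lie in one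
   pointed cone, and since the ends of the paths are close, their sum is
   bounded. Hence the two coordinate vectors (m_1, ..., m_n) differ by a bounded
   amount, and partial sums up to the same coordinates stay close, as the defect
   of a prefix is dominated by the total one. Finally the parameter t is
   compared with the coordinates by counting: on a ray along e_l the vertices,
   and likewise the special vertices, form a periodic discrete set. *)

From HB Require Import structures.
From mathcomp Require Import all_boot all_order all_algebra finmap.
From mathcomp Require Import all_classical all_reals ereal.
From mathcomp Require Import ring lra zify.
Require Import Defs.

Set Implicit Arguments.
Unset Strict Implicit.
Unset Printing Implicit Defensive.

Import Order.TTheory GRing.Theory Num.Theory.
Local Open Scope card_scope.
Local Open Scope classical_set_scope.
Local Open Scope ring_scope.

(** The choice of centre drives the estimate. For a retraction centred anywhere in the second
    apartment, pairing the defect with the dominant [e l] bounds the difference of the total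
    displacements from one side only; exchanging the paths gives the other side. For intermediate
    points the centre is moved to an alcove containing the point of the second path: an apartment
    through that alcove and the first point contains both points, and there the retracted
    displacement is the true one.

    The obstacle is that charts and orderings of different apartments are unrelated a priori. Two
    charts of one apartment differ by a simplicial automorphism of the model. A gallery argument
    shows that it is affine; it permutes the directions of walls and preserves coweights, so
    specialness is independent of the chart. A Weyl-invariant labelling of the edges at the origin
    is determined by one alcove, so the isomorphisms of (B2), which fix an alcove, preserve types.
    That the cells of the model are Euclidean simplices closed under faces is pulled back from the
    building through a chart. *)

Section Uniformity.
Variable R : realType.

(** The minimum of finitely many thresholds serves for all roots at once; all uniform constants
    below arise this way. *)
Lemma seq_small (T : eqType) (S : seq T) (P : T -> R -> Prop) :
  (forall a, a \in S -> exists2 e, 0 < e & forall t, 0 < t -> t <= e -> P a t) ->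
  exists2 e, 0 < e & forall a, a \in S -> forall t, 0 < t -> t <= e -> P a t.
Proof.
elim: S => [|a S IH] H; first by exists 1.
have [|e e0 He] := IH; first by move=> b bS; apply: H; rewrite inE bS orbT.
have [e' e'0 He'] := H a (mem_head _ _).
exists (Num.min e e'); first by rewrite lt_min e0.
move=> b; rewrite inE => bS t t0; rewrite le_min => /andP[te te'].
by case/orP: bS => [/eqP -> | bS]; [apply: He' | apply: He].
Qed.

(** Induction on the number of drops [e] that fit into [m x]. It replaces inductions on lengths of
    galleries, heights of roots and lengths of Weyl group elements; [Q] is then often constant. *)
Lemma real_descent (T : Type) (m : T -> R) (e : R) (I Q : T -> Prop) :
  0 < e -> (forall x, I x -> 0 <= m x) ->
  (forall x, I x -> Q x \/ exists y, [/\ I y, m y <= m x - e & Q y -> Q x]) ->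
  forall x, I x -> Q x.
Proof.
move=> e0 m0 step.
suff H k : forall x, I x -> m x <= k%:R * e -> Q x.
  move=> x Ix; apply: (H (Num.truncn (m x / e)).+1) => //.
  by rewrite -ler_pdivrMr// ltW// truncnS_gt.
elim: k => [|k IH] x Ix mx; have [//|[y [Iy my Qyx]]] := step x Ix.
  by have := m0 _ Iy; move: mx; rewrite mul0r; lra.
by apply/Qyx/IH => //; move: mx; rewrite -natr1; lra.
Qed.

End Uniformity.

(** * The scalar product and generic vectors *)

Section Dot.
Variables (R : realType) (n : nat).
Implicit Types (u v w a b d : 'rV[R]_n).

Lemma dotE u v : dot u v = \sum_i u 0 i * v 0 i.
Proof. by rewrite /dot mxE; apply: eq_bigr => i _; rewrite mxE. Qed.

Lemma dotC u v : dot u v = dot v u.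
Proof. by rewrite !dotE; apply: eq_bigr => i _; rewrite mulrC. Qed.

Lemma dotDl u v w : dot (u + v) w = dot u w + dot v w.
Proof. by rewrite /dot mulmxDl mxE. Qed.

Lemma dotNl u w : dot (- u) w = - dot u w.
Proof. by rewrite /dot mulNmx mxE. Qed.

Lemma dotBl u v w : dot (u - v) w = dot u w - dot v w.
Proof. by rewrite dotDl dotNl. Qed.

Lemma dotZl (c : R) u w : dot (c *: u) w = c * dot u w.
Proof. by rewrite /dot -scalemxAl mxE. Qed.

Lemma dot0l w : dot 0 w = 0.
Proof. by rewrite /dot mul0mx mxE. Qed.

Lemma dotDr u v w : dot w (u + v) = dot w u + dot w v.
Proof. by rewrite dotC dotDl !(dotC w). Qed.

Lemma dotNr u w : dot w (- u) = - dot w u.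
Proof. by rewrite dotC dotNl dotC. Qed.

Lemma dotBr u v w : dot w (u - v) = dot w u - dot w v.
Proof. by rewrite dotDr dotNr. Qed.

Lemma dotZr (c : R) u w : dot w (c *: u) = c * dot w u.
Proof. by rewrite dotC dotZl dotC. Qed.

Lemma dot0r w : dot w 0 = 0.
Proof. by rewrite dotC dot0l. Qed.

Lemma dot_suml (I : Type) (r : seq I) (P : pred I) (F : I -> 'rV[R]_n) w :
  dot (\sum_(i <- r | P i) F i) w = \sum_(i <- r | P i) dot (F i) w.
Proof. by apply: (big_morph (fun u => dot u w)) => [u v|]; rewrite ?dotDl ?dot0l. Qed.

Lemma dot_sumr (I : Type) (r : seq I) (P : pred I) (F : I -> 'rV[R]_n) w :
  dot w (\sum_(i <- r | P i) F i) = \sum_(i <- r | P i) dot w (F i).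
Proof. by rewrite dotC dot_suml; apply: eq_bigr => i _; rewrite dotC. Qed.

Definition dot_lin := (dotDl, dotDr, dotNl, dotNr, dotZl, dotZr, dot0l, dot0r).

Lemma dot_ge0 u : 0 <= dot u u.
Proof. by rewrite dotE sumr_ge0// => i _; rewrite -expr2 sqr_ge0. Qed.

Lemma dot_eq0 u : (dot u u == 0) = (u == 0).
Proof.
apply/eqP/eqP => [|->]; last by rewrite dot0l.
rewrite dotE => /eqP; rewrite psumr_eq0; last by move=> i _; rewrite -expr2 sqr_ge0.
move=> /allP H; apply/rowP => i; rewrite mxE.
by have := H i (mem_index_enum _); rewrite /= -expr2 sqrf_eq0 => /eqP.
Qed.

Lemma dot_gt0 u : u != 0 -> 0 < dot u u.
Proof. by move=> u0; rewrite lt_neqAle dot_ge0 eq_sym dot_eq0 u0. Qed.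

Lemma dot_mulmxl m (M : 'M[R]_(m, n)) (u : 'rV_m) v :
  dot (u *m M) v = dot u (v *m M^T).
Proof. by rewrite /dot trmx_mul trmxK mulmxA. Qed.

Lemma dot_orth (L : 'M[R]_n) u v : L *m L^T = 1%:M -> dot (u *m L) (v *m L) = dot u v.
Proof. by move=> LL; rewrite dot_mulmxl -mulmxA LL mulmx1. Qed.

Lemma eq_of_dot (u v : 'rV[R]_n) : (forall w, dot u w = dot v w) -> u = v.
Proof.
move=> H; by apply/eqP; rewrite -subr_eq0 -dot_eq0 dotBl H subrr.
Qed.

(** Finitely many hyperplanes do not cover the space: a vector that is good for the tail but
    orthogonal to [a] is moved by a small multiple of [a]. *)
Lemma generic_vector (S : seq 'rV[R]_n) :
  (forall a, a \in S -> a != 0) -> exists d, forall a, a \in S -> dot d a != 0.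
Proof.
elim: S => [|a S IH] S0; first by exists 0.
have [|d Hd] := IH; first by move=> b bS; apply: S0; rewrite inE bS orbT.
have [da|da] := eqVneq (dot d a) 0; last first.
  by exists d => b; rewrite inE => /orP[/eqP ->|/Hd].
have a0 := S0 a (mem_head _ _).
have [|e e0 He] := @seq_small R _ S (fun b t => dot (d + t *: a) b != 0).
  move=> b bS; have db := Hd _ bS.
  have [ab|ab] := eqVneq (dot a b) 0.
    by exists 1 => // t _ _; rewrite !dot_lin ab mulr0 addr0.
  have lt0 : 0 < `|dot d b| / (2 * `|dot a b|).
    by rewrite divr_gt0 ?mulr_gt0 ?normr_gt0.
  exists (`|dot d b| / (2 * `|dot a b|)) => // t t0 te.
  rewrite !dot_lin; apply/eqP => H.
  have : `|dot d b| = t * `|dot a b|.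
    by rewrite -[t]gtr0_norm// -normrM -normrN; congr `|_|; lra.
  move: te; rewrite ler_pdivlMr ?mulr_gt0 ?normr_gt0// => te E.
  by have := db; rewrite -normr_gt0; lra.
exists (d + e *: a) => b; rewrite inE => /orP[/eqP ->|bS]; last by apply: He.
by rewrite !dot_lin da add0r mulf_neq0 ?gt_eqF// dot_gt0.
Qed.

End Dot.

Lemma edist_eq (R : realType) n m (u v : 'rV[R]_n) (p q : 'rV[R]_m) :
  edist u v = edist p q <-> dot (u - v) (u - v) = dot (p - q) (p - q).
Proof.
rewrite /edist; split => [H|->//].
by rewrite -[LHS]sqr_sqrtr ?dot_ge0// H sqr_sqrtr ?dot_ge0.
Qed.

Lemma seq_argmin (R : realType) (T : eqType) (S : seq T) (P : pred T) (F : T -> R) :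
  has P S -> exists a, [/\ a \in S, P a & forall b, b \in S -> P b -> F a <= F b].
Proof.
elim: S => [//|a S IH]; rewrite [has _ _]/=.
have [hS _|hS] := boolP (has P S); last first.
  rewrite orbF => Pa; exists a; split => //; first exact: mem_head.
  move=> b; rewrite inE => /orP[/eqP -> //|bS] Pb.
  by case/hasP: hS; exists b.
have [b [bS Pb Hb]] := IH hS.
have [Pa|Pa] := boolP (P a); last first.
  exists b; split => //; first by rewrite inE bS orbT.
  by move=> c; rewrite inE => /orP[/eqP ->|/Hb//]; rewrite (negPf Pa).
have [ab|ba] := leP (F a) (F b).
  exists a; split => //; first exact: mem_head.
  move=> c; rewrite inE => /orP[/eqP -> //|cS] Pc.
  by rewrite (le_trans ab)// Hb.
exists b; split => //; first by rewrite inE bS orbT.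
move=> c; rewrite inE => /orP[/eqP -> _|/Hb//]; exact: ltW.
Qed.

(** * Root systems *)

Section Roots.
Variables (R : realType) (n : nat) (Phi : {fset 'rV[R]_n}).
Variable hPhi : root_system Phi.
Implicit Types (u v w a b d p q x y g : 'rV[R]_n).

Lemma root_nz a : a \in Phi -> a != 0.
Proof. by apply: contraTneq => ->; exact: root_neq0 hPhi. Qed.

Lemma root_dot_gt0 a : a \in Phi -> 0 < dot a a.
Proof. by move=> /root_nz /dot_gt0. Qed.

Lemma reflection_id a : a != 0 -> reflection a a = - a.
Proof.
move=> a0; rewrite /reflection mulfK ?gt_eqF ?dot_gt0//.
by rewrite scaler_nat mulr2n opprD addrA subrr add0r.
Qed.

Lemma rootN a : a \in Phi -> - a \in Phi.
Proof. by move=> aP; rewrite -reflection_id ?root_nz//; apply: (root_reflection hPhi). Qed.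

Lemma root_dot_sep v : (forall a, a \in Phi -> dot v a = 0) -> v = 0.
Proof.
move=> H; apply: eq_of_dot => w; rewrite dot0l.
have : w \in <<Phi>>%VS by rewrite (root_span hPhi) memvf.
move=> /(@coord_span _ _ _ (in_tuple Phi) w) ->.
rewrite dot_sumr big1// => i _; rewrite dotZr H ?mulr0//.
by apply: mem_nth; rewrite -[X in (_ < X)%N]/(size Phi).
Qed.

Lemma dim_gt0 : (0 < n)%N.
Proof.
have /fset0Pn[a aP] := root_nonempty hPhi.
have := root_nz aP; case: (n) a {aP} => [|//] a.
by rewrite [a]thinmx0 eqxx.
Qed.

(** A norm, because the roots span. It can be estimated wall by wall: reflections permute its
    summands, and two points of one closed cell are at distance at most [size Phi]. *)
Definition root_norm v : R := \sum_(a <- Phi) `|dot v a|.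

Lemma root_norm_ge0 v : 0 <= root_norm v.
Proof. by apply: sumr_ge0. Qed.

Lemma root_norm_ge a v : a \in Phi -> `|dot v a| <= root_norm v.
Proof.
move=> aP; rewrite /root_norm (big_rem a)//= lerDl; exact: sumr_ge0.
Qed.

Lemma root_norm_le v (C : R) : (forall a, a \in Phi -> `|dot v a| <= C) ->
  root_norm v <= C * (size Phi)%:R.
Proof.
move=> H; rewrite /root_norm.
rewrite (@le_trans _ _ (\sum_(a <- Phi) C))//; first by rewrite big_seq [leRHS]big_seq ler_sum.
by rewrite big_const_seq count_predT iter_addr_0 mulr_natr.
Qed.

Lemma root_normD u v : root_norm (u + v) <= root_norm u + root_norm v.
Proof.
by rewrite -big_split ler_sum// => a _; rewrite dotDl ler_normD.
Qed.

Lemma root_normZ c v : root_norm (c *: v) = `|c| * root_norm v.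
Proof. by rewrite /root_norm mulr_sumr; apply: eq_bigr => a _; rewrite dotZl normrM. Qed.

Lemma root_normN v : root_norm (- v) = root_norm v.
Proof. by rewrite -scaleN1r root_normZ normrN1 mul1r. Qed.

Lemma root_normB u v : root_norm (u - v) <= root_norm u + root_norm v.
Proof. by rewrite -[root_norm v]root_normN root_normD. Qed.

Lemma root_norm0 : root_norm 0 = 0.
Proof. by rewrite -(scale0r 0) root_normZ normr0 mul0r. Qed.

Lemma root_norm_sum (I : Type) (r : seq I) (P : pred I) (F : I -> 'rV[R]_n) :
  root_norm (\sum_(i <- r | P i) F i) <= \sum_(i <- r | P i) root_norm (F i).
Proof.
elim/big_rec2: _ => [|i x y _ H]; first by rewrite root_norm0.
by rewrite (le_trans (root_normD _ _))// lerD2l.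
Qed.

(** Expand [g] in the spanning set of roots; the summand 1 only makes the constant positive. *)
Lemma dot_bound g : exists2 C, 0 < C & forall v, `|dot v g| <= C * root_norm v.
Proof.
have : g \in <<Phi>>%VS by rewrite (root_span hPhi) memvf.
move=> /(@coord_span _ _ _ (in_tuple Phi) g) gE.
set c := fun i => _ in gE.
exists (1 + \sum_(i < size Phi) `|coord (in_tuple Phi) i g|).
  by rewrite ltr_pwDl// sumr_ge0.
move=> v; rewrite {1}gE dot_sumr mulrDl mul1r.
rewrite (le_trans (ler_norm_sum _ _ _))//.
rewrite (@le_trans _ _ ((\sum_(i < size Phi) `|coord (in_tuple Phi) i g|) * root_norm v))//; last first.
  by rewrite lerDr root_norm_ge0.
rewrite mulr_suml ler_sum// => i _; rewrite dotZr normrM ler_wpM2l//.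
by apply: root_norm_ge; apply: mem_nth; rewrite -[X in (_ < X)%N]/(size Phi).
Qed.

Lemma dot_self_bound : exists2 C, 0 < C & forall v, dot v v <= C * root_norm v ^+ 2.
Proof.
have /choice[c Hc] : forall i : 'I_n, exists c, 0 < c /\
    forall v, `|v 0 i| <= c * root_norm v.
  move=> i.
  have [C C0 HC] := dot_bound (delta_mx 0 i); exists C; split=> // v.
  rewrite (le_trans _ (HC v))// dotE (bigD1 i)//= big1 => [|j ji].
    by rewrite mxE !eqxx mulr1 addr0.
  by rewrite mxE (negPf ji) mulr0.
exists (1 + \sum_i c i ^+ 2); first by rewrite ltr_pwDl// sumr_ge0// => i _; rewrite sqr_ge0.
move=> v; rewrite mulrDl mul1r -[leLHS]add0r lerD ?sqr_ge0//.
rewrite dotE mulr_suml ler_sum// => i _; rewrite -exprMn -expr2 -real_normK ?num_real//.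
by rewrite ler_sqr ?nnegrE ?normr_ge0//; [case: (Hc i)|
  rewrite mulr_ge0 ?root_norm_ge0// ltW//; case: (Hc i)].
Qed.

Lemma dot_reflection a u v : dot (reflection a u) v = dot u (reflection a v).
Proof.
rewrite /reflection !dot_lin (dotC a v); ring.
Qed.

Lemma reflectionK a : a != 0 -> involutive (reflection a).
Proof.
move=> a0 v; rewrite /reflection !dot_lin mulfVK ?gt_eqF ?dot_gt0//.
have -> : 2 * (dot v a - 2 * dot v a) / dot a a = - (2 * dot v a / dot a a) by ring.
by rewrite scaleNr opprK subrK.
Qed.

Lemma root_norm_reflection a v : a \in Phi ->
  root_norm (reflection a v) = root_norm v.
Proof.
move=> aP; rewrite /root_norm.
rewrite [RHS](perm_big (map (reflection a) Phi)).
  by rewrite big_map; apply: eq_bigr => b _; rewrite dot_reflection.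
have inj : {in Phi &, injective (reflection a)}.
  by move=> x y _ _; apply/inv_inj/reflectionK/root_nz.
apply: uniq_perm; rewrite ?fset_uniq ?map_inj_in_uniq ?fset_uniq//.
move=> x; apply/idP/mapP => [xP|[y yP ->]].
  by exists (reflection a x); rewrite ?reflectionK ?root_nz//; apply: (root_reflection hPhi).
exact: (root_reflection hPhi).
Qed.

(** The orthogonal reflection in the hyperplane [dot v a = k], a wall when [k] is an integer and [a]
    a root. *)
Definition areflection a (k : R) v : 'rV[R]_n :=
  v - (2 * (dot v a - k) / dot a a) *: a.

Lemma areflection_normal a k v : a != 0 ->
  dot (areflection a k v) a = 2 * k - dot v a.
Proof.
by move=> a0; rewrite /areflection !dot_lin mulfVK ?gt_eqF ?dot_gt0//; ring.
Qed.

Lemma areflectionK a k : a != 0 -> involutive (areflection a k).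
Proof.
move=> a0 v; rewrite {1}/areflection areflection_normal// /areflection.
rewrite -addrA -opprD -scalerDl -mulrDl.
have -> : 2 * (dot v a - k) + 2 * (2 * k - dot v a - k) = 0 by ring.
by rewrite mul0r scale0r subr0.
Qed.

Lemma areflection_fix a k v : dot v a = k -> areflection a k v = v.
Proof. by move=> E; rewrite /areflection E subrr mulr0 mul0r scale0r subr0. Qed.

(** The crystallographic condition makes the shift [m] an integer, so reflections in walls permute
    the walls. *)
Lemma areflection_dot a (k : int) b : a \in Phi -> b \in Phi ->
  exists m : int, forall v, dot (areflection a k%:~R v) b = dot v (reflection a b) + m%:~R.
Proof.
move=> aP bP; have /intrP[m Hm] := root_crystallographic hPhi aP bP.
exists (k * m) => v; rewrite /areflection /reflection !dot_lin intrM -Hm (dotC a b); ring.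
Qed.

Lemma areflection_coweight a (k : int) x : a \in Phi -> coweight Phi x ->
  coweight Phi (areflection a k%:~R x).
Proof.
move=> aP Hx b bP; have [m ->] := areflection_dot k aP bP.
by rewrite rpredD ?intr_int//; apply: Hx; apply: (root_reflection hPhi).
Qed.

(** The sign of the correction tells whether the hyperplane separates [v] from [w]: if it does, the
    reflection brings [v] closer to [w]. All gallery descents rest on this identity. *)
Lemma areflection_dist a k v w : a != 0 ->
  dot (areflection a k v - w) (areflection a k v - w) =
  dot (v - w) (v - w) + 4 * (dot v a - k) * (dot w a - k) / dot a a.
Proof.
move=> a0; have aa := dot_gt0 a0.
rewrite /areflection !dot_lin (dotC a v) (dotC a w) (dotC w v).
field; exact: lt0r_neq0.
Qed.

(** * Cells *)

Definition generic p : Prop := forall a, a \in Phi -> dot p a \isn't a Num.int.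

Definition cell_verts p : set 'rV[R]_n := closed_cell Phi p `&` cell_vertex Phi.

(** For each root only the largest integer below [dot q a] matters, which reduces infinitely many
    walls to finitely many conditions. *)
Lemma nudge q d : exists2 e, 0 < e & forall t, 0 < t -> t <= e ->
  forall a (k : int), a \in Phi -> k%:~R < dot q a -> k%:~R < dot (q + t *: d) a.
Proof.
have [|e e0 He] := @seq_small R _ Phi
  (fun a t => forall k : int, k%:~R < dot q a -> k%:~R < dot (q + t *: d) a).
  move=> a _; set m := Num.ceil (dot q a) - 1.
  have mq : m%:~R < dot q a.
    by rewrite -ceil_gt_int /m ltrBlDr ltrDl.
  have Hm (k : int) : k%:~R < dot q a -> k <= m.
    by rewrite -ceil_gt_int /m lerBrDr lezD1.
  have lt0 : 0 < (dot q a - m%:~R) / (2 * (1 + `|dot d a|)).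
    by rewrite divr_gt0 ?subr_gt0// mulr_gt0// ltr_pwDl.
  eexists; first exact: lt0.
  move=> t t0; rewrite ler_pdivlMr; last by rewrite mulr_gt0// ltr_pwDl.
  move=> tle k /Hm km; rewrite (@le_lt_trans _ _ m%:~R)// ?ler_int//.
  rewrite dotDl dotZl.
  have : - (t * `|dot d a|) <= t * dot d a.
    by rewrite -mulrN ler_pM2l// lerNl ler_normr lexx orbT.
  by move: tle mq; lra.
by exists e => // t t0 te a k aP; apply: He.
Qed.

Lemma closed_cell_refl p : closed_cell Phi p p.
Proof. by move=> a k. Qed.

Lemma closed_cell_trans p q : closed_cell Phi p q ->
  closed_cell Phi q `<=` closed_cell Phi p.
Proof. by move=> pq v qv a k aP kp; apply: qv => //; apply: pq. Qed.

Lemma closed_cell_ge p v a (k : int) : closed_cell Phi p v -> a \in Phi ->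
  dot p a <= k%:~R -> dot v a <= k%:~R.
Proof.
move=> pv aP pk; have := pv (- a) (- k) (rootN aP).
by rewrite !dotNr intrN !lerN2; apply.
Qed.

Lemma closed_cell_tight p v a : closed_cell Phi p v -> a \in Phi ->
  dot p a \is a Num.int -> dot v a = dot p a.
Proof.
move=> pv aP /intrP[k pk]; apply/eqP; rewrite eq_le pk.
by rewrite (closed_cell_ge pv)// ?pk// pv// pk.
Qed.

Lemma closed_cell_width p x y a : closed_cell Phi p x -> closed_cell Phi p y ->
  a \in Phi -> dot x a - dot y a <= 1.
Proof.
move=> px py aP; have /andP[pl pu] := floor_itv (dot p a).
have := py _ _ aP pl; have := closed_cell_ge px aP (ltW pu).
by rewrite intrD; lra.
Qed.

Lemma generic_closed_cell p q : generic q -> closed_cell Phi p q ->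
  closed_cell Phi q = closed_cell Phi p.
Proof.
move=> gq pq; apply/seteqP; split; first exact: closed_cell_trans.
move=> v pv a k aP kq; apply: pv => //.
have [//|pk] := leP k%:~R (dot p a).
have := closed_cell_ge pq aP (ltW pk); move=> qk.
have /negP[] := gq a aP; apply/intrP; exists k; apply/eqP; rewrite eq_le kq qk//.
Qed.

Lemma nudge_cell q d : exists2 e, 0 < e & forall t, 0 < t -> t <= e ->
  closed_cell Phi (q + t *: d) q.
Proof.
have [e e0 He] := nudge q d; exists e => // t t0 te a k aP.
have [//|qk] := leP k%:~R (dot q a).
have := He t t0 te (- a) (- k) (rootN aP).
by rewrite !dotNr intrN !ltrN2 => /(_ qk) H1 H2; move: (lt_le_trans H1 H2); rewrite ltxx.
Qed.

(** A slight move along [d] leaves every wall transversal to [d] and reaches no new one transversal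
    to it. The direction may lie in some walls, which [wall_generic] exploits. *)
Lemma nudge_nonint q d : exists2 e, 0 < e & forall t, 0 < t -> t <= e ->
  (forall a, a \in Phi -> dot d a != 0 -> dot (q + t *: d) a \isn't a Num.int) /\
  closed_cell Phi (q + t *: d) q.
Proof.
have [e e0 He] := nudge q d; have [e' e'0 He'] := nudge_cell q d.
exists (Num.min e e'); first by rewrite lt_min e0 e'0.
move=> t t0; rewrite le_min => /andP[te te']; split; last exact: He'.
move=> a aP gd; apply/negP => /intrP[k Hk].
wlog da : a aP k Hk gd / 0 < dot d a.
  move=> H; have := gd; rewrite neq_lt => /orP[da|]; last exact: H Hk _.
  apply: (H (- a) (rootN aP) (- k)); rewrite dotNr ?Hk ?intrN ?oppr_gt0//.
  by rewrite oppr_eq0.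
have [kq|qk] := ltP k%:~R (dot q a).
  by have := He t t0 te a k aP kq; rewrite Hk ltxx.
have := He' t t0 te' a k aP; rewrite Hk => /(_ (lexx _)) kq.
have E : dot q a = k%:~R by apply/eqP; rewrite eq_le kq qk.
by move: Hk; rewrite dotDl dotZl E => /eqP; rewrite -subr_eq0 addrAC subrr add0r
  mulf_eq0 !gt_eqF.
Qed.

Lemma nudge_generic q d : (forall a, a \in Phi -> dot d a != 0) ->
  exists2 e, 0 < e & forall t, 0 < t -> t <= e ->
  generic (q + t *: d) /\ closed_cell Phi (q + t *: d) q.
Proof.
move=> gd; have [e e0 He] := nudge_nonint q d; exists e => // t t0 te.
by have [H ?] := He t t0 te; split=> // a aP; apply: H => //; apply: gd.
Qed.

Lemma generic_nudge q d : generic q -> exists2 e, 0 < e & forall t, 0 < t -> t <= e ->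
  closed_cell Phi q (q + t *: d).
Proof.
move=> gq; have [e e0 He] := nudge q d; exists e => // t t0 te a k aP kq.
apply/ltW/He => //; rewrite lt_neqAle kq andbT; apply/eqP => E.
by have /negP[] := gq a aP; apply/intrP; exists k.
Qed.

(** Every point lies in a closed alcove: nudge it in a direction orthogonal to no root. *)
Lemma exists_generic q : exists2 p, generic p & closed_cell Phi p q.
Proof.
have [d Hd] := generic_vector (fun a (aP : a \in (Phi : seq _)) => root_nz aP).
have [e e0 He] := nudge_generic q Hd.
by have [] := He e e0 (lexx _); exists (q + e *: d).
Qed.

(* A functional is minimized over a cell at a vertex: from a point that is not a
   vertex move along its cell until one more root takes an integral value. *)
Lemma closed_cell_min g q : exists v, cell_verts q v /\ dot v g <= dot q g.
Proof.
have [m] := ubnP (count (fun a => dot q a \isn't a Num.int) Phi).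
elim: m q => // m IH q; rewrite ltnS => cm.
have [vq|/eqP nvq] := pselect (cell_vertex Phi q).
  by exists q; split=> //; split=> //; apply: closed_cell_refl.
have [r [qr rq]] : exists r, closed_cell Phi q r /\ r != q.
  apply: contrapT => H; move: nvq => /eqP []; apply/seteqP; split => [r qr|r ->] /=.
    by apply: contrapT => /eqP rq; apply: H; exists r.
  exact: closed_cell_refl.
(* Roots integral at [q] are constant on its cell, so both [r - q] and [q - r] are admissible
   directions; the sign is chosen so that [g] does not increase. *)
have [d [dq d0 dg]] : exists d, [/\ forall a, a \in Phi -> dot q a \is a Num.int ->
    dot d a = 0, d != 0 & dot d g <= 0].
  have [rg|rg] := leP (dot (r - q) g) 0.
    exists (r - q); rewrite subr_eq0; split => // a aP /(closed_cell_tight qr aP) E.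
    by rewrite dotBl E subrr.
  exists (q - r); rewrite subr_eq0 eq_sym; split => // [a aP|].
    by move=> /(closed_cell_tight qr aP) E; rewrite dotBl E subrr.
  by rewrite -opprB dotNl oppr_le0 ltW.
have hd : has (fun a => 0 < dot d a) Phi.
  apply/hasP; apply: contrapT => H; move: d0 => /eqP; apply; apply: root_dot_sep => a aP.
  apply/eqP; rewrite eq_le; apply/andP; split; rewrite leNgt; apply/negP => Ha.
    by apply: H; exists a.
  by apply: H; exists (- a); [exact: rootN|rewrite dotNr oppr_gt0].
(* The time at which the ray from [q] along [d] reaches the next wall of [a]; up to the smallest
   such time the ray stays in the closed cell of [q]. *)
pose F a := ((Num.floor (dot q a) + 1)%:~R - dot q a) / dot d a.
have [b [bP db Hb]] := seq_argmin F hd.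
have Fb0 : 0 < F b.
  by rewrite divr_gt0// subr_gt0; case/andP: (floor_itv (dot q b)).
set q' := q + F b *: d.
have up a : a \in Phi -> 0 < dot d a -> dot q' a <= (Num.floor (dot q a) + 1)%:~R.
  move=> aP da; have := Hb a aP da; rewrite {2}/F ler_pdivlMr// /q' dotDl dotZl; lra.
have qq' : closed_cell Phi q q'.
  move=> a k aP kq; have [da|da] := leP 0 (dot d a).
    by rewrite /q' dotDl dotZl (le_trans kq)// lerDl mulr_ge0// ltW.
  have := up _ (rootN aP); rewrite !dotNr oppr_gt0 => /(_ da).
  suff : k <= - (Num.floor (- dot q a) + 1) by rewrite -(ler_int R) !intrN; lra.
  suff : Num.floor (- dot q a) < - k by lia.
  rewrite floor_lt_int intrN ltrN2 lt_neqAle kq andbT; apply/eqP => E.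
  by move: da; rewrite dq ?ltxx//; apply/intrP; exists k.
have tb : dot q' b \is a Num.int.
  by rewrite /q' dotDl dotZl /F mulfVK ?gt_eqF// addrC subrK intr_int.
have ntb : dot q b \isn't a Num.int.
  by apply/negP => /(dq _ bP) E; move: db; rewrite E ltxx.
have sub a : a \in Phi -> dot q a \is a Num.int -> dot q' a \is a Num.int.
  by move=> aP qa; rewrite (closed_cell_tight qq').
have [|v [[q'v vv] vg]] := IH q'.
  apply: leq_trans cm.
  have := perm_to_rem bP => /permP Hperm; rewrite !Hperm /= tb ntb /= add0n add1n ltnS.
  rewrite -!size_filter; apply: uniq_leq_size; first by rewrite filter_uniq ?rem_uniq ?fset_uniq.
  move=> a; rewrite !mem_filter => /andP[na aP]; rewrite aP andbT.
  by apply: contra na; apply: sub; apply: mem_rem aP.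
exists v; split; first by split=> //; apply: closed_cell_trans q'v.
by rewrite (le_trans vg)// /q' dotDl dotZl gerDl mulr_ge0_le0// ltW.
Qed.

Lemma closed_cell_max g q : exists v, cell_verts q v /\ dot q g <= dot v g.
Proof.
have [v [vq]] := closed_cell_min (- g) q; rewrite !dotNr lerN2 => ?; by exists v.
Qed.

(** Extrema over a cell are attained at vertices, so [g] would be constant on the whole cell; but
    the cell of a generic point contains a nudge along [g] itself. *)
Lemma generic_nondegenerate c g (t : R) : generic c ->
  (forall v, cell_verts c v -> dot v g = t) -> g = 0.
Proof.
move=> gc H; have [e e0 He] := generic_nudge g gc.
have E q : closed_cell Phi c q -> dot q g = t.
  move=> cq; have [v [[qv vv] vg]] := closed_cell_min g q.
  have [w [[qw vw] wg]] := closed_cell_max g q.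
  apply/eqP; rewrite eq_le; apply/andP; split.
    by rewrite -(H w)//; split=> //; apply: closed_cell_trans qw.
  by rewrite -(H v)//; split=> //; apply: closed_cell_trans qv.
have := E _ (He e e0 (lexx _)); rewrite dotDl dotZl E; last exact: closed_cell_refl.
move=> /eqP; rewrite -subr_eq0 addrAC subrr add0r mulf_eq0 gt_eqF//=.
by rewrite dot_eq0 => /eqP.
Qed.

Lemma coweight_vertex x : coweight Phi x -> cell_vertex Phi x.
Proof.
move=> cx; apply/seteqP; split=> [y xy|y ->] /=; last exact: closed_cell_refl.
apply/eqP; rewrite -subr_eq0; apply/eqP/root_dot_sep => a aP.
by rewrite dotBl (closed_cell_tight xy)// ?subrr//; apply: cx.
Qed.

Lemma vertices_coxeter v : vertices (coxeter_complex Phi) v <-> cell_vertex Phi v.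
Proof.
split=> [[p E]|vv].
  have : [set v] v by []. by rewrite E => -[].
exists v; apply/seteqP; split => [w ->|w []] /=; last by rewrite vv.
by split=> //; apply: closed_cell_refl.
Qed.

(* The special vertex closest to a generic point lies in its alcove: otherwise
   reflecting it in a separating wall brings it closer. *)
Lemma generic_coweight c : generic c -> exists2 x, coweight Phi x & cell_verts c x.
Proof.
move=> gc.
have [|e e0 He] := @seq_small R _ Phi (fun a t =>
    forall k : int, k%:~R <= dot c a -> t * dot a a <= 4 * (dot c a - k%:~R)).
  move=> a aP; have aa := root_dot_gt0 aP.
  have lt0 : 0 < 4 * (dot c a - (Num.floor (dot c a))%:~R) / dot a a.
    rewrite divr_gt0// mulr_gt0// subr_gt0 lt_neqAle floor_le andbT; apply/eqP => E.
    by have /negP[] := gc a aP; rewrite -E intr_int.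
  exists (4 * (dot c a - (Num.floor (dot c a))%:~R) / dot a a) => // t t0.
  rewrite ler_pdivlMr// => H k; rewrite -floor_ge_int -(ler_int R); lra.
have := @real_descent R _ (fun x => dot (x - c) (x - c)) e (coweight Phi)
  (fun _ => exists2 x, coweight Phi x & closed_cell Phi c x) e0.
move=> /(_ (fun x _ => dot_ge0 _)) H.
have : exists2 x, coweight Phi x & closed_cell Phi c x.
  apply: (H _ 0); last by move=> a aP; rewrite dot0l int_num0.
  move=> x cx; have [cc|ncc] := pselect (closed_cell Phi c x).
    by left; exists x.
  right; have [a [k [aP kc xk]]] : exists a (k : int),
      [/\ a \in Phi, k%:~R <= dot c a & dot x a < k%:~R].
    apply: contrapT => N; apply: ncc => a k aP kc; rewrite leNgt; apply/negP => xk.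
    by apply: N; exists a, k.
  exists (areflection a k%:~R x); split=> //; first exact: areflection_coweight.
  rewrite areflection_dist ?root_nz// lerD2l lerNr -mulNr ler_pdivlMr ?root_dot_gt0//.
  (* Since [dot x a] is an integer below [k], the factor of [areflection_dist] coming from [x] is at
     least 1, and the drop is bounded below in terms of [c] alone. *)
  have le1 : 1 <= k%:~R - dot x a.
    have /intrP[m Hm] := cx a aP; move: xk; rewrite Hm ltr_int.
    by rewrite -intrB -[leLHS]/(1%:~R) ler_int; lia.
  have := He a aP e e0 (lexx _) k kc => E.
  have c0 : 0 <= dot c a - k%:~R by rewrite subr_ge0.
  rewrite (le_trans E)//; have := ler_peMl c0 le1; lra.
move=> [x cx ccx]; exists x => //; split=> //; exact: coweight_vertex.
Qed.

End Roots.

(** * Alcoves and galleries *)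

Lemma dot_polar (R : realType) n (x y : 'rV[R]_n) :
  dot x y = (dot x x + dot y y - dot (x - y) (x - y)) / 2.
Proof. rewrite !dot_lin (dotC y x); lra. Qed.

Lemma mulmx_tr_dot (R : realType) m n (g : 'rV[R]_n) (Q : 'M[R]_(m, n)) j :
  (g *m Q^T) 0 j = dot g (row j Q).
Proof. by rewrite dotE mxE; apply: eq_bigr => l _; rewrite !mxE. Qed.

Section Alcoves.
Variables (R : realType) (n : nat) (Phi : {fset 'rV[R]_n}).
Variable hPhi : root_system Phi.
Local Notation K := (coxeter_complex Phi).
Local Notation cell_verts := (cell_verts Phi).
Variable hK : piecewise_euclidean K (@edist R n).
Implicit Types (u w a b c d p q x y g : 'rV[R]_n).

(** Affine independence is read off the edge lengths: by polarization the Gram matrix of the edge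
    vectors is that of a nondegenerate simplex, hence invertible. *)
Lemma simplex_enum s : K s -> exists m (v : 'I_m.+1 -> 'rV[R]_n),
  s = range v /\ row_free (\matrix_(i < m) (v (lift ord0 i) - v ord0)).
Proof.
move=> /hK[m [v [p [-> Pfree len]]]]; exists m, v; split=> //.
set P := (\matrix_i _) in Pfree; set Q := \matrix_i _.
have E : Q *m Q^T = P *m P^T.
  apply/matrixP => i j.
  have dE k (M : 'M[R]_(m, k)) : (M *m M^T) i j = dot (row i M) (row j M).
    by rewrite dotE mxE; apply: eq_bigr => l _; rewrite !mxE.
  rewrite !dE !rowK dot_polar [RHS]dot_polar.
  have lenE k l : dot (v k - v l) (v k - v l) = dot (p k - p l) (p k - p l).
    exact/edist_eq/len.
  by rewrite !lenE !opprB !addrA !subrK !lenE.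
have Pu : P *m P^T \in unitmx.
  by rewrite unitmx_mul unitmx_tr -row_free_unit Pfree.
rewrite /row_free eqn_leq rank_leq_row -[X in (X <= _)%N](mxrank_unit Pu) -E.
exact: mxrankM_maxl.
Qed.

Definition alcove_enum c (v : 'I_n.+1 -> 'rV[R]_n) : Prop :=
  generic Phi c /\ cell_verts c = range v.

(** A root integral at [p] would put all vertices of the cell in one hyperplane, so [p] is generic;
    comparing ranks then gives exactly [n.+1] vertices. *)
Lemma nondeg_simplex p : (forall g (t : R), (forall v, cell_verts p v -> dot v g = t) -> g = 0) ->
  exists v, alcove_enum p v.
Proof.
move=> nd.
have gp : generic Phi p.
  move=> a aP; apply/negP => pa; move: (root_nz hPhi aP) => /eqP; apply.
  by apply: (nd a (dot p a)) => v [pv _]; apply: closed_cell_tight pv aP pa.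
have [|m [v [E Qf]]] := @simplex_enum (cell_verts p); first by exists p.
set Q := (\matrix_i _) in Qf.
have mn : m = n.
  apply/eqP; rewrite eqn_leq.
  have -> : (m <= n)%N by rewrite -(eqP Qf) rank_leq_col.
  have Qt : row_free Q^T.
    apply: inj_row_free => g gQ; apply: (nd g (dot (v ord0) g)) => w.
    rewrite E => -[i _ <-]; have [j|] := unliftP ord0 i; last by move=> ->.
    move=> ->; apply/eqP; rewrite -subr_eq0 -dotBl dotC; apply/eqP.
    by have := mulmx_tr_dot g Q j; rewrite gQ rowK mxE => <-.
  by rewrite -(eqP Qt) rank_leq_col.
by subst m; exists v.
Qed.

Lemma generic_enum c : generic Phi c -> exists v, alcove_enum c v.
Proof.
move=> gc; apply: nondeg_simplex => g t; exact: (generic_nondegenerate hPhi).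
Qed.

Lemma diff_unit (v : 'I_n.+1 -> 'rV[R]_n) i :
  (forall g (t : R), (forall j, dot (v j) g = t) -> g = 0) ->
  \matrix_j (v (lift i j) - v i) \in unitmx.
Proof.
move=> nd; set Q := \matrix_j _.
rewrite -unitmx_tr -row_free_unit; apply: inj_row_free => g gQ.
apply: (nd g (dot (v i) g)) => k; have [j|] := unliftP i k; last by move=> ->.
move=> ->; apply/eqP; rewrite -subr_eq0 -dotBl dotC; apply/eqP.
by have := mulmx_tr_dot g Q j; rewrite gQ rowK mxE => <-.
Qed.

Lemma alcove_enum_nondeg c v : alcove_enum c v ->
  forall g (t : R), (forall j, dot (v j) g = t) -> g = 0.
Proof.
move=> [gc E] g t H; apply: (generic_nondegenerate hPhi gc (t := t)) => w.
by rewrite E => -[j _ <-].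
Qed.

Lemma alcove_enum_unit c v i : alcove_enum c v ->
  \matrix_j (v (lift i j) - v i) \in unitmx.
Proof. by move=> /alcove_enum_nondeg/diff_unit. Qed.

(** With [n.+1] vertices the edge vectors form a basis, so the vertices lie in no hyperplane. This
    links the cardinality in (B2) to alcoves. *)
Lemma card_simplex_generic s : K s -> s #= `I_n.+1 ->
  exists c v, alcove_enum c v /\ s = cell_verts c.
Proof.
move=> Ks cs; have [m [v [E Qf]]] := simplex_enum Ks.
have [p sp] := Ks.
have vinj : injective v.
  set Q := (\matrix_i _) in Qf.
  have QE i : v (lift ord0 i) - v ord0 = delta_mx 0 i *m Q by rewrite -rowE rowK.
  have Q0 i : v (lift ord0 i) <> v ord0.
    move=> /eqP; rewrite -subr_eq0 QE -(mul0mx _ Q) => /eqP /(row_free_inj Qf).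
    by move=> /(congr1 (fun M : 'M_(_, _) => M 0 i))/eqP; rewrite !mxE !eqxx oner_eq0.
  move=> i j; have [i'|] := unliftP ord0 i; have [j'|] := unliftP ord0 j; move=> -> ->.
  - move=> /(congr1 (fun z => z - v ord0)); rewrite !QE => /(row_free_inj Qf).
    move=> /(congr1 (fun M : 'M_(_, _) => M 0 i'))/eqP; rewrite !mxE !eqxx /=.
    by have [->//|_] := eqVneq i' j'; rewrite oner_eq0.
  - by move=> /Q0.
  - by move=> /esym/Q0.
  - by [].
have mn : m = n.
  apply: succn_inj; apply/card_eq_II; rewrite (card_eq_trans _ cs)// card_eq_sym.
  rewrite E (card_eq_trans (inj_card_eq (in2W vinj)))// card_eq_sym; exact: card_II.
have cv i : cell_verts p (v i) by rewrite /cell_verts -sp E; exists i.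
suff [v' H] : exists v', alcove_enum p v' by exists p, v'; split.
apply: nondeg_simplex => g t H; subst m.
set Q := (\matrix_i _) in Qf.
have Qu : Q^T \in unitmx by rewrite unitmx_tr -row_free_unit.
have : g *m Q^T = 0.
  apply/rowP => j; rewrite mulmx_tr_dot rowK mxE.
  by rewrite dotC dotBl (H _ (cv _)) (H _ (cv _)) subrr.
by move=> gQ; rewrite -(mulmxK Qu g) gQ mul0mx.
Qed.

(** The wall carries the facet opposite to [v i], and [a] is signed so that the alcove lies on its
    positive side. *)
Definition facet_wall (v : 'I_n.+1 -> 'rV[R]_n) i a (k : int) : Prop :=
  [/\ a \in Phi, forall j, j != i -> dot (v j) a = k%:~R & k%:~R < dot (v i) a].

(* If no wall passed through the barycentre of a facet, the cell would extend
   beyond that facet. *)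
Lemma facet_exists c v i : alcove_enum c v -> exists a k, facet_wall v i a k /\ k%:~R < dot c a.
Proof.
move=> ev; have Qu := alcove_enum_unit i ev; have [gc E] := ev.
have n0 := dim_gt0 hPhi; have n0R : n%:R != 0 :> R by rewrite pnatr_eq0 -lt0n.
set Q := (\matrix_i _) in Qu.
(* The functional whose value at every vertex of the facet is one less than at [v i], so that the
   facet is where [g] is minimal on the alcove. *)
set g := const_mx (-1) *m invmx Q^T : 'rV_n.
have gE j : dot (v (lift i j)) g = dot (v i) g - 1.
  have := mulmx_tr_dot g Q j; rewrite mulmxKV ?unitmx_tr// rowK mxE dotC dotBl; lra.
have gmin j : dot (v i) g - 1 <= dot (v j) g.
  by have [j' ->|->] := unliftP i j; rewrite ?gE// lerBlDr lerDl.
have cv j : closed_cell Phi c (v j) by have [] : cell_verts c (v j) by rewrite E; exists j.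
have avg (t : R) : n%:R^-1 * (\sum_(j < n) t) = t.
  by rewrite sumr_const card_ord -[t *+ n]mulr_natl mulrA mulVf ?mul1r.
have [q qdot] : exists q, forall b, dot q b = n%:R^-1 * \sum_j dot (v (lift i j)) b.
  by exists (n%:R^-1 *: \sum_j v (lift i j)) => b; rewrite dotZl dot_suml.
have cq : closed_cell Phi c q.
  move=> b m bP cb; rewrite qdot -[m%:~R]avg ler_pM2l ?invr_gt0 ?ltr0n//.
  by apply: ler_sum => j _; apply: cv.
have qg : dot q g = dot (v i) g - 1 by rewrite qdot -[RHS]avg; congr *%R; apply: eq_bigr.
have g0 : g != 0.
  apply/eqP => g0; have := gE (Ordinal n0); rewrite g0 !dot0r; lra.
have [a [aP aq ca]] : exists a, [/\ a \in Phi, dot q a \is a Num.int & dot q a <= dot c a].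
  apply: contrapT => N.
  have gq : generic Phi q.
    move=> a aP; apply/negP => qa; apply: N.
    have [H|H] := leP (dot q a) (dot c a); first by exists a.
    exists (- a); rewrite !dotNr rootN// rpredN lerN2; split=> //; exact: ltW.
  have [e e0 He] := generic_nudge (- g) gq.
  have [w [[qw vw] wg]] := closed_cell_min hPhi g (q + e *: - g).
  have [j _ jw] : range v w.
    rewrite -E; split=> //; apply: closed_cell_trans qw.
    by apply: closed_cell_trans cq _ _; apply: He.
  have := gmin j; rewrite jw; move: wg; rewrite !dot_lin qg.
  by have := mulr_gt0 e0 (dot_gt0 g0); lra.
move: aq => /intrP[k qk]; exists a, k.
have cak : k%:~R < dot c a.
  rewrite lt_neqAle -qk ca andbT; apply/eqP => H.
  by have /negP[] := gc a aP; apply/intrP; exists k; rewrite -H.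
have va j : k%:~R <= dot (v j) a by apply: cv => //; apply: ltW.
have fa j : j != i -> dot (v j) a = k%:~R.
  have [j' -> _|->] := unliftP i j; last by rewrite eqxx.
  have : \sum_j (dot (v (lift i j)) a - k%:~R) = 0.
    rewrite big_split /= sumrN; apply: (mulfI (_ : n%:R^-1 != 0)); first by rewrite invr_eq0.
    by rewrite mulr0 mulrBr avg -qdot qk subrr.
  move=> /eqP; rewrite psumr_eq0; last by move=> l _; rewrite subr_ge0.
  by move=> /allP /(_ j' (mem_index_enum _)); rewrite subr_eq0 => /eqP.
split=> //; split=> //; rewrite lt_neqAle va andbT; apply/eqP => H.
have a0 : a = 0.
  apply: (alcove_enum_nondeg ev (t := k%:~R)) => j.
  by have [->|/fa//] := eqVneq j i.
by have := root_nz hPhi aP; rewrite a0 eqxx.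
Qed.

Lemma barycentric c v d : alcove_enum c v ->
  exists b : 'I_n.+1 -> R, \sum_i b i = 1 /\ d = \sum_i b i *: v i.
Proof.
move=> ev; have Qu := alcove_enum_unit ord0 ev; set Q := (\matrix_i _) in Qu.
set y := (d - v ord0) *m invmx Q.
set b := fun i => if unlift ord0 i is Some j then y 0 j else 1 - \sum_j y 0 j.
have b0 : b ord0 = 1 - \sum_j y 0 j by rewrite /b unlift_none.
have bl j : b (lift ord0 j) = y 0 j by rewrite /b liftK.
exists b; rewrite !big_ord_recl b0 !(eq_bigr _ (fun j _ => bl j)) subrK.
split=> //; rewrite (eq_bigr _ (fun j _ => congr1 (fun t => t *: _) (bl j))).
have H : \sum_j y 0 j *: v (lift ord0 j) - (\sum_j y 0 j) *: v ord0 = d - v ord0.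
  rewrite -[d - v ord0](mulmxKV Qu) -/y mulmx_sum_row scaler_suml -sumrB.
  by apply: eq_bigr => j _; rewrite rowK scalerBr.
rewrite scalerBl scale1r.
by rewrite addrAC -addrA H addrC subrK.
Qed.

(** If no facet wall separates, each root of a facet wall shows that one barycentric coordinate of
    [d] is nonnegative; then [d] lies in the closed alcove and, being generic, has the same cell. *)
Lemma separating_facet c v d : alcove_enum c v -> generic Phi d ->
  closed_cell Phi c <> closed_cell Phi d ->
  exists i a (k : int), [/\ facet_wall v i a k, k%:~R < dot c a & dot d a < k%:~R].
Proof.
move=> ev gd ncd; apply: contrapT => N; apply: ncd; apply/esym.
apply: (generic_closed_cell hPhi) => //.
have [b [b1 dE]] := barycentric d ev.
have b0 i : 0 <= b i.
  have [a [k [[aP fa ia] ca]]] := facet_exists i ev.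
  have : k%:~R <= dot d a.
    rewrite leNgt; apply/negP => dk; apply: N; exists i, a, k; split=> //.
  have -> : k%:~R = \sum_j b j * k%:~R :> R by rewrite -mulr_suml b1 mul1r.
  rewrite dE dot_suml -subr_ge0 -sumrB (bigD1 i)//= big1 => [|j ji].
    by rewrite addr0 dotZl -mulrBr pmulr_lge0// subr_gt0.
  by rewrite dotZl fa// subrr.
move=> a k aP ca; rewrite dE dot_suml.
have -> : k%:~R = \sum_j b j * k%:~R :> R by rewrite -mulr_suml b1 mul1r.
apply: ler_sum => j _; rewrite dotZl ler_wpM2l//.
have [_ E] := ev; have [vj _] : cell_verts c (v j) by rewrite E; exists j.
exact: vj.
Qed.

Lemma areflection_closed_cell a (k : int) p v : a \in Phi ->
  closed_cell Phi p v -> closed_cell Phi (areflection a k%:~R p) (areflection a k%:~R v).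
Proof.
move=> aP pv b m bP; have [l E] := areflection_dot hPhi k aP bP; rewrite !E.
rewrite -!lerBlDr -intrB; apply: pv; exact: (root_reflection hPhi).
Qed.

Lemma areflection_closed_cellE a (k : int) p v : a \in Phi ->
  closed_cell Phi (areflection a k%:~R p) v <-> closed_cell Phi p (areflection a k%:~R v).
Proof.
move=> aP; have r := areflectionK k%:~R (root_nz hPhi aP); split=> H.
  by rewrite -[p]r; apply: areflection_closed_cell.
by rewrite -[v]r; apply: areflection_closed_cell.
Qed.

Lemma areflection_cell_vertex a (k : int) v : a \in Phi ->
  cell_vertex Phi (areflection a k%:~R v) <-> cell_vertex Phi v.
Proof.
move=> aP; have r := areflectionK k%:~R (root_nz hPhi aP).
suff H w : cell_vertex Phi w -> cell_vertex Phi (areflection a k%:~R w).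
  by split=> [/H|/H//]; rewrite r.
rewrite /cell_vertex => E; apply/seteqP; split => x /=.
  by move=> H; have := (areflection_closed_cellE _ _ _ aP).1 H; rewrite E => /= <-; rewrite r.
by move=> ->; apply: closed_cell_refl.
Qed.

Lemma areflection_cell_verts a (k : int) p : a \in Phi ->
  cell_verts (areflection a k%:~R p) = areflection a k%:~R @` cell_verts p.
Proof.
move=> aP; have r := areflectionK k%:~R (root_nz hPhi aP).
apply/seteqP; split => [x [px vx]|_ [x [px vx] <-]].
  exists (areflection a k%:~R x); last by rewrite r.
  by split; [apply/areflection_closed_cellE|apply/areflection_cell_vertex].
by split; [apply: areflection_closed_cell|apply/areflection_cell_vertex].
Qed.

(* A quantitative form of [generic] that is invariant under reflections. *)
Definition separated (e : R) p : Prop :=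
  forall a (k : int), a \in Phi -> e <= `|dot p a - k%:~R|.

Lemma separated_generic e p : 0 < e -> separated e p -> generic Phi p.
Proof.
move=> e0 H a aP; apply/negP => /intrP[k E].
by have := H a k aP; rewrite E subrr normr0 leNgt e0.
Qed.

Lemma generic_separated p : generic Phi p -> exists2 e, 0 < e & separated e p.
Proof.
move=> gp; have [|e e0 He] := @seq_small R _ Phi
    (fun a t => forall k : int, k%:~R <= dot p a -> t <= dot p a - k%:~R).
  move=> a aP; exists (dot p a - (Num.floor (dot p a))%:~R).
    rewrite subr_gt0 lt_neqAle floor_le andbT; apply/eqP => E.
    by have /negP[] := gp a aP; rewrite -E intr_int.
  by move=> t t0 te k; rewrite -floor_ge_int -(ler_int R); lra.
exists e => // a k aP; have [kp|pk] := leP k%:~R (dot p a).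
  by rewrite ger0_norm ?subr_ge0//; apply: He.
have := He _ (rootN hPhi aP) e e0 (lexx _) (- k).
rewrite dotNr intrN lerN2 => /(_ (ltW pk)) H.
by rewrite ler0_norm ?subr_le0; [rewrite opprB addrC; rewrite opprK in H | exact: ltW].
Qed.

Lemma areflection_separated e a (k : int) p : a \in Phi -> separated e p ->
  separated e (areflection a k%:~R p).
Proof.
move=> aP H b m bP; have [l ->] := areflection_dot hPhi k aP bP.
rewrite -addrA -opprB -intrB; apply: H; exact: (root_reflection hPhi).
Qed.

(** By [areflection_dist] the drop is at least [4 * e * f / dot a a], which is uniform since there
    are finitely many roots. *)
Lemma separated_descent e f : 0 < e -> 0 < f -> exists2 h, 0 < h &
  forall c d a (k : int), separated e c -> separated f d -> a \in Phi ->
    k%:~R < dot c a -> dot d a < k%:~R ->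
    dot (areflection a k%:~R c - d) (areflection a k%:~R c - d) <= dot (c - d) (c - d) - h.
Proof.
move=> e0 f0; have [|h h0 Hh] := @seq_small R _ Phi (fun a t => t * dot a a <= 4 * e * f).
  move=> a aP; have aa := root_dot_gt0 hPhi aP.
  exists (4 * e * f / dot a a) => [|t _]; last by rewrite ler_pdivlMr.
  by rewrite divr_gt0 ?mulr_gt0.
exists h => // c d a k sc sd aP kc dk.
rewrite areflection_dist ?root_nz// ?(root_nz hPhi)// lerD2l lerNr -mulNr.
rewrite ler_pdivlMr ?(root_dot_gt0 hPhi)// (le_trans (Hh _ aP h h0 (lexx _)))//.
have := sc a k aP; have := sd a k aP.
rewrite ltr0_norm ?subr_lt0// gtr0_norm ?subr_gt0// => fd ec.
have := ler_pM (ltW e0) (ltW f0) ec fd; lra.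
Qed.

(** Induction along galleries. As long as the alcove of [c] differs from that of [d], reflect [c] in
    a facet wall separating them. Reflections preserve [separated Phi e], so the squared distance to
    [d] drops by a fixed amount and the gallery ends. *)
Lemma gallery_ind (e : R) (P : 'rV[R]_n -> Prop) c0 :
  0 < e -> separated e c0 -> P c0 ->
  (forall c v i a (k : int), separated e c -> alcove_enum c v -> facet_wall v i a k ->
     P c -> P (areflection a k%:~R c)) ->
  forall d, generic Phi d ->
  exists c, [/\ separated e c, P c & closed_cell Phi c = closed_cell Phi d].
Proof.
move=> e0 s0 P0 step d gd.
have [f f0 sf] := generic_separated gd; have [h h0 Hh] := separated_descent e0 f0.
apply: (@real_descent R _ (fun c => dot (c - d) (c - d)) h
  (fun c => separated e c /\ P c) (fun _ => _) h0 _ _ c0) => // [c _|c [sc Pc]].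
  exact: dot_ge0.
have [E|ne] := pselect (closed_cell Phi c = closed_cell Phi d).
  by left; exists c.
right; have gc := separated_generic e0 sc; have [v ev] := generic_enum gc.
have [i [a [k [fw kc dk]]]] := separating_facet ev gd ne; have [aP _ _] := fw.
exists (areflection a k%:~R c); split=> //; last exact: Hh.
split; first exact: areflection_separated.
exact: (step c v i).
Qed.

End Alcoves.

(** * Rigidity of the Coxeter complex *)

Section SimplicialIsometries.
Variable R : realType.

(** The inverse is a total function with an arbitrary value off the vertices, hence the
    inhabitedness assumption. *)
Lemma simplicial_isometry_inv (T T' : Type) (K : set (set T)) (len : T -> T -> R)
    (K' : set (set T')) (len' : T' -> T' -> R) (f : T -> T') :
  (exists x : T, True) ->
  (forall s, K' s -> s `<=` vertices K') ->
  simplicial_isometry K len K' len' f ->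
  exists g, [/\ simplicial_isometry K' len' K len g,
    forall x, vertices K x -> g (f x) = x & forall y, vertices K' y -> f (g y) = y].
Proof.
move=> [x0 _] sub [[fK finj fsurj] fs fl].
have /choice[g Hg] : forall y, exists x, vertices K' y -> vertices K x /\ f x = y.
  move=> y; have [|n] := pselect (vertices K' y); last by exists x0.
  by move=> /fsurj[x Kx <-]; exists x.
have gf x : vertices K x -> g (f x) = x.
  move=> Kx; have [Kg E] := Hg _ (fK _ Kx).
  by apply: finj; rewrite ?inE.
have fg y : vertices K' y -> f (g y) = y by move=> /Hg[].
have gs s : s `<=` vertices K' -> g @` s `<=` vertices K.
  by move=> sK _ [y /sK/Hg[Ky _] <-].
have fgs s : s `<=` vertices K' -> f @` (g @` s) = s.
  move=> sK; apply/seteqP; split => [_ [_ [y sy <-] <-]|y sy]; first by rewrite fg//; apply: sK.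
  by exists (g y); [exists y|rewrite fg//; apply: sK].
exists g; split=> //; split.
- split=> [y /Hg[]//|y z|x Kx].
    by rewrite !inE => /fg Ey /fg Ez E; rewrite -Ey -Ez E.
  by exists (f x); [apply: fK|apply: gf].
- move=> s sK; rewrite -{1}(fgs s sK); split=> H.
    by apply/fs => //; apply: gs.
  by apply/fs => //; apply: gs.
- move=> u v [uv Kuv]; have uK : vertices K' u by apply: sub Kuv _ _; left.
  have vK : vertices K' v by apply: sub Kuv _ _; right.
  rewrite -[in RHS](fg u uK) -[in RHS](fg v vK) fl//; split.
    by move=> E; apply: uv; rewrite -(fg u uK) -(fg v vK) E.
  have E : f @` [set g u; g v] = [set u; v].
    by rewrite image_setU !image_set1 !fg.
  apply/fs; last by rewrite E.
  by move=> _ [->|->]; [have [] := Hg u uK | have [] := Hg v vK].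
Qed.

Lemma simplicial_isometry_comp (T T' T'' : Type) (K : set (set T)) (len : T -> T -> R)
    (K' : set (set T')) (len' : T' -> T' -> R) (K'' : set (set T'')) (len'' : T'' -> T'' -> R)
    (f : T -> T') (g : T' -> T'') :
  (forall s, K s -> s `<=` vertices K) ->
  simplicial_isometry K len K' len' f -> simplicial_isometry K' len' K'' len'' g ->
  simplicial_isometry K len K'' len'' (g \o f).
Proof.
move=> sub [[fK finj fsurj] fs fl] [[gK ginj gsurj] gs gl]; split.
- split=> [x /fK/gK//|x y /set_mem Kx /set_mem Ky /= E|z /gsurj[y /fsurj[x Kx <-] <-]].
    by apply: finj; rewrite ?inE//; apply: ginj; rewrite ?inE//; apply: fK.
  by exists x.
- move=> s sK; have -> : (g \o f) @` s = g @` (f @` s) by rewrite image_comp.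
  rewrite fs// gs// => _ [x /sK/fK ? <-] //.
- move=> u v [uv Kuv].
  have uK : vertices K u by apply: sub Kuv _ _; left.
  have vK : vertices K v by apply: sub Kuv _ _; right.
  rewrite /= gl ?fl//; split.
    by move=> E; apply: uv; apply: finj; rewrite ?inE.
  have -> : [set f u; f v] = f @` [set u; v] by rewrite image_setU !image_set1.
  by apply/fs => // x [->|->].
Qed.

End SimplicialIsometries.

(** Equal distances give equal Gram matrices of the edge vectors, which makes [invmx Q *m Q']
    orthogonal. Matrices act on row vectors from the right. *)
Lemma isometry_extend (R : realType) n (v w : 'I_n.+1 -> 'rV[R]_n) :
  (forall g (t : R), (forall j, dot (v j) g = t) -> g = 0) ->
  (forall i j, dot (w i - w j) (w i - w j) = dot (v i - v j) (v i - v j)) ->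
  exists L t, L *m L^T = 1%:M /\ forall i, w i = v i *m L + t.
Proof.
move=> nd len; have := diff_unit ord0 nd; set Q := \matrix_j _ => Qu.
pose Q' := \matrix_j (w (lift ord0 j) - w ord0).
have E : Q' *m Q'^T = Q *m Q^T.
  apply/matrixP => i j.
  have dE (M : 'M[R]_n) : (M *m M^T) i j = dot (row i M) (row j M).
    by rewrite dotE mxE; apply: eq_bigr => l _; rewrite !mxE.
  by rewrite !dE !rowK dot_polar [RHS]dot_polar !opprB !addrA !subrK !len.
exists (invmx Q *m Q'), (w ord0 - v ord0 *m (invmx Q *m Q')); split.
  rewrite trmx_mul mulmxA -[X in X *m _]mulmxA E mulmxA mulVmx// mul1mx trmx_inv mulmxV//.
  by rewrite unitmx_tr.
move=> i; rewrite addrCA -mulmxBl; have [j ->|->] := unliftP ord0 i; last first.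
  by rewrite subrr mul0mx addr0.
have -> : v (lift ord0 j) - v ord0 = row j Q by rewrite rowK.
by rewrite mulmxA -row_mul mulmxV// -row_mul mul1mx rowK addrC subrK.
Qed.

Lemma affine_inverse (R : realType) n (v : 'I_n.+1 -> 'rV[R]_n) (L L' : 'M[R]_n) t t' :
  (forall g (t : R), (forall j, dot (v j) g = t) -> g = 0) -> L *m L^T = 1%:M ->
  (forall j, v j = (v j *m L + t) *m L' + t') -> L' = L^T.
Proof.
move=> nd LL E; have := diff_unit ord0 nd; set Q := \matrix_j _ => Qu.
have E2 j : v j *m (L *m L') = v j - (t *m L' + t').
  by apply/eqP; rewrite eq_sym subr_eq addrA mulmxA -mulmxDl -E.
have QE : Q *m (L *m L') = Q.
  by apply/row_matrixP => j; rewrite row_mul rowK mulmxBl !E2 opprB addrA subrK.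
have H : L *m L' = 1%:M by rewrite -[LHS](mulKmx Qu) QE mulVmx.
by rewrite -[L']mul1mx -(mulmx1C LL) -mulmxA H mulmx1.
Qed.

(** A point with prescribed distances to the vertices of a facet is determined up to reflection in
    the hyperplane of that facet. *)
Lemma reflected_point (R : realType) n (v : 'I_n.+1 -> 'rV[R]_n) i a k w :
  (forall g (t : R), (forall j, dot (v j) g = t) -> g = 0) ->
  (forall j, j != i -> dot (v j) a = k) -> k < dot (v i) a ->
  (forall j, j != i -> dot (w - v j) (w - v j) = dot (v i - v j) (v i - v j)) ->
  w != v i -> w = areflection a k (v i).
Proof.
move=> nd va kv dist; rewrite -subr_eq0 => d0.
have [d wE] : exists d, w = v i + d by exists (w - v i); rewrite addrC subrK.
have {}d0 : d != 0 by move: d0; rewrite wE addrAC subrr add0r.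
have vk : dot (v i) a - k != 0 by rewrite subr_eq0 gt_eqF.
(* Equality of distances reads [dot (v i - v j) d = - (dot d d / 2)] for all [j != i], whereas
   [dot (v i - v j) a] is [dot (v i) a - k]; so [d] and [t *: a] have the same pairings. *)
pose t := - (dot d d / 2) / (dot (v i) a - k).
have dE : d = t *: a.
  apply/eqP; rewrite -subr_eq0; apply/eqP.
  apply: (nd _ (dot (v i) (d - t *: a))) => j; have [->//|ji] := eqVneq j i.
  have H := dist j ji; have Ej := va j ji.
  have : dot (v i - v j) d = - (dot d d / 2).
    move: H; rewrite wE !dot_lin (dotC d (v i)) (dotC d (v j)) (dotC (v j) (v i)); lra.
  have Ht : t * (dot (v i) a - k) = - (dot d d / 2) by rewrite divfK.
  by rewrite !dot_lin Ej; lra.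
have t0 : t != 0 by apply: contraNneq d0 => t0; rewrite dE t0 scale0r.
have a0 : a != 0 by apply: contraNneq d0 => a0; rewrite dE a0 scaler0.
have Ht : t * (dot (v i) a - k) = - (t * t * dot a a / 2).
  by rewrite divfK// dE !dot_lin mulrA.
rewrite wE {1}dE /areflection; congr (_ + _); rewrite -scaleNr; congr (_ *: _).
have aa := lt0r_neq0 (dot_gt0 a0).
have -> : dot (v i) a - k = - (t * dot a a / 2) by apply: (mulfI t0); rewrite Ht; ring.
by field.
Qed.

Section Rigidity.
Variables (R : realType) (n : nat) (Phi : {fset 'rV[R]_n}).
Variable hPhi : root_system Phi.
Local Notation K := (coxeter_complex Phi).
Local Notation cell_verts := (cell_verts Phi).
Variable hK : piecewise_euclidean K (@edist R n).
Variable hF : face_closed K.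
Implicit Types (u w a b c d p q x y g : 'rV[R]_n).

Lemma simplex_vertices s : K s -> s `<=` vertices K.
Proof.
by move=> Ks x sx; apply: (hF Ks) => [_ -> //|]; exists x.
Qed.

Lemma cell_verts_simplex p : K (cell_verts p).
Proof. by exists p. Qed.

Section Isometry.
Variable h : 'rV[R]_n -> 'rV[R]_n.
Variable hh : simplicial_isometry K (@edist R n) K (@edist R n) h.

Lemma isometry_dist s x y : K s -> s x -> s y ->
  dot (h x - h y) (h x - h y) = dot (x - y) (x - y).
Proof.
move=> Ks sx sy; have [->|xy] := pselect (x = y); first by rewrite !subrr.
apply/edist_eq/(isometry_len hh); split=> //; apply: (hF Ks); last by exists x; left.
by move=> z [->|->].
Qed.

Lemma isometry_inj x y : vertices K x -> vertices K y -> h x = h y -> x = y.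
Proof. by move=> Kx Ky E; have [_ inj _] := isometry_bij hh; apply: inj; rewrite ?inE. Qed.

(** One alcove determines an affine isometry, and agreement propagates along galleries: across a
    facet only one vertex is new, its distances to the facet leave two candidates, and injectivity
    excludes the old vertex. *)
Lemma isometry_affine : exists L t, L *m L^T = 1%:M /\
  forall x, vertices K x -> h x = x *m L + t.
Proof.
have [c0 gc0 _] := exists_generic hPhi 0.
have [v0 ev0] := generic_enum hPhi hK gc0.
have v0c j : cell_verts c0 (v0 j) by have [_ ->] := ev0; exists j.
have [L [t [LL E0]]] := isometry_extend (alcove_enum_nondeg hPhi ev0)
  (fun i j => isometry_dist (cell_verts_simplex c0) (v0c i) (v0c j)).
have LL' : L^T *m L = 1%:M by apply: mulmx1C.
exists L, t; split=> //.
have [e e0 se] := generic_separated hPhi gc0.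
pose P c := forall x, cell_verts c x -> h x = x *m L + t.
have P0 : P c0 by move=> x; have [_ ->] := ev0; move=> [j _ <-].
have step c v i a (k : int) : separated Phi e c -> alcove_enum Phi c v ->
    facet_wall Phi v i a k -> P c -> P (areflection a k%:~R c).
  move=> _ ev [aP va kv] Pc x; rewrite areflection_cell_verts//.
  have [_ Ec] := ev; have vc j : cell_verts c (v j) by rewrite Ec; exists j.
  rewrite Ec => -[_ [j _ <-] <-].
  have [->|ji] := eqVneq j i; last first.
    by rewrite (areflection_fix (va j ji)); apply: Pc.
  set r := areflection _ _ _; set c' := areflection a k%:~R c.
  have Kc' := cell_verts_simplex c'.
  have rc' : cell_verts c' r by rewrite areflection_cell_verts//; exists (v i).
  have vc' l : l != i -> cell_verts c' (v l).
    by move=> li; rewrite areflection_cell_verts//; exists (v l) => //; rewrite areflection_fix// va.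
  have a0 := root_nz hPhi aP.
  have ra : dot r a = 2 * k%:~R - dot (v i) a by rewrite areflection_normal.
  have rK : vertices K r by apply: simplex_vertices rc'.
  have viK : vertices K (v i) by apply: (simplex_vertices (cell_verts_simplex c)).
  have back y : ((y - t) *m L^T) *m L + t = y by rewrite -mulmxA LL' mulmx1 subrK.
  have E : (h r - t) *m L^T = r.
    apply: (reflected_point (alcove_enum_nondeg hPhi ev) va kv) => [l li|].
      have -> : (h r - t) *m L^T - v l = (h r - h (v l)) *m L^T.
        have vlE : v l = (h (v l) - t) *m L^T by rewrite (Pc _ (vc l)) addrK -mulmxA LL mulmx1.
        by rewrite {1}vlE -mulmxBl opprB addrA subrK.
      rewrite dot_orth ?trmxK// (isometry_dist Kc' rc' (vc' _ li)).
      have := areflection_dist k%:~R (v i) (v l) a0; rewrite -/r => ->.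
      by rewrite (va l li) subrr mulr0 mul0r addr0.
    apply/eqP => E.
    have : h r = h (v i) by rewrite (Pc _ (vc i)) -E back.
    move=> /(isometry_inj rK viK) H; move: ra; rewrite H => ra.
    by move: kv; lra.
  by rewrite -{2}E back.
move=> x /vertices_coxeter vx; have [p gp px] := exists_generic hPhi x.
have [c [_ Pc cp]] := gallery_ind hPhi hK e0 se P0 step gp.
by apply: Pc; split=> //; rewrite cp.
Qed.

(** From the foot of the perpendicular from 0 on the hyperplane, nudge along a direction inside it
    that is orthogonal to no root other than the multiples of [b]. *)
Lemma wall_generic b (k : R) : b \in Phi -> exists2 q, dot q b = k &
  forall a, a \in Phi -> dot q a \is a Num.int -> exists s, a = s *: b.
Proof.
move=> bP; have bb := lt0r_neq0 (root_dot_gt0 hPhi bP).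
pose pr a := a - (dot a b / dot b b) *: b.
have prb a : dot (pr a) b = 0 by rewrite /pr !dot_lin mulfVK// subrr.
have [d0 Hd0] := @generic_vector R n [seq pr a | a <- Phi & pr a != 0]
  (fun x => ltac:(move=> /mapP[a]; rewrite mem_filter => /andP[? _] -> //)).
have [d [db dE]] : exists d, dot d b = 0 /\ forall a, dot d a = dot d0 (pr a).
  by exists (pr d0); split=> // a; rewrite /pr !dot_lin (dotC b a); field.
have [e e0 He] := nudge_nonint hPhi ((k / dot b b) *: b) d.
have [H _] := He e e0 (lexx _).
exists ((k / dot b b) *: b + e *: d); first by rewrite !dot_lin mulfVK// db mulr0 addr0.
move=> a aP qa; have [pa|pa] := eqVneq (pr a) 0.
  by exists (dot a b / dot b b); apply/eqP; rewrite -subr_eq0 -/(pr a) pa.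
have da : dot d a != 0.
  by rewrite dE; apply: Hd0; apply/mapP; exists a; rewrite // mem_filter pa.
by have := H a aP da; rewrite qa.
Qed.

(** Take an alcove whose closure contains a point [q] of the wall that is on no wall of another
    direction. If [q] missed all facet walls, its barycentric coordinates would be positive, and a
    root with a one-sided bound on the vertices that is attained at [q] would be constant on the
    alcove. *)
Lemma wall_facet b (k : int) : b \in Phi -> exists c v i, alcove_enum Phi c v /\
  forall j, j != i -> dot (v j) b = k%:~R.
Proof.
move=> bP0.
have [q qb0 Hq0] := wall_generic k%:~R bP0.
have [p gp pq] := exists_generic hPhi q; have [v ev] := generic_enum hPhi hK gp.
have [b' [k' [bP qb Hq bE pb]]] : exists b' (k' : int), [/\ b' \in Phi, dot q b' = k'%:~R,
    forall a, a \in Phi -> dot q a \is a Num.int -> exists s, a = s *: b',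
    forall x, dot x b' = k'%:~R -> dot x b = k%:~R & k'%:~R <= dot p b'].
  have [H|H] := leP k%:~R (dot p b); first by exists b, k; split.
  exists (- b), (- k); split; rewrite ?rootN ?dotNr ?qb0 ?intrN//.
  - move=> a aP /(Hq0 a aP)[s ->]; exists (- s); by rewrite scaleNr scalerN opprK.
  - by move=> x; rewrite dotNr => /oppr_inj.
  - by rewrite lerN2 ltW.
have vp j : closed_cell Phi p (v j) by have [_ E] := ev; have [] : cell_verts p (v j) by rewrite E; exists j.
have [be [be1 qE]] := barycentric hPhi q ev.
have /choice[f Hf] : forall i, exists ak, facet_wall Phi v i ak.1 ak.2 /\ ak.2%:~R < dot p ak.1.
  by move=> i; have [a [m H]] := facet_exists hPhi i ev; exists (a, m).
have [i qi] : exists i, dot q (f i).1 = (f i).2%:~R.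
  apply: contrapT => N.
  have bei i : 0 < be i.
    have [[aP fa ia] ca] := Hf i.
    have : (f i).2%:~R < dot q (f i).1.
      rewrite lt_neqAle pq ?andbT//; last exact: ltW.
      by apply/eqP => E; apply: N; exists i.
    have {1}-> : (f i).2%:~R = \sum_j be j * (f i).2%:~R :> R by rewrite -mulr_suml be1 mul1r.
    rewrite qE dot_suml -subr_gt0 -sumrB (bigD1 i)//= big1 => [|j ji].
      by rewrite addr0 dotZl -mulrBr pmulr_lgt0// subr_gt0.
    by rewrite dotZl fa// subrr.
  have b0 : b' = 0.
    apply: (alcove_enum_nondeg hPhi ev (t := k'%:~R)) => j.
    have : \sum_j be j * (dot (v j) b' - k'%:~R) = 0.
      under eq_bigr => l _ do rewrite mulrBr.
      rewrite sumrB -mulr_suml be1 mul1r -qb qE dot_suml.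
      by under [X in _ - X]eq_bigr => l _ do rewrite dotZl; rewrite subrr.
    move=> /eqP; rewrite psumr_eq0 => [|l _]; last first.
      by apply: mulr_ge0; [exact: ltW|rewrite subr_ge0 vp].
    move=> /allP /(_ j (mem_index_enum _)); rewrite mulf_eq0 gt_eqF//= subr_eq0.
    by move=> /eqP.
  by have := root_nz hPhi bP; rewrite b0 eqxx.
have [[aP fa ia] _] := Hf i; have [s sE] := Hq _ aP (ltac:(apply/intrP; exists (f i).2; exact: qi)).
exists p, v, i; split=> // j ji; apply: bE.
have s0 : s != 0 by apply: contraNneq (root_nz hPhi aP) => s0; rewrite sE s0 scale0r.
by have := fa j ji; rewrite -qi sE !dotZr => /(mulfI s0) ->.
Qed.

(** The automorphism maps an alcove with a facet on the wall to an alcove, whose corresponding facet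
    spans a wall of some root [a]. Both normals are constant on the same facet, hence
    proportional. *)
Lemma isometry_wall L t b (k : int) : L *m L^T = 1%:M ->
  (forall x, vertices K x -> h x = x *m L + t) -> b \in Phi ->
  exists a s, [/\ a \in Phi, b *m L = s *: a, s != 0 &
    forall x, dot x b = k%:~R -> dot (x *m L + t) a \is a Num.int].
Proof.
move=> LL hE bP; have LL' : L^T *m L = 1%:M by apply: mulmx1C.
have [c [v [i [ev vb]]]] := wall_facet k bP.
have [gc Ec] := ev; have vc j : cell_verts c (v j) by rewrite Ec; exists j.
have vE j : h (v j) = v j *m L + t by apply: hE; apply: simplex_vertices (vc j); apply: cell_verts_simplex.
have nd := alcove_enum_nondeg hPhi ev.
have [p pE] : K (h @` cell_verts c).
  apply/(isometry_simplex hh (simplex_vertices (cell_verts_simplex c))).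
  exact: cell_verts_simplex.
have ev' : alcove_enum Phi p (h \o v).
  have pE' : cell_verts p = range (h \o v) by rewrite /cell_verts -pE Ec image_comp.
  split=> //; suff [v' []] : exists v', alcove_enum Phi p v' by [].
  apply: nondeg_simplex => // g s H.
  have : g *m L^T = 0.
    apply: (nd _ (s - dot t g)) => j; rewrite -dot_mulmxl.
    by rewrite -(H (h (v j))) ?pE'; [rewrite vE dotDl addrK | exists j].
  by move=> /(congr1 (mulmx^~ L)); rewrite -mulmxA LL' mulmx1 mul0mx.
have [a [m [[aP fa ia] _]]] := facet_exists hPhi i ev'.
have vib : dot (v i) b - k%:~R != 0.
  rewrite subr_eq0; apply/eqP => E; have := root_nz hPhi bP.
  by rewrite (nd b k%:~R) ?eqxx// => j; have [->|/vb] := eqVneq j i.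
have fa' j : j != i -> dot (v j) (a *m L^T) = m%:~R - dot t a.
  by move=> ji; rewrite -dot_mulmxl -(fa j ji) /= vE dotDl addrK.
pose s := (dot (v i) (a *m L^T) - (m%:~R - dot t a)) / (dot (v i) b - k%:~R).
have aE : a *m L^T = s *: b.
  apply/eqP; rewrite -subr_eq0; apply/eqP.
  apply: (nd _ (dot (v i) (a *m L^T - s *: b))) => j; have [->//|ji] := eqVneq j i.
  have : s * (dot (v i) b - k%:~R) = dot (v i) (a *m L^T) - (m%:~R - dot t a) by rewrite divfK.
  by rewrite !dotBr !dotZr (vb _ ji) (fa' _ ji); lra.
have aE' : a = s *: (b *m L) by rewrite scalemxAl -aE -mulmxA LL' mulmx1.
have s0 : s != 0 by apply: contraNneq (root_nz hPhi aP) => s0; rewrite aE' s0 scale0r.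
exists a, s^-1; split; rewrite ?invr_eq0//; first by rewrite {1}aE' scalerA mulVf// scale1r.
move=> x xb; have [j ji] : exists j, j != i.
  by exists (lift i (Ordinal (dim_gt0 hPhi))); rewrite eq_sym neq_lift.
have := fa' j ji; rewrite aE dotZr (vb j ji) -xb => E.
by rewrite dotDl dot_mulmxl aE dotZr E subrK intr_int.
Qed.

End Isometry.

(** Roots are only asserted to go to multiples of roots, which is all that conjugating reflections
    by [L] takes. *)
Record coxeter_automorphism (L : 'M[R]_n) t : Prop := CoxeterAutomorphism {
  automorphism_orth : L *m L^T = 1%:M;
  automorphism_root : forall a, a \in Phi -> exists b s,
    [/\ b \in Phi, a *m L = s *: b & s != 0];
  automorphism_coweight : forall x, coweight Phi x -> coweight Phi (x *m L + t)
}.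

Lemma rigidity h h' :
  simplicial_isometry K (@edist R n) K (@edist R n) h ->
  simplicial_isometry K (@edist R n) K (@edist R n) h' ->
  (forall x, vertices K x -> h' (h x) = x) ->
  exists L t, coxeter_automorphism L t /\ forall x, vertices K x -> h x = x *m L + t.
Proof.
move=> hh hh' hK'; have [L [t [LL hE]]] := isometry_affine hh.
have [L' [t' [LL' hE']]] := isometry_affine hh'.
exists L, t; split=> //.
have L'E : L' = L^T.
  have [c gc _] := exists_generic hPhi 0; have [v ev] := generic_enum hPhi hK gc.
  have [_ Ec] := ev.
  apply: (affine_inverse (alcove_enum_nondeg hPhi ev) LL (t := t) (t' := t')) => j.
  have vK : vertices K (v j).
    by apply: (simplex_vertices (cell_verts_simplex c)); rewrite Ec; exists j.
  rewrite -hE// -hE' ?hK'//; have [hv _ _] := isometry_bij hh; exact: hv.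
split=> // [a aP|x cx b bP].
  by have [b [s [bP E s0 _]]] := isometry_wall hh 0 LL hE aP; exists b, s.
(* To evaluate [b] at the image of [x], pull its direction back to a root [a]. The wall of [a]
   through [x] goes to a wall of some [b'] proportional to [b], and reducedness gives [b = b'] or
   [b = - b']. *)
have [a [s [aP E s0 _]]] := isometry_wall hh' 0 LL' hE' bP.
have /intrP[k xk] := cx a aP.
have [b' [s' [b'P E' s'0 Hx]]] := isometry_wall hh k LL hE aP.
have bE : b = (s * s') *: b'.
  by rewrite -scalerA -E' scalemxAl -E L'E -mulmxA (mulmx1C LL) mulmx1.
have := Hx x xk.
have [|E1|E1] := root_reduced hPhi (c := s * s') b'P; first by rewrite -bE.
  by rewrite bE E1 scale1r.
by rewrite bE E1 scaleN1r dotNr rpredN.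
Qed.

End Rigidity.

(** * Frames *)

Section Frames.
Variables (R : realType) (n : nat) (Phi : {fset 'rV[R]_n}).
Variable hPhi : root_system Phi.
Local Notation K := (coxeter_complex Phi).
Local Notation cell_verts := (cell_verts Phi).
Implicit Types (u w a b c d p q x y g : 'rV[R]_n).

(** A vertex is not interior to a segment of a closed cell: a wall through it transversal to the
    segment would cut the cell, and if all walls through it contain the direction, its own cell is
    larger than a point. *)
Lemma middle_vertex p x y (s : R) : closed_cell Phi p x -> closed_cell Phi p y ->
  0 < s < 1 -> cell_vertex Phi (x + s *: (y - x)) -> x = y.
Proof.
move=> px py /andP[s0 s1] vz; apply: contrapT => /eqP; rewrite eq_sym -subr_eq0 => d0.
set d := y - x in vz d0; set z := x + s *: d in vz.
have [|H] := pselect (exists a, [/\ a \in Phi, dot z a \is a Num.int & dot d a != 0]).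
  move=> [a [aP /intrP[k zk] da]].
  wlog da0 : a aP k zk da / 0 < dot d a.
    move=> H; have := da; rewrite neq_lt => /orP[da0|]; last exact: H zk da.
    apply: (H (- a) (rootN hPhi aP) (- k)); rewrite dotNr ?zk ?intrN ?oppr_gt0//.
    by rewrite oppr_eq0.
  have xk : dot x a < k%:~R.
    by rewrite -zk /z dotDl dotZl ltrDl mulr_gt0.
  have yk : k%:~R < dot y a.
    have -> : y = z + (1 - s) *: d by rewrite /z -addrA -scalerDl (_ : s + (1 - s) = 1) ?scale1r /d ?(addrC x) ?subrK//; ring.
    by rewrite [ltRHS]dotDl dotZl zk ltrDl mulr_gt0 ?subr_gt0.
  have [kp|pk] := leP k%:~R (dot p a).
    by have := px a k aP kp; rewrite leNgt xk.
  by have := closed_cell_ge hPhi py aP (ltW pk); rewrite leNgt yk.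
have [e e0 He] := nudge Phi z d.
have : closed_cell Phi z (z + e *: d).
  move=> a k aP; rewrite le_eqVlt => /orP[/eqP E|kz]; last exact/ltW/He.
  have [da|da] := eqVneq (dot d a) 0; first by rewrite dotDl dotZl da mulr0 addr0 E.
  by case: H; exists a; split=> //; apply/intrP; exists k.
rewrite vz /= => /eqP; rewrite -subr_eq0 addrAC subrr add0r scaler_eq0 gt_eqF//=.
exact/negP.
Qed.

Lemma closed_cell_translate p q l : coweight Phi l ->
  closed_cell Phi (p + l) (q + l) <-> closed_cell Phi p q.
Proof.
move=> cl; split=> H a k aP; have /intrP[m lm] := cl a aP.
  have := H a (k + m) aP; rewrite !dotDl lm intrD !lerD2r; exact.
by rewrite !dotDl lm -!lerBlDr -intrB; apply: H.
Qed.

Lemma coweightN l : coweight Phi l -> coweight Phi (- l).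
Proof. by move=> cl a aP; rewrite dotNl rpredN cl. Qed.

Lemma coweightD l m : coweight Phi l -> coweight Phi m -> coweight Phi (l + m).
Proof. by move=> cl cm a aP; rewrite dotDl rpredD ?cl ?cm. Qed.

Lemma coweight0 : coweight Phi 0.
Proof. by move=> a _; rewrite dot0l int_num0. Qed.

Lemma coweightB l m : coweight Phi l -> coweight Phi m -> coweight Phi (l - m).
Proof. by move=> cl cm; apply/coweightD/coweightN. Qed.

Lemma cell_vertex_translate q l : coweight Phi l ->
  cell_vertex Phi (q + l) <-> cell_vertex Phi q.
Proof.
suff H q' l' : coweight Phi l' -> cell_vertex Phi q' -> cell_vertex Phi (q' + l').
  move=> cl; split; last exact: H.
  by move=> /(H _ _ (coweightN cl)); rewrite addrK.
move=> cl vq; apply/seteqP; split=> [x H|x -> /=]; last exact: closed_cell_refl.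
have : closed_cell Phi q' (x - l') by apply/(closed_cell_translate _ _ cl); rewrite subrK.
by rewrite vq /= => <-; rewrite subrK.
Qed.

Lemma cell_verts_translate p q l : coweight Phi l ->
  cell_verts (p + l) (q + l) <-> cell_verts p q.
Proof.
by move=> cl; split=> -[/(closed_cell_translate _ _ cl) ? /(cell_vertex_translate _ cl) ?].
Qed.

Lemma edge_translate x y l : coweight Phi l -> edge K x y -> edge K (x + l) (y + l).
Proof.
move=> cl [xy [p E]]; split; first by move=> /addIr.
exists (p + l); apply/seteqP; split => z.
  move=> zxy; rewrite -[z](subrK l); apply/(cell_verts_translate _ _ cl).
  rewrite /cell_verts -E; case: zxy => ->; rewrite addrK; by [left|right].
rewrite -{1}[z](subrK l) => /(cell_verts_translate _ _ cl); rewrite /cell_verts -E.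
by move=> -[H|H]; [left|right]; rewrite -[z](subrK l) H.
Qed.

Lemma generic_translate c l : coweight Phi l -> generic Phi c -> generic Phi (c + l).
Proof.
move=> cl gc a aP; rewrite dotDl; apply/negP => H; have /negP[] := gc a aP.
by rewrite -[dot c a](addrK (dot l a)) rpredB ?cl.
Qed.

Lemma hyperplane_normal a b (s t : R) : a != 0 -> b != 0 ->
  [set v | dot v a = s] = [set v | dot v b = t] -> exists k : R, b = k *: a.
Proof.
move=> a0 b0 E; have aa := lt0r_neq0 (dot_gt0 a0).
exists (dot b a / dot a a); apply/eqP; rewrite -subr_eq0 -dot_eq0; apply/eqP.
set d := b - _; have da : dot d a = 0 by rewrite /d !dot_lin mulfVK// subrr.
pose v := (s / dot a a) *: a.
have va : dot v a = s by rewrite dotZl mulfVK.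
have vb : dot v b = t by have : [set v | dot v a = s] v by []; rewrite E.
have : [set v | dot v a = s] (v + d) by rewrite /= dotDl va da addr0.
rewrite E /= dotDl vb => /eqP; rewrite -subr_eq0 addrAC subrr add0r => /eqP db.
by rewrite [in X in dot _ X]/d dotBr dotZr da mulr0 subr0.
Qed.

(** Parallel walls have proportional normals, and reducedness leaves only [a] and [- a]; so a wall
    through [x] parallel to one of [a] makes [dot x a] integral. *)
Lemma special_coweight x : special_point Phi x <-> coweight Phi x.
Proof.
split=> [[_ H] a aP|cx].
  have [|H' [[b [m [bP ->]]] [t Et] xm]] := H (hyperplane a 0); first by exists a, 0.
  have [|k bE] := @hyperplane_normal a b (dot t a) m%:~R (root_nz hPhi aP) (root_nz hPhi bP).
    rewrite -[RHS]/(hyperplane b m) Et; apply/seteqP; split=> v /=.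
      by move=> va; exists (v - t); rewrite ?subrK//= /hyperplane /= dotBl va subrr.
    by move=> [w wa <-]; rewrite dotDl wa add0r.
  have [|c1|c1] := root_reduced hPhi (c := k) aP; first by rewrite -bE.
    by move: xm; rewrite /hyperplane /= bE c1 scale1r => ->; rewrite intr_int.
  move: xm; rewrite /hyperplane /= bE c1 scaleN1r dotNr => /(canRL opprK) ->.
  by rewrite rpredN intr_int.
split; first exact/vertices_coxeter/coweight_vertex.
move=> _ [a [k [aP ->]]]; have /intrP[m xm] := cx a aP.
exists (hyperplane a m); split=> //; first by exists a, m.
have aa := lt0r_neq0 (root_dot_gt0 hPhi aP).
exists (((m - k)%:~R / dot a a) *: a); apply/seteqP; split=> v; rewrite /hyperplane /=.
  move=> va; exists (v - ((m - k)%:~R / dot a a) *: a); last by rewrite subrK.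
  by rewrite /= dotBl va dotZl mulfVK// intrB; ring.
by move=> [w wa <-]; rewrite dotDl wa dotZl mulfVK// intrB; ring.
Qed.

Definition regular (l : 'rV[R]_n) : Prop := forall a, a \in Phi -> dot l a != 0.

(** For [l] regular, the closed Weyl chamber containing [l]. *)
Definition closed_chamber (l d : 'rV[R]_n) : Prop :=
  forall a, a \in Phi -> 0 < dot l a -> 0 <= dot d a.

Lemma generic_regular c : generic Phi c -> regular c.
Proof. by move=> gc a aP; apply: contraNneq (gc a aP) => ->; rewrite int_num0. Qed.

Lemma alcove0_ge c d a : closed_cell Phi c 0 -> closed_cell Phi c d ->
  a \in Phi -> 0 < dot c a -> 0 <= dot d a.
Proof. by move=> _ cd aP ca; apply: (cd a 0) => //; apply: ltW. Qed.

Lemma edge_width x y a : edge K x y -> a \in Phi -> `|dot x a - dot y a| <= 1.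
Proof.
move=> [_ [p E]] aP.
have [px _] : cell_verts p x by rewrite /cell_verts -E; left.
have [py _] : cell_verts p y by rewrite /cell_verts -E; right.
rewrite ler_norml (closed_cell_width hPhi px py)// andbT lerNl opprB.
exact: (closed_cell_width hPhi py px).
Qed.

(** In its chamber, the alcove at 0 is cut out by the values 0 and 1 of the positive roots, and
    every edge vector satisfies the bound 1 by [edge_width]. *)
Lemma edge_in_chamber c w : generic Phi c -> closed_cell Phi c 0 ->
  edge K 0 w -> closed_chamber c w -> cell_verts c w.
Proof.
move=> gc c0 ew cw; split; last first.
  have [_ [p E]] := ew; have : cell_verts p w by rewrite /cell_verts -E; right.
  by case.
move=> a k aP kc; have := edge_width ew aP; rewrite dot0l sub0r normrN ler_norml => /andP[wl wu].
have := generic_regular gc aP; rewrite neq_lt => /orP[ca|ca].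
  have : k%:~R < (0%:~R : R) by apply: le_lt_trans ca.
  rewrite ltr_int => k0; rewrite (le_trans _ wl)// -[leRHS]/((-1)%:~R) ler_int; lia.
have c1 : dot c a < (1%:~R : R).
  rewrite lt_neqAle; apply/andP; split.
    by apply: contraNneq (gc a aP) => ->; rewrite intr_int.
  by have := closed_cell_width hPhi (@closed_cell_refl _ _ Phi c) c0 aP; rewrite dot0l subr0.
have : k%:~R < (1%:~R : R) by apply: le_lt_trans c1.
rewrite ltr_int => k1; apply: (le_trans _ (cw a aP ca)).
by rewrite -[leRHS]/(0%:~R) ler_int; lia.
Qed.

(* [e l] are the edges at the origin of the alcove of [c], and [al l] is the
   simple root dual to [e l]. *)
Record frame c (e al : 'I_n -> 'rV[R]_n) : Prop := Frame {
  frame_generic : generic Phi c;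
  frame_0 : closed_cell Phi c 0;
  frame_verts : cell_verts c = [set 0] `|` range e;
  frame_nondeg : forall g, (forall l, dot (e l) g = 0) -> g = 0;
  frame_root : forall l, al l \in Phi;
  frame_pos : forall l, 0 < dot c (al l);
  frame_dual : forall l m, l != m -> dot (e l) (al m) = 0;
  frame_dual_gt0 : forall l, 0 < dot (e l) (al l)
}.

Section FrameTheory.
Variables (c : 'rV[R]_n) (e al : 'I_n -> 'rV[R]_n).
Hypothesis fr : frame c e al.

(** [period m *: e m] is the fundamental coweight dual to [al m]; on the ray along [e m] from a
    special point, the special points are spaced by this parameter. *)
Definition period m : R := (dot (e m) (al m))^-1.

Lemma frame_vert m : cell_verts c (e m).
Proof. by rewrite (frame_verts fr); right; exists m. Qed.

Lemma frame_ge0 m a : a \in Phi -> 0 < dot c a -> 0 <= dot (e m) a.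
Proof. by have [H _] := frame_vert m; apply: alcove0_ge H; apply: (frame_0 fr). Qed.

Lemma frame_le1 m a : a \in Phi -> dot (e m) a <= 1.
Proof.
move=> aP; have [H _] := frame_vert m.
by have := closed_cell_width hPhi H (frame_0 fr) aP; rewrite dot0l subr0.
Qed.

Lemma period_ge1 m : 1 <= period m.
Proof.
by rewrite /period invf_ge1 ?(frame_dual_gt0 fr)// frame_le1 ?(frame_root fr).
Qed.

Lemma period_gt0 m : 0 < period m.
Proof. by rewrite invr_gt0 (frame_dual_gt0 fr). Qed.

Lemma period_dot m : period m * dot (e m) (al m) = 1.
Proof. by rewrite mulVf// gt_eqF// (frame_dual_gt0 fr). Qed.

Lemma dot_sum_dual (f : 'I_n -> R) m : dot (\sum_l f l *: e l) (al m) = f m * dot (e m) (al m).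
Proof.
rewrite dot_suml (bigD1 m)//= big1 ?addr0 ?dotZl// => l lm.
by rewrite dotZl (frame_dual fr) ?mulr0.
Qed.

Lemma dot_sum_simple (f : 'I_n -> R) m : dot (e m) (\sum_l f l *: al l) = f m * dot (e m) (al m).
Proof.
rewrite dot_sumr (bigD1 m)//= big1 ?addr0 ?dotZr// => l lm.
by rewrite dotZr (frame_dual fr) ?mulr0// eq_sym.
Qed.

Lemma simple_expand g : g = \sum_l (dot (e l) g * period l) *: al l.
Proof.
apply/eqP; rewrite -subr_eq0; apply/eqP/(frame_nondeg fr) => m.
by rewrite dotBr dot_sum_simple /= -mulrA period_dot mulr1 subrr.
Qed.

Lemma frame_expand x : x = \sum_l (dot x (al l) * period l) *: e l.
Proof.
apply/eqP; rewrite -subr_eq0; apply/eqP/(root_dot_sep hPhi) => a aP.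
rewrite (simple_expand a) dot_sumr big1// => m _.
by rewrite dotZr dotBl dot_sum_dual /= -[dot x _ * _ * _]mulrA period_dot mulr1 subrr mulr0.
Qed.

(** Descent on [dot c]: a positive root that is not simple has positive product with some simple
    root, and reflecting in that one subtracts a positive integral multiple of it. *)
Lemma positive_root_nat a : a \in Phi -> 0 < dot c a ->
  exists k : 'I_n -> nat, a = \sum_l (k l)%:R *: al l.
Proof.
have [d d0 sd] := generic_separated hPhi (frame_generic fr).
have cpos b : b \in Phi -> 0 < dot c b -> d <= dot c b.
  by move=> bP cb; have := sd b 0 bP; rewrite subr0 gtr0_norm.
move=> aP ca; apply: (@real_descent R _ (dot c) d (fun a => a \in Phi /\ 0 < dot c a)
  (fun a => exists k : 'I_n -> nat, a = \sum_l (k l)%:R *: al l) d0) => //.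
  by move=> b [_ /ltW].
move=> {a aP ca} a [aP ca].
have [[i ai]|nsimple] := pselect (exists i, a = al i).
  left; exists (fun l => (l == i)); rewrite (bigD1 i)//= big1 ?addr0.
    by rewrite eqxx scale1r.
  by move=> l /negPf ->; rewrite scale0r.
right; have coef0 l : 0 <= dot (e l) a * period l.
  by rewrite mulr_ge0 ?frame_ge0// ltW// period_gt0.
have [i ai] : exists i, 0 < dot a (al i).
  apply: contrapT => N; have := root_dot_gt0 hPhi aP.
  rewrite {2}(simple_expand a) dot_sumr ltNge => /negP; apply.
  apply: sumr_le0 => l _; rewrite dotZr mulr_ge0_le0// leNgt; apply/negP => H.
  by apply: N; exists l.
(* A second simple root occurs in [a], because by reducedness the only positive root proportional to
   [al i] is [al i]. Its coefficient is unchanged by the reflection and keeps the image positive. *)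
have [j [ji aj]] : exists j, j != i /\ 0 < dot (e j) a.
  apply: contrapT => N.
  have aE : a = (dot (e i) a * period i) *: al i.
    rewrite {1}(simple_expand a) (bigD1 i)//= big1 ?addr0// => j ji.
    suff -> : dot (e j) a = 0 by rewrite mul0r scale0r.
    apply/eqP; rewrite eq_le frame_ge0// andbT leNgt; apply/negP => H.
    by apply: N; exists j.
  have [|E|E] := root_reduced hPhi (c := dot (e i) a * period i) (frame_root fr i).
  - by rewrite -aE.
  - by apply: nsimple; exists i; rewrite {1}aE E scale1r.
  - by have := coef0 i; rewrite E oppr_ge0 ler10.
have aai := root_dot_gt0 hPhi (frame_root fr i).
have /intrP[N NE] := root_crystallographic hPhi (frame_root fr i) aP.
have N0 : (0 < N)%R by rewrite -(ltr_int R) -NE divr_gt0// mulr_gt0.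
have rE : reflection (al i) a = a - N%:~R *: al i by rewrite /reflection NE.
have rP : reflection (al i) a \in Phi by apply: (root_reflection hPhi) => //; apply: (frame_root fr).
exists (reflection (al i) a); split.
- split=> //; have := generic_regular (frame_generic fr) rP; rewrite neq_lt => /orP[H|//].
  have : 0 <= dot (e j) (- reflection (al i) a).
    by apply: frame_ge0; rewrite ?rootN// dotNr oppr_gt0.
  rewrite dotNr rE dotBr dotZr (frame_dual fr)// mulr0 subr0 oppr_ge0 leNgt.
  by rewrite aj.
- rewrite rE dotBr dotZr lerD2l lerN2.
  have N1 : 1 <= N%:~R :> R by rewrite -[leLHS]/(1%:~R) ler_int; lia.
  rewrite (le_trans (cpos _ (frame_root fr i) (frame_pos fr i)))//.
  by rewrite ler_peMl// ltW// (frame_pos fr).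
- move=> [k kE]; exists (fun l => (k l + (l == i) * `|N|)%N).
  have -> : a = reflection (al i) a + N%:~R *: al i by rewrite rE subrK.
  rewrite kE; under [RHS]eq_bigr => l _ do rewrite natrD scalerDl.
  rewrite big_split /=; congr (_ + _).
  rewrite (bigD1 i)//= big1 ?addr0 => [|l /negPf ->]; last by rewrite mul0n scale0r.
  by rewrite eqxx mul1n natr_absz gtr0_norm.
Qed.

Lemma coweight_simple x : coweight Phi x <-> forall l, dot x (al l) \is a Num.int.
Proof.
split=> [cx l|H a aP]; first by apply/cx/(frame_root fr).
wlog ca : a aP / 0 < dot c a.
  move=> W; have := generic_regular (frame_generic fr) aP; rewrite neq_lt => /orP[ca|]; last exact: W.
  by rewrite -[a]opprK dotNr rpredN; apply: W; rewrite ?rootN// dotNr oppr_gt0.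
have [k ->] := positive_root_nat aP ca; rewrite dot_sumr rpred_sum// => l _.
by rewrite dotZr rpredM ?natr_int.
Qed.

Lemma period_coweight m : coweight Phi (period m *: e m).
Proof.
apply/coweight_simple => l; rewrite dotZl; have [->|ml] := eqVneq l m.
  by rewrite period_dot int_num1.
by rewrite (frame_dual fr) 1?eq_sym// mulr0 int_num0.
Qed.

Lemma ray_coweight m (r : R) : coweight Phi (r *: e m) <-> r / period m \is a Num.int.
Proof.
have E : dot (r *: e m) (al m) = r / period m by rewrite dotZl /period invrK.
split=> [cr|ri]; first by rewrite -E; apply/cr/(frame_root fr).
apply/coweight_simple => l; have [->|ml] := eqVneq l m; first by rewrite E.
by rewrite dotZl (frame_dual fr) 1?eq_sym// mulr0 int_num0.
Qed.

Lemma ray_inj x m : injective (fun r : R => x + r *: e m).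
Proof.
move=> r r' /addrI /(congr1 (fun y => dot y (al m))); rewrite !dotZl => /mulIf -> //.
by rewrite gt_eqF// (frame_dual_gt0 fr).
Qed.

Lemma ray_middle p x m (r1 r2 r3 : R) :
  closed_cell Phi p (x + r1 *: e m) -> cell_vertex Phi (x + r2 *: e m) ->
  closed_cell Phi p (x + r3 *: e m) -> r1 < r2 -> r2 < r3 -> False.
Proof.
move=> p1 v2 p3 r12 r23; have d0 : 0 < r3 - r1 by lra.
have sE : (r2 - r1) / (r3 - r1) * (r3 - r1) = r2 - r1 by rewrite divfK// gt_eqF.
have := middle_vertex (s := (r2 - r1) / (r3 - r1)) p1 p3.
have -> : x + r1 *: e m + ((r2 - r1) / (r3 - r1)) *: (x + r3 *: e m - (x + r1 *: e m)) =
    x + r2 *: e m.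
  rewrite opprD addrACA subrr add0r -scalerBl scalerA sE.
  by rewrite -addrA -scalerDl (addrC r1) subrK.
have s01 : 0 < (r2 - r1) / (r3 - r1) < 1.
  apply/andP; split; first by apply: divr_gt0 => //; rewrite subr_gt0.
  by rewrite ltr_pdivrMr// mul1r ltrD2r.
move=> /(_ s01 v2) /ray_inj E.
by move: d0; rewrite E subrr ltxx.
Qed.

(** All simple roots except [al m] are integral along the ray, hence constant on each cell that it
    meets. *)
Lemma ray_cell x m (r : R) y : coweight Phi x -> closed_cell Phi (x + r *: e m) y ->
  exists r', y = x + r' *: e m.
Proof.
move=> cx zy; exists (dot (y - x) (al m) * period m).
rewrite {1}(_ : y = x + (y - x)); last by rewrite addrC subrK.
congr (_ + _); rewrite {1}(frame_expand (y - x)) (bigD1 m)//= big1 ?addr0// => l lm.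
have zx : dot (x + r *: e m) (al l) = dot x (al l).
  by rewrite dotDl dotZl (frame_dual fr) 1?eq_sym// mulr0 addr0.
rewrite dotBl (closed_cell_tight hPhi zy) ?(frame_root fr)//.
  by rewrite zx subrr mul0r scale0r.
by rewrite zx; apply/cx/(frame_root fr).
Qed.

(** The cell of a point of the ray lies on the line of the ray. Its vertices with extreme value of
    [al m] are its only ones, since of three vertices on a line one would be in the middle. *)
Lemma ray_skeleton x m (r : R) : coweight Phi x -> skeleton1 Phi (x + r *: e m).
Proof.
move=> cx; set z := x + r *: e m.
have am := frame_dual_gt0 fr m.
have [u [[zu vu] ul]] := closed_cell_min hPhi (al m) z.
have [v [[zv vv] vl]] := closed_cell_max hPhi (al m) z.
have [r1 uE] := ray_cell cx zu; have [r2 vE] := ray_cell cx zv.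
move: ul vl; rewrite uE vE /z !dotDl !lerD2l !dotZl !ler_pM2r// => r1r rr2.
exists u, v; split.
  exists z; apply/seteqP; split=> [w [->|->]//|w [zw vw]] /=.
  have [r3 wE] := ray_cell cx zw.
  have zz : closed_cell Phi z z by apply: closed_cell_refl.
  have [r31|r13|E] := ltgtP r3 r1; last by left; rewrite wE uE E.
    right; have [r12|r21|E] := ltgtP r1 r2; last 2 first.
    - by move: (lt_le_trans r21 r1r); rewrite ltNge rr2.
    - have rE : r = r1 by apply/eqP; rewrite eq_le r1r E rr2.
      move: zw; rewrite /z rE -uE vu /= => ->; by rewrite uE vE E.
    by exfalso; apply: (@ray_middle z x m r3 r1 r2) => //; rewrite -?wE -?uE -?vE.
  right; have [r32|r23|E] := ltgtP r3 r2; last by rewrite vE wE E.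
    by exfalso; apply: (@ray_middle z x m r1 r3 r2) => //; rewrite -?wE -?uE -?vE.
  have [r12|r21|E] := ltgtP r1 r2; last 2 first.
  - by move: (lt_le_trans r21 r1r); rewrite ltNge rr2.
  - have rE : r = r2 by apply/eqP; rewrite eq_le rr2 -E r1r.
    by move: zw; rewrite /z rE -vE vv.
  by exfalso; apply: (@ray_middle z x m r1 r2 r3) => //; rewrite -?wE -?uE -?vE.
have [E|ne] := eqVneq r1 r2.
  have rE : r = r1 by apply/eqP; rewrite eq_le r1r E rr2.
  by exists 0; [rewrite /= lexx ler01 | rewrite scale0r addr0 uE /z rE].
have d0 : 0 < r2 - r1 by rewrite subr_gt0 lt_neqAle ne (le_trans r1r).
exists ((r - r1) / (r2 - r1)).
  apply/andP; split; first by apply: divr_ge0; rewrite subr_ge0 ?(le_trans r1r).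
  by rewrite ler_pdivrMr// mul1r lerD2r.
rewrite uE vE opprD addrACA subrr add0r -scalerBl scalerA divfK ?gt_eqF//.
by rewrite -addrA -scalerDl (addrC r1) subrK.
Qed.

End FrameTheory.
End Frames.

(** * Distances in the Coxeter complex *)

(** An upper bound on [graph_dist] witnessed by a path. Symmetry of [adj] is not built in, so both
    directions are carried along later. *)
Definition dist_le (T : Type) (adj : T -> T -> Prop) (k : nat) (x y : T) : Prop :=
  exists p : seq T, [/\ (size p <= k)%N, path (fun u v => `[< adj u v >]) x p & last x p = y].

Section DistLe.
Variables (T : Type) (adj : T -> T -> Prop).

Lemma dist_le_refl k x : dist_le adj k x x.
Proof. by exists [::]. Qed.

Lemma dist_le_step x y : adj x y -> dist_le adj 1 x y.
Proof. by move=> H; exists [:: y]; split=> //=; rewrite andbT; apply/asboolP. Qed.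

Lemma dist_le_trans k l x y z : dist_le adj k x y -> dist_le adj l y z ->
  dist_le adj (k + l) x z.
Proof.
move=> [p [sp pp lp]] [q [sq pq lq]]; exists (p ++ q); split.
- by rewrite size_cat leq_add.
- by rewrite cat_path pp lp.
- by rewrite last_cat lp.
Qed.

Lemma dist_le_mono k l x y : (k <= l)%N -> dist_le adj k x y -> dist_le adj l x y.
Proof. by move=> kl [p [sp pp lp]]; exists p; split=> //; apply: leq_trans kl. Qed.

Lemma dist_le_ind (P : nat -> T -> T -> Prop) :
  (forall x k, P k x x) ->
  (forall x y z k, adj x y -> P k y z -> P k.+1 x z) ->
  forall k x y, dist_le adj k x y -> P k x y.
Proof.
move=> P0 PS k x y [p [sp pp lp]]; elim: p k x sp pp lp => [|z p IH] k x /=.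
  by move=> _ _ ->.
case: k => // k; rewrite ltnS => sp /andP[/asboolP xz pp] lp.
by apply: PS xz _; apply: IH.
Qed.

End DistLe.

Lemma dist_le_map (T T' : Type) (adj : T -> T -> Prop) (adj' : T' -> T' -> Prop)
    (f : T -> T') (P : T -> Prop) k x y :
  (forall u v, P u -> adj u v -> P v /\ adj' (f u) (f v)) -> P x ->
  dist_le adj k x y -> dist_le adj' k (f x) (f y).
Proof.
move=> H Px [p [sp pp lp]]; exists (map f p); split; first by rewrite size_map.
  elim: p x Px {sp lp} pp => //= z p IH x Px /andP[/asboolP xz pp].
  have [Pz xz'] := H _ _ Px xz.
  by rewrite IH// andbT; apply/asboolP.
by rewrite last_map lp.
Qed.

(** * Existence of frames and conjugation into a chamber *)

Section FramesExist.
Variables (R : realType) (n : nat) (Phi : {fset 'rV[R]_n}).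
Variable hPhi : root_system Phi.
Local Notation K := (coxeter_complex Phi).
Local Notation cell_verts := (cell_verts Phi).
Variable hK : piecewise_euclidean K (@edist R n).
Variable hF : face_closed K.
Implicit Types (u a b c d p q x y g : 'rV[R]_n).

(** [al l] is the normal of the facet opposite to [e l]; this facet contains 0, so its wall has
    level 0. *)
Lemma frame_of_verts c (e : 'I_n -> 'rV[R]_n) : generic Phi c -> closed_cell Phi c 0 ->
  cell_verts c = [set 0] `|` range e -> exists al, frame Phi c e al.
Proof.
move=> gc c0 E; pose v (i : 'I_n.+1) := if unlift ord0 i is Some l then e l else 0.
have v0 : v ord0 = 0 by rewrite /v unlift_none.
have vl l : v (lift ord0 l) = e l by rewrite /v liftK.
have ev : alcove_enum Phi c v.
  split=> //; rewrite E; apply/seteqP; split=> [x [->|[l _ <-]]|_ [i _ <-]].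
  - by exists ord0.
  - by exists (lift ord0 l).
  - by have [l ->|->] := unliftP ord0 i; [right; exists l; rewrite ?vl|left].
have /choice[f Hf] : forall l, exists ak, facet_wall Phi v (lift ord0 l) ak.1 ak.2 /\ ak.2%:~R < dot c ak.1.
  by move=> l; have [a [k H]] := facet_exists hPhi (lift ord0 l) ev; exists (a, k).
have k0 l : (f l).2%:~R = 0 :> R.
  by have [[_ H _] _] := Hf l; rewrite -(H ord0) ?v0 ?dot0l.
exists (fun l => (f l).1); split=> //.
- move=> g H; apply: (alcove_enum_nondeg hPhi ev (t := 0)) => i.
  by have [l ->|->] := unliftP ord0 i; rewrite ?vl ?v0 ?dot0l.
- by move=> l; have [[? _ _] _] := Hf l.
- by move=> l; have [_] := Hf l; rewrite k0.
- by move=> l m lm; have [[_ H _] _] := Hf m; rewrite -vl H ?k0// (inj_eq (@lift_inj _ _)).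
- by move=> l; have [[_ _ H] _] := Hf l; rewrite k0 vl in H.
Qed.

Lemma frame_exists c : generic Phi c -> closed_cell Phi c 0 ->
  exists e al, frame Phi c e al.
Proof.
move=> gc c0; have [v [_ E]] := generic_enum hPhi hK gc.
have [i _ v0] : range v 0.
  by rewrite -E; split=> //; apply/(coweight_vertex hPhi)/coweight0.
have [|al fr] := @frame_of_verts c (fun l => v (lift i l)) gc c0; last first.
  by exists (fun l => v (lift i l)), al.
rewrite E; apply/seteqP; split=> [_ [j _ <-]|x [->|[l _ <-]]].
- by have [l ->|->] := unliftP i j; [right; exists l|left].
- by exists i.
- by exists (lift i l).
Qed.

Lemma small_scaling d : exists2 t, 0 < t <= 1 & forall a, a \in Phi -> t * dot d a < 1.
Proof.
have N0 : 0 < 1 + root_norm Phi d by rewrite ltr_pwDl// root_norm_ge0.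
exists (1 + root_norm Phi d)^-1; first by rewrite invr_gt0 N0 invf_le1// lerDl root_norm_ge0.
move=> a aP; rewrite mulrC ltr_pdivrMr// mul1r.
by rewrite (le_lt_trans (ler_norm _))// (le_lt_trans (root_norm_ge _ aP))// ltrDr.
Qed.

(** Shrink [d] until no root reaches 1 on it; an alcove whose closure contains the shrunken vector
    then has 0 in its closure. *)
Lemma chamber_of d : exists c, [/\ generic Phi c, closed_cell Phi c 0 & closed_chamber Phi c d].
Proof.
have [t /andP[t0 _] small] := small_scaling d.
have [c gc cd] := exists_generic hPhi (t *: d); exists c; split=> //.
  move=> a k aP kc; have := cd a k aP kc; rewrite dotZl => kd.
  have : k%:~R < (1%:~R : R) by apply: le_lt_trans (small _ aP).
  by rewrite dot0l ltr_int -[X in _ <= X]/(0%:~R) ler_int; lia.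
move=> a aP ca; have := cd a 0 aP (ltW ca); rewrite dotZl pmulr_rge0//.
Qed.

Lemma reflection0 a v : reflection a v = areflection a 0%:~R v.
Proof. by rewrite /reflection /areflection subr0. Qed.

Lemma reflectionB a x y : reflection a (x - y) = reflection a x - reflection a y.
Proof.
by rewrite /reflection dotBl; apply/rowP => i; rewrite !mxE; ring.
Qed.

Lemma reflectionZ a (k : R) x : reflection a (k *: x) = k *: reflection a x.
Proof. by rewrite /reflection dotZl scalerBr scalerA; congr (_ - _ *: _); ring. Qed.

Lemma reflection_simplicial a : a \in Phi ->
  simplicial_isometry K (@edist R n) K (@edist R n) (reflection a).
Proof.
move=> aP; have r := reflectionK (root_nz hPhi aP).
have rv v : cell_vertex Phi v -> cell_vertex Phi (reflection a v).
  by rewrite reflection0 => ?; apply/areflection_cell_vertex.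
have rs s : K s -> K (reflection a @` s).
  move=> [p ->]; exists (areflection a 0%:~R p).
  rewrite -/(cell_verts p) -/(cell_verts _) areflection_cell_verts//.
  by apply: eq_imagel => x _; rewrite reflection0.
split.
- split=> [v /vertices_coxeter vv|x y _ _|v /vertices_coxeter vv].
  + exact/vertices_coxeter/rv.
  + exact: (inv_inj r).
  + by exists (reflection a v); rewrite ?r//; apply/vertices_coxeter/rv.
- move=> s _; split=> [/rs//|/rs]; rewrite image_comp.
  by rewrite (eq_imagel (f' := id)) ?image_id// => x _ /=; rewrite r.
- move=> u v _; apply/edist_eq.
  by rewrite -!reflectionB (dot_reflection a (u - v)) r.
Qed.

Lemma weyl_isometry (w : 'rV[R]_n -> 'rV[R]_n) : weyl Phi w ->
  [/\ simplicial_isometry K (@edist R n) K (@edist R n) w,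
      forall x y, w (x - y) = w x - w y,
      forall (k : R) x, w (k *: x) = k *: w x,
      forall x, root_norm Phi (w x) = root_norm Phi x &
      forall x, coweight Phi (w x) <-> coweight Phi x].
Proof.
elim=> [|a {}w aP _ [si wB wZ wN wc]].
  split=> //; split=> //; last by move=> s _; rewrite image_id.
  by split=> // x Kx; exists x.
split.
- apply: simplicial_isometry_comp si (reflection_simplicial aP); exact: simplex_vertices.
- by move=> x y /=; rewrite wB reflectionB.
- by move=> k x /=; rewrite wZ reflectionZ.
- by move=> x /=; rewrite (root_norm_reflection hPhi).
- have rc x : coweight Phi x -> coweight Phi (reflection a x).
    by rewrite reflection0; apply: areflection_coweight.
  move=> x; apply: iff_trans (wc x); split=> /rc //=.
  by rewrite reflectionK// (root_nz hPhi).
Qed.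

(* Reflecting in the walls that separate it from the chamber, any vector is moved
   into the chamber; the displacement is a combination of positive roots. *)
Lemma weyl_dominant l : regular Phi l -> exists2 kap : R, 0 < kap & forall x,
  exists w, [/\ weyl Phi w, closed_chamber Phi l (w x),
    forall m, closed_chamber Phi l m -> 0 <= dot m (w x - x) &
    kap * root_norm Phi (w x - x) <= dot l (w x - x)].
Proof.
(* The least ratio of [dot l a] to the norm of [a] over the positive roots: it makes the cone that
   they generate uniformly pointed, independently of [x]. *)
move=> rl; have [|kap kap0 Hk] := @seq_small R _ Phi
    (fun a t => 0 < dot l a -> t * root_norm Phi a <= dot l a).
  move=> a aP; have [la|la] := ltP 0 (dot l a); last by exists 1.
  have na : 0 < root_norm Phi a.
    by rewrite (lt_le_trans _ (root_norm_ge a aP))// normr_gt0 gt_eqF// (root_dot_gt0 hPhi).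
  by exists (dot l a / root_norm Phi a); [rewrite divr_gt0|move=> t _; rewrite ler_pdivlMr].
exists kap => // x.
(* A lower bound for the nonzero pairings of [x] with roots. Weyl conjugates of [x] have the same
   pairings, so each reflection raises [dot (w x) l] by at least the [h] chosen next. Unlike [kap],
   both may depend on [x]. *)
have [|d d0 Hd] := @seq_small R _ Phi (fun a t => dot x a != 0 -> t <= `|dot x a|).
  move=> a aP; have [->|xa] := eqVneq (dot x a) 0; first by exists 1.
  by exists `|dot x a|; rewrite ?normr_gt0.
have [|h h0 Hh] := @seq_small R _ Phi
    (fun a t => 0 < dot l a -> t * dot a a <= 2 * d * dot l a).
  move=> a aP; have [la|la] := ltP 0 (dot l a); last by exists 1.
  have aa := root_dot_gt0 hPhi aP; exists (2 * d * dot l a / dot a a).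
    by rewrite divr_gt0// !mulr_gt0.
  by move=> t _; rewrite ler_pdivlMr.
have [B B0 HB] := dot_bound hPhi l.
pose cone y := (forall m, closed_chamber Phi l m -> 0 <= dot m y) /\ kap * root_norm Phi y <= dot l y.
pose I w := [/\ weyl Phi w, cone (w x - x) &
  forall a, a \in Phi -> dot (w x) a != 0 -> d <= `|dot (w x) a|].
pose Q (_ : 'rV[R]_n -> 'rV[R]_n) := exists w, [/\ weyl Phi w, closed_chamber Phi l (w x),
    forall m, closed_chamber Phi l m -> 0 <= dot m (w x - x) &
    kap * root_norm Phi (w x - x) <= dot l (w x - x)].
apply: (@real_descent R _ (fun w => B * root_norm Phi x - dot (w x) l) h I Q h0 _ _ id).
- move=> w [/weyl_isometry[_ _ _ wN _] _ _]; rewrite subr_ge0.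
  by rewrite (le_trans (ler_norm _))// (le_trans (HB _))// wN.
- move=> w [Ww [cm ck] wd].
  have [cw|ncw] := pselect (closed_chamber Phi l (w x)); first by left; exists w.
  right; have [a [aP la wa]] : exists a, [/\ a \in Phi, 0 < dot l a & dot (w x) a < 0].
    apply: contrapT => N; apply: ncw => a aP la; rewrite leNgt; apply/negP => H.
    by apply: N; exists a.
  have aa := root_dot_gt0 hPhi aP.
  have s0 : 0 < - (2 * dot (w x) a / dot a a).
    by rewrite -mulNr divr_gt0// -mulrN mulr_gt0// oppr_gt0.
  have rE : reflection a (w x) = w x + (- (2 * dot (w x) a / dot a a)) *: a.
    by rewrite scaleNr.
  exists (reflection a \o w); split=> //.
  + split; first exact: weyl_reflection.
    * rewrite /= rE addrAC; split=> [m cm'|].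
        by rewrite dotDr addr_ge0 ?cm// dotZr mulr_ge0 ?(ltW s0)// cm'.
      rewrite dotDr dotZr (le_trans (ler_wpM2l (ltW kap0) (root_normD _ _ _)))//.
      rewrite mulrDr lerD// root_normZ gtr0_norm// mulrCA ler_pM2l//.
      exact: (Hk _ aP kap kap0 (lexx _)).
    * move=> b bP; rewrite /= dot_reflection; apply: wd; exact: (root_reflection hPhi).
  + rewrite /= -addrA lerD2l rE dotDl dotZl opprD lerD2l lerN2 (dotC a l).
    rewrite -mulNr mulrAC ler_pdivlMr// (le_trans (Hh _ aP h h0 (lexx _) la))//.
    rewrite ler_pM2r// -mulrN ler_pM2l// (le_trans (wd _ aP _)) ?lt_eqF//.
    by rewrite ltr0_norm.
- split; first exact: weyl_id.
  + rewrite subrr; split=> [m _|]; first by rewrite dot0r.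
    by rewrite root_norm0 mulr0 dot0r.
  + by move=> a aP xa; apply: (Hd _ aP d d0 (lexx _)).
Qed.

End FramesExist.

Section Distances.
Variables (R : realType) (n : nat) (Phi : {fset 'rV[R]_n}).
Variable hPhi : root_system Phi.
Local Notation K := (coxeter_complex Phi).
Local Notation cell_verts := (cell_verts Phi).
Variable hK : piecewise_euclidean K (@edist R n).
Variable hF : face_closed K.
Implicit Types (u a b c d p q x y z g : 'rV[R]_n).

Lemma cell_dist1 c p q : cell_verts c p -> cell_verts c q -> dist_le (edge K) 1 p q.
Proof.
move=> cp cq; have [->|pq] := pselect (p = q); first exact: dist_le_refl.
apply: dist_le_step; split=> //; apply: (hF (cell_verts_simplex Phi c)).
  by move=> x [->|->].
by exists p; left.
Qed.

(** Each wall crossing costs one edge, leading to a vertex of the crossed facet, which belongs to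
    both alcoves; at most [N] crossings occur, and one more edge is spent in the last alcove. *)
Lemma separated_cells_dist e h N : 0 < e -> 0 < h ->
  (forall c d a (k : int), separated Phi e c -> separated Phi e d -> a \in Phi ->
    k%:~R < dot c a -> dot d a < k%:~R ->
    dot (areflection a k%:~R c - d) (areflection a k%:~R c - d) <= dot (c - d) (c - d) - h) ->
  forall c d p q, separated Phi e c -> separated Phi e d ->
  dot (c - d) (c - d) <= N%:R * h -> cell_verts c p -> cell_verts d q ->
  dist_le (edge K) N.+1 p q.
Proof.
move=> e0 h0 Hh; elim: N => [|N IH] c d p q sc sd cd cp dq.
  have [E|ne] := pselect (closed_cell Phi c = closed_cell Phi d).
    by apply: (cell_dist1 cp); rewrite /cell_verts E.
  have [v ev] := generic_enum hPhi hK (separated_generic e0 sc).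
  have [i [a [k [[aP _ _] kc dk]]]] := separating_facet hPhi ev (separated_generic e0 sd) ne.
  have := Hh c d a k sc sd aP kc dk; have := dot_ge0 (areflection a k%:~R c - d).
  by move: cd; rewrite mul0r; lra.
have [E|ne] := pselect (closed_cell Phi c = closed_cell Phi d).
  by apply: (dist_le_mono (k := 1)) => //; apply: (cell_dist1 cp); rewrite /cell_verts E.
have [v ev] := generic_enum hPhi hK (separated_generic e0 sc).
have [i [a [k [[aP va _] kc dk]]]] := separating_facet hPhi ev (separated_generic e0 sd) ne.
have [j ji] : exists j, j != i.
  by exists (lift i (Ordinal (dim_gt0 hPhi))); rewrite eq_sym neq_lift.
have vj : cell_verts c (v j) by have [_ ->] := ev; exists j.
apply: (dist_le_trans (k := 1) (l := N.+1) (cell_dist1 cp vj)).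
apply: (IH _ _ _ _ (areflection_separated hPhi k aP sc) sd _ _ dq).
  by have := Hh c d a k sc sd aP kc dk; move: cd; rewrite -natr1; lra.
by rewrite areflection_cell_verts//; exists (v j) => //; rewrite areflection_fix// va.
Qed.

(** Every alcove contains a reflected copy of [c0], separated by the same [e], so one drop [h]
    serves for all pairs of alcoves. *)
Lemma vertex_dist_bound (C : R) : exists k, forall p q, vertices K p -> vertices K q ->
  root_norm Phi (p - q) <= C -> dist_le (edge K) k p q.
Proof.
have [c0 gc0 _] := exists_generic hPhi 0.
have [e e0 se] := generic_separated hPhi gc0.
have [h h0 Hh] := separated_descent hPhi e0 e0.
have [B B0 HB] := dot_self_bound hPhi.
pose W := (size Phi)%:R : R.
(* Bounds the squared distance of the two centres: [W] from each centre to its vertex, and [C]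
   between the vertices. *)
set D := B * (W + C + W) ^+ 2.
exists (Num.truncn (D / h)).+2 => p q /vertices_coxeter vp /vertices_coxeter vq pqC.
have near x : cell_vertex Phi x -> exists c, [/\ separated Phi e c, cell_verts c x &
    root_norm Phi (c - x) <= W].
  move=> vx; have [g gg gx] := exists_generic hPhi x.
  have [c [sc _ cg]] := @gallery_ind _ _ _ hPhi hK e (fun _ => True) c0 e0 se I
    (fun _ _ _ _ _ _ _ _ _ => I) g gg.
  have cx : closed_cell Phi c x by rewrite cg.
  exists c; split=> //; rewrite -[W]mul1r; apply: root_norm_le => a aP.
  have cc := @closed_cell_refl _ _ Phi c.
  by rewrite dotBl ler_norml lerNl opprB !(closed_cell_width hPhi (p := c)).
have [c [sc cp nc]] := near p vp; have [d [sd dq nd]] := near q vq.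
apply: (separated_cells_dist e0 h0 Hh sc sd _ cp dq).
have cdN : root_norm Phi (c - d) <= W + C + W.
  have -> : c - d = (c - p) + (p - q) - (d - q).
    by rewrite opprB !addrA !subrK.
  rewrite (le_trans (root_normB _ _ _))// lerD//.
  by rewrite (le_trans (root_normD _ _ _))// lerD.
rewrite (le_trans (HB _))// -ler_pdivrMr//; apply: (@le_trans _ _ (D / h)); last first.
  by rewrite ltW// truncnS_gt.
rewrite ler_pM2r ?invr_gt0// ler_pM2l// ler_sqr// ?nnegrE ?root_norm_ge0//.
by rewrite (le_trans _ cdN)// root_norm_ge0.
Qed.

(* The model of [adjacent_spec]. *)
Definition special_adj x y : Prop :=
  [/\ x <> y, special_segment Phi x y &
    forall z, special_point Phi z -> segment x y z -> z = x \/ z = y].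

Section FrameSteps.
Variables (c : 'rV[R]_n) (e al : 'I_n -> 'rV[R]_n).
Hypothesis fr : frame Phi c e al.
Local Notation T := (period e al).

Lemma ray_special_segment x m (r : R) : coweight Phi x -> coweight Phi (r *: e m) ->
  special_segment Phi x (x + r *: e m).
Proof.
move=> cx cr; split; [exact/special_coweight|exact/special_coweight/coweightD|].
move=> _ [t _ <-]; rewrite addrAC subrr add0r scalerA.
exact: (ray_skeleton hPhi fr).
Qed.

Lemma frame_special_adj x m : coweight Phi x -> special_adj x (x + T m *: e m).
Proof.
move=> cx; have T0 := period_gt0 fr m; split.
- move=> /eqP; rewrite addrC -subr_eq subrr eq_sym scaler_eq0 gt_eqF//= => /eqP e0.
  by have := frame_dual_gt0 fr m; rewrite e0 dot0l ltxx.
- by apply: ray_special_segment => //; apply: (period_coweight hPhi fr).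
- move=> z /(special_coweight hPhi) cz [t /andP[t0 t1] zE].
  move: zE; rewrite addrAC subrr add0r scalerA => zE.
  have : coweight Phi ((t * T m) *: e m).
    by rewrite -[_ *: _](addrK x) [_ + x]addrC zE; apply: coweightB.
  move=> /(ray_coweight hPhi fr); rewrite mulfK ?gt_eqF// => /intrP[k kE].
  move: t0 t1 zE; rewrite kE (_ : 0 = 0%:~R :> R)// (_ : 1 = 1%:~R :> R)// !ler_int => k0 k1.
  have [->|->] : k = 0 \/ k = 1 by lia.
    by rewrite mul0r scale0r addr0 => <-; left.
  by rewrite mul1r => <-; right.
Qed.

Lemma frame_walk (k : 'I_n -> nat) N x : (\sum_l k l <= N)%N -> coweight Phi x ->
  dist_le special_adj N x (x + \sum_l ((k l)%:R * T l) *: e l).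
Proof.
elim: N k x => [|N IH] k x kN cx.
  rewrite big1 ?addr0 => [|l _]; first exact: dist_le_refl.
  have : (k l <= 0)%N by apply: leq_trans kN; rewrite (bigD1 l)//= leq_addr.
  by rewrite leqn0 => /eqP ->; rewrite mul0r scale0r.
have [/existsP[m km]|/existsPn H] := boolP [exists m, (0 < k m)%N]; last first.
  rewrite big1 ?addr0 => [|l _]; first exact: dist_le_refl.
  by have := H l; rewrite lt0n negbK => /eqP ->; rewrite mul0r scale0r.
apply: (dist_le_trans (k := 1) (l := N) (y := x + T m *: e m)).
  exact/dist_le_step/frame_special_adj.
pose k' l := (k l - (l == m))%N.
have kE l : k l = (k' l + (l == m))%N by rewrite /k'; have [->|] := eqVneq l m; lia.
have -> : x + \sum_l ((k l)%:R * T l) *: e l = (x + T m *: e m) + \sum_l ((k' l)%:R * T l) *: e l.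
  rewrite -addrA; congr (_ + _).
  under eq_bigr => l _ do rewrite kE natrD mulrDl scalerDl.
  rewrite big_split addrC /=; congr (_ + _).
  rewrite (bigD1 m)//= eqxx mul1r big1 ?addr0// => l /negPf ->.
  by rewrite mul0r scale0r.
apply: IH; last by apply: coweightD => //; apply: (period_coweight hPhi fr).
suff : (\sum_l k l = (\sum_l k' l) + 1)%N by lia.
under eq_bigr => l _ do rewrite kE.
rewrite big_split /=; congr (_ + _)%N.
by rewrite (bigD1 m)//= eqxx big1 ?addn0// => l /negPf ->.
Qed.

End FrameSteps.

Lemma chamber_coefficients c e al d : frame Phi c e al -> closed_chamber Phi c d ->
  coweight Phi d -> exists k : 'I_n -> nat, (forall l, (k l)%:R = dot d (al l)) /\
    d = \sum_l ((k l)%:R * period e al l) *: e l.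
Proof.
move=> fr cd wd.
have /choice[k Hk] : forall l, exists k : nat, k%:R = dot d (al l).
  move=> l; have /intrP[k Ek] := wd _ (frame_root fr l).
  have : 0 <= dot d (al l) by apply: cd; [apply: (frame_root fr)|apply: (frame_pos fr)].
  rewrite Ek (_ : 0 = 0%:~R :> R)// ler_int => k0; exists `|k|%N.
  by rewrite natr_absz ger0_norm.
exists k; split=> //; rewrite {1}(frame_expand hPhi fr d).
by apply: eq_bigr => l _; rewrite Hk.
Qed.

(** In a frame whose chamber contains [y - x], this vector is a sum of fundamental coweights, each
    an edge of the special graph. Their multiplicities are pairings with simple roots, so each is at
    most [C]. *)
Lemma coweight_dist_bound (C : R) : exists k, forall x y, coweight Phi x -> coweight Phi y ->
  root_norm Phi (x - y) <= C -> dist_le special_adj k x y.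
Proof.
exists (Num.truncn (n%:R * C)).+1 => x y cx cy xyC.
have [c [gc c0 cd]] := chamber_of hPhi (y - x).
have [e [al fr]] := frame_exists hPhi hK gc c0.
have [k [kE dE]] := chamber_coefficients fr cd (coweightB cy cx).
rewrite {1}(_ : y = x + (y - x)); last by rewrite addrC subrK.
rewrite dE; apply: (frame_walk fr) => //.
apply: ltnW; rewrite -(ltr_nat R) natr_sum.
apply: (@le_lt_trans _ _ (n%:R * C)); last exact: truncnS_gt.
rewrite (le_trans (ler_sum (G := fun=> C) _ _))//; last first.
  by rewrite sumr_const card_ord mulr_natl.
move=> l _; rewrite kE (le_trans (ler_norm _))//.
rewrite (le_trans (root_norm_ge _ (frame_root fr l)))//.
by rewrite -root_normN opprB.
Qed.

End Distances.

(** * Edges of the special graph *)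

Section SpecialEdges.
Variables (R : realType) (n : nat) (Phi : {fset 'rV[R]_n}).
Variable hPhi : root_system Phi.
Local Notation K := (coxeter_complex Phi).
Local Notation cell_verts := (cell_verts Phi).
Variable hK : piecewise_euclidean K (@edist R n).
Variable hF : face_closed K.
Implicit Types (u a b c d p q x y z g : 'rV[R]_n).

Lemma segment_cell p x y : closed_cell Phi p x -> closed_cell Phi p y ->
  segment x y `<=` closed_cell Phi p.
Proof.
move=> px py _ [t /andP[t0 t1] <-] a k aP kp.
have := px a k aP kp; have := py a k aP kp.
rewrite dotDl dotZl dotBl => ky kx.
have := mulr_ge0 t0 (_ : 0 <= dot y a - k%:~R); rewrite subr_ge0 => /(_ ky).
have := mulr_ge0 (_ : 0 <= 1 - t) (_ : 0 <= dot x a - k%:~R); rewrite !subr_ge0 => /(_ t1 kx).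
by rewrite !mulrBr !mulrBl; lra.
Qed.

(** If two coefficients of [y - x] in a frame were positive, the start of the segment would lie in a
    cell with the three vertices [x], [x + e l], [x + e m], not in the 1-skeleton. The absence of
    intermediate special points makes the remaining multiplicity 1. *)
Lemma special_adj_frame x y : special_adj Phi x y -> exists c e al m,
  frame Phi c e al /\ y = x + period e al m *: e m.
Proof.
move=> [xy [/(special_coweight hPhi) cx /(special_coweight hPhi) cy sk] nosp].
set d := y - x; have cdw : coweight Phi d by apply: coweightB.
have yE : y = x + d by rewrite /d addrC subrK.
have [c [gc c0 cd]] := chamber_of hPhi d.
have [e [al fr]] := frame_exists hPhi hK gc c0.
have [k [kE dE]] := chamber_coefficients hPhi fr cd cdw.
have T0 := period_gt0 fr.
have [m km] : exists m, (0 < k m)%N.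
  apply: contrapT => N; apply: xy; rewrite yE dE big1 ?addr0// => l _.
  have -> : k l = 0%N by apply/eqP; rewrite -leqn0 leqNgt; apply/negP => H; apply: N; exists l.
  by rewrite mul0r scale0r.
have k0 l : l != m -> k l = 0%N.
  move=> lm; apply/eqP; rewrite -leqn0 leqNgt; apply/negP => kl.
  (* For this [t] no root gains 1 between [x] and [x + t *: d], so the cell of that point contains
     [x] and every [x + e l'] with [k l'] positive. *)
  have [t /andP[t0 t1] small] := small_scaling Phi d.
  have [|u [v [[p pE] uvz]]] := sk (x + t *: d).
    by exists t => //; apply/andP; split=> //; apply: ltW.
  have [pu _] : cell_verts p u by rewrite /cell_verts -pE; left.
  have [pv _] : cell_verts p v by rewrite /cell_verts -pE; right.
  have pz := segment_cell pu pv uvz.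
  have zx a (j i : int) : a \in Phi -> dot x a = i%:~R -> j%:~R <= dot (x + t *: d) a ->
      j%:~R <= i%:~R :> R.
    move=> aP xi; rewrite dotDl dotZl xi => H; rewrite ler_int.
    have : j%:~R < (i + 1)%:~R :> R by rewrite intrD; have := small a aP; lra.
    by rewrite ltr_int; lia.
  have ze l' : (0 < k l')%N -> closed_cell Phi (x + t *: d) (x + e l').
    move=> kl' a j aP; have /intrP[i xi] := cx a aP => H.
    have ji := zx a j i aP xi H; rewrite dotDl xi.
    have := generic_regular gc aP; rewrite neq_lt => /orP[ca|ca]; last first.
      by rewrite (le_trans ji)// lerDl (frame_ge0 fr).
    have NP := rootN hPhi aP; have Nca : 0 < dot c (- a) by rewrite dotNr oppr_gt0.
    have e_le0 m' : dot (e m') a <= 0.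
      by have := frame_ge0 fr m' NP Nca; rewrite dotNr oppr_ge0.
    have [da|da] := ltP (dot d a) 0.
      have : j%:~R < i%:~R :> R.
        by rewrite (le_lt_trans H)// dotDl dotZl xi gtrDl pmulr_rlt0.
      rewrite ltr_int => ji'; have : j%:~R <= (i - 1)%:~R :> R by rewrite ler_int; lia.
      have := frame_le1 hPhi fr l' NP; rewrite dotNr intrB; lra.
    suff -> : dot (e l') a = 0 by rewrite addr0.
    apply/eqP; rewrite eq_le e_le0 /=; move: da; rewrite dE dot_suml (bigD1 l')//=.
    rewrite dotZl => H0.
    have H1 : \sum_(i0 < n | i0 != l') dot (((k i0)%:R * period e al i0) *: e i0) a <= 0.
      by apply: sumr_le0 => i0 _; rewrite dotZl mulr_ge0_le0// mulr_ge0// ltW// T0.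
    have : 0 <= (k l')%:R * period e al l' * dot (e l') a by lra.
    by rewrite pmulr_rge0// mulr_gt0// ltr0n.
  have px : cell_verts p x.
    split; last exact: coweight_vertex.
    apply: (closed_cell_trans pz) => a j aP H; have /intrP[i xi] := cx a aP.
    by rewrite xi; apply: zx H.
  have pe l' : (0 < k l')%N -> cell_verts p (x + e l').
    move=> kl'; split; first by apply: (closed_cell_trans pz); apply: ze.
    have [_ ve] := frame_vert fr l'.
    by rewrite addrC; apply/cell_vertex_translate.
  have e0 l' : e l' <> 0.
    by move=> E; have := frame_dual_gt0 fr l'; rewrite E dot0l ltxx.
  have elm : e l <> e m.
    move=> E; have := frame_dual_gt0 fr m; rewrite -E (frame_dual fr)// ltxx//.
  have xe l' : x <> x + e l'.
    by move=> /eqP; rewrite addrC -subr_eq subrr eq_sym => /eqP /e0.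
  have := pe l kl; have := pe m km; have := px.
  rewrite /cell_verts -pE => -[x1|x1] [m1|m1] [l1|l1];
    first [by apply: (xe m); rewrite m1 -x1 | by apply: (xe l); rewrite l1 -x1
          | by apply: elm; apply: (addrI x); rewrite l1 m1].
have dkE : d = ((k m)%:R * period e al m) *: e m.
  rewrite {1}dE (bigD1 m)//= big1 ?addr0// => l lm.
  by rewrite k0// mul0r scale0r.
exists c, e, al, m; split=> //.
have adj := frame_special_adj hPhi fr m cx; have [ne [_ sz _] _] := adj.
have [|E|->//] := nosp _ sz; last by case: ne; rewrite -{1}E.
exists ((k m)%:R^-1).
  by rewrite /= invr_ge0 ler0n /= invf_le1 ?ltr0n// ler1n.
by rewrite -/d dkE scalerA mulrA mulVf ?mul1r// pnatr_eq0 -lt0n.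
Qed.

(** The frame of the edge varies, so its direction is moved by the Weyl group into the chamber of a
    fixed frame. There it becomes some [e0 j], and the period of [e0 j] bounds that of [e m]. *)
Lemma special_adj_bound : exists C : R, forall x y, special_adj Phi x y -> root_norm Phi (x - y) <= C.
Proof.
have [c0 [gc0 c00 _]] := chamber_of hPhi 0.
have [e0 [al0 fr0]] := frame_exists hPhi hK gc0 c00.
have T00 := period_gt0 fr0.
exists ((\sum_j period e0 al0 j) * (size Phi)%:R) => x y.
move=> /special_adj_frame[c [e [al [m [fr ->]]]]].
have T0 := period_gt0 fr m.
rewrite opprD addrA subrr add0r root_normN root_normZ gtr0_norm//.
have [_ _ /(_ (e m))[w [ww cw _ _]]] := weyl_dominant hPhi hF (generic_regular gc0).
have [si wB wZ wN wc] := weyl_isometry hPhi hF ww.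
have ve := frame_vert fr m; have v0 : cell_verts c 0.
  by rewrite (frame_verts fr); left.
have em0 : 0 <> e m.
  by move=> E; have := frame_dual_gt0 fr m; rewrite -E dot0l ltxx.
have w0 : w 0 = 0 by have := wB 0 0; rewrite !subrr.
have Kc := cell_verts_simplex Phi c.
have edge_e : edge K 0 (e m).
  split=> //; apply: (hF Kc); last by exists 0; left.
  by move=> z [->|->].
have edge_we : edge K 0 (w (e m)).
  have K0 := simplex_vertices hF Kc v0; have Ke := simplex_vertices hF Kc ve.
  split; first by rewrite -{1}w0 => /(isometry_inj si K0 Ke).
  have -> : [set 0; w (e m)] = w @` [set 0; e m] by rewrite image_setU !image_set1 w0.
  have sub : [set 0; e m] `<=` vertices K by move=> z [->|->].
  by apply/(isometry_simplex si sub); case: edge_e.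
have := edge_in_chamber hPhi gc0 c00 edge_we cw.
rewrite (frame_verts fr0) => -[E|[j _ E]].
  case: em0; apply: (isometry_inj si); rewrite ?w0 ?E//.
    exact: (simplex_vertices hF Kc v0).
  exact: (simplex_vertices hF Kc ve).
have : coweight Phi (period e0 al0 j *: e m).
  by apply/wc; rewrite wZ -E; apply: (period_coweight hPhi fr0).
move=> /(ray_coweight hPhi fr)/intrP[i iE].
have i0 : 0 < i%:~R :> R by rewrite -iE divr_gt0.
have Tj : period e al m <= period e0 al0 j.
  rewrite -[leLHS]mul1r -ler_pdivlMr// iE -[leLHS]/(1%:~R) ler_int.
  by move: i0; rewrite -[ltLHS]/(0%:~R) ltr_int; lia.
apply: ler_pM; [exact: ltW|exact: root_norm_ge0| |].
- by rewrite (le_trans Tj)// (bigD1 j)//= lerDl; apply: sumr_ge0 => l _; exact: ltW.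
- rewrite -[leRHS]mul1r; apply: root_norm_le => a aP.
  by have := edge_width hPhi edge_e aP; rewrite dot0l sub0r normrN.
Qed.

End SpecialEdges.

(** * Labellings by edge types *)

Section Labels.
Variables (R : realType) (n : nat) (Phi : {fset 'rV[R]_n}).
Variable hPhi : root_system Phi.
Local Notation K := (coxeter_complex Phi).
Local Notation cell_verts := (cell_verts Phi).
Variable hK : piecewise_euclidean K (@edist R n).
Variable hF : face_closed K.
Implicit Types (u a b c d p q x y z g : 'rV[R]_n).

Lemma alcove_enum_inj c v : alcove_enum Phi c v -> injective v.
Proof.
move=> ev i j; have [j' ->|-> //] := unliftP i j => E; exfalso.
have := alcove_enum_unit hPhi i ev; set Q := \matrix_j _ => Qu.
have : (delta_mx 0 j' : 'rV_n) *m Q = 0 by rewrite -rowE rowK -E subrr.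
move=> /(congr1 (mulmx^~ (invmx Q))); rewrite mulmxK// mul0mx.
by move=> /(congr1 (fun M : 'M_(_, _) => M 0 j'))/eqP; rewrite !mxE !eqxx oner_eq0.
Qed.

Lemma generic_alcove c : generic Phi c -> alcove Phi (cell_verts c).
Proof.
move=> gc; split; first exact: cell_verts_simplex.
have [v ev] := generic_enum hPhi hK gc; have [_ ->] := ev.
rewrite (card_eq_trans (inj_card_eq (in2W (alcove_enum_inj ev))))// card_eq_sym.
exact: card_II.
Qed.

(* [Om l] is the set of the edge vectors of type [l] at a special vertex. *)
Record labelling (Om : 'I_n -> set 'rV[R]_n) : Prop := Labelling {
  labelling_reflection : forall l a x, a \in Phi -> Om l x -> Om l (reflection a x);
  labelling_edge : forall l x, Om l x -> edge K 0 x;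
  labelling_disjoint : forall l m x, Om l x -> Om m x -> l = m;
  labelling_alcove : forall c, generic Phi c -> closed_cell Phi c 0 ->
    exists e, cell_verts c = [set 0] `|` range e /\ forall l, Om l (e l)
}.

Lemma edge_frame x : edge K 0 x -> exists c e al m, frame Phi c e al /\ x = e m.
Proof.
move=> [x0 [p pE]]; have [c gc cp] := exists_generic hPhi p.
have c0 : cell_verts c 0.
  have [p0 v0] : cell_verts p 0 by rewrite /cell_verts -pE; left.
  by split=> //; apply: (closed_cell_trans cp).
have cx : cell_verts c x.
  have [px vx] : cell_verts p x by rewrite /cell_verts -pE; right.
  by split=> //; apply: (closed_cell_trans cp).
have [e [al fr]] := frame_exists hPhi hK gc c0.1.
move: cx; rewrite (frame_verts fr) => -[xE|[m _ <-]]; first by case: x0.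
by exists c, e, al, m.
Qed.

Lemma reflection_edge a x y : a \in Phi -> edge K x y -> edge K (reflection a x) (reflection a y).
Proof.
move=> aP [xy Kxy]; have si := reflection_simplicial hPhi aP; split.
  by move=> /(inv_inj (reflectionK (root_nz hPhi aP))).
have -> : [set reflection a x; reflection a y] = reflection a @` [set x; y].
  by rewrite image_setU !image_set1.
by apply/(isometry_simplex si (simplex_vertices hF Kxy)).
Qed.

(** The edge extends along its ray, inside the 1-skeleton, to the next special point, one period
    away. *)
Lemma edge_quasi_special x y : coweight Phi x -> edge K x y -> quasi_special_edge Phi x y.
Proof.
move=> cx exy.
have : edge K 0 (y - x).
  by rewrite -(subrr x); apply: edge_translate => //; apply: coweightN.
move=> /edge_frame[c [e [al [m [fr xE]]]]].
have T0 := period_gt0 fr m; have T1 := period_ge1 hPhi fr m.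
exists x, (x + period e al m *: e m); split.
  by apply: (ray_special_segment hPhi fr) => //; apply: (period_coweight hPhi fr).
split=> //; exists 0, (period e al m)^-1; split=> //; first by rewrite invr_gt0.
- by rewrite invf_le1.
- by rewrite scale0r addr0.
- by rewrite addrAC subrr add0r scalerA mulVf ?gt_eqF// scale1r -xE addrC subrK.
Qed.

(** Only the types at the origin are kept: translations by coweights recover those at every special
    vertex. *)
Lemma ordering_labelling sig : coxeter_ordering Phi sig ->
  labelling (fun l => [set x | edge K 0 x /\ sig 0 x = l]).
Proof.
move=> os; split.
- move=> l a x aP [ex xl]; have r0 : reflection a 0 = 0 by rewrite /reflection dot0l mulr0 mul0r scale0r subr0.
  split; first by rewrite -r0; apply: reflection_edge.
  rewrite -xl -(ordering_invariant os (g := fun v => (reflection a \o id) v + 0) _ (edge_quasi_special (@coweight0 _ _ Phi) ex)) /=.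
    by rewrite !addr0 r0.
  exists (reflection a \o id), 0; split=> //; last exact: coweight0.
  by apply: weyl_reflection => //; apply: weyl_id.
- by move=> l x [].
- by move=> l m x [_ <-] [].
- move=> c gc c0; have v0 : cell_verts c 0.
    by split=> //; apply/(coweight_vertex hPhi)/coweight0.
  have sp0 : special_point Phi 0 by apply/(special_coweight hPhi)/coweight0.
  have [_ inj surj] := ordering_alcove os sp0 (generic_alcove gc) v0.
  have /choice[e He] : forall l, exists x, [/\ cell_verts c x, x <> 0 & sig 0 x = l].
    by move=> l; have [x [cx x0] <-] := surj l I; exists x.
  exists e; split.
    apply/seteqP; split=> [x cx|x [->//|[l _ <-]]]; last by have [] := He l.
    have [->|x0] := pselect (x = 0); [by left|right; exists (sig 0 x) => //].
    have [cx' x0' E] := He (sig 0 x).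
    by apply: inj => //; rewrite inE; split.
  move=> l; have [cx x0 E] := He l; split=> //; split; first by move=> /esym.
  apply: (hF (cell_verts_simplex Phi c)); last by exists 0; left.
  by move=> z [->|->].
Qed.

Section LabellingTheory.
Variable Om : 'I_n -> set 'rV[R]_n.
Hypothesis hOm : labelling Om.

Lemma labelling_frame c : generic Phi c -> closed_cell Phi c 0 ->
  exists e al, frame Phi c e al /\ forall l, Om l (e l).
Proof.
move=> gc c0; have [e [E He]] := labelling_alcove hOm gc c0.
by have [al fr] := frame_of_verts hPhi gc c0 E; exists e, al.
Qed.

Lemma labelling_weyl w l x : weyl Phi w -> Om l x <-> Om l (w x).
Proof.
elim=> // a {}w aP _ IH; apply: (iff_trans IH); split=> /(labelling_reflection hOm aP)//=.
by rewrite reflectionK// (root_nz hPhi).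
Qed.

Section LabelledFrame.
Variables (c : 'rV[R]_n) (e al : 'I_n -> 'rV[R]_n).
Hypothesis fr : frame Phi c e al.
Hypothesis eOm : forall l, Om l (e l).

Lemma labelling_unique l x : Om l x -> closed_chamber Phi c x -> x = e l.
Proof.
move=> xl cx; have ex := labelling_edge hOm xl.
have := edge_in_chamber hPhi (frame_generic fr) (frame_0 fr) ex cx.
rewrite (frame_verts fr) => -[x0|[m _ mE]]; first by case: ex; rewrite x0.
have lm : l = m by apply: (labelling_disjoint hOm xl); rewrite -mE; apply: eOm.
by rewrite -mE lm.
Qed.

(** The dominant conjugate of [x] keeps the type [l], hence is [e l]. So [e l - x] is the
    displacement estimated in [weyl_dominant]: the defect of one unit step. *)
Lemma labelling_conj : exists2 kap, 0 < kap & forall l x, Om l x ->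
  [/\ exists2 w, weyl Phi w & w x = e l,
      forall m, closed_chamber Phi c m -> 0 <= dot m (e l - x) &
      kap * root_norm Phi (e l - x) <= dot c (e l - x)].
Proof.
have [kap kap0 H] := weyl_dominant hPhi hF (generic_regular (frame_generic fr)).
exists kap => // l x xl; have [w [ww cw H1 H2]] := H x.
have wE : w x = e l by apply: labelling_unique cw; apply: (labelling_weyl l x ww).1.
by rewrite -wE; split=> //; exists w.
Qed.

End LabelledFrame.
End LabellingTheory.

(** By [labelling_conj], [Om l] is the Weyl orbit of [e l], so one alcove determines a labelling. *)
Lemma labelling_eq Om Om' c e al : labelling Om -> labelling Om' -> frame Phi c e al ->
  (forall l, Om l (e l)) -> (forall l, Om' l (e l)) -> forall l, Om l = Om' l.
Proof.
move=> hO hO' fr H H' l; apply/seteqP; split => x xl.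
  have [k _ /(_ l x xl)[[w ww E] _ _]] := labelling_conj hO fr H.
  by apply: (labelling_weyl hO' l x ww).2; rewrite E.
have [k _ /(_ l x xl)[[w ww E] _ _]] := labelling_conj hO' fr H'.
by apply: (labelling_weyl hO l x ww).2; rewrite E.
Qed.

End Labels.

(** * Charts of a building *)

Section Building.
Variables (R : realType) (n : nat) (Delta : euclidean_building R n).
Local Notation Phi := (root_set Delta).
Local Notation hPhi := (building_roots Delta).
Local Notation K := (coxeter_complex Phi).
Local Notation cell_verts := (cell_verts Phi).
Local Notation len := (@len _ _ Delta).
Implicit Types (A B : set (set (vert Delta))) (u v x y : vert Delta) (f g : vert Delta -> 'rV[R]_n).

Lemma apartment_vertices A s : apartment A -> A s -> s `<=` vertices A.
Proof.
move=> aA As x sx; have [_ fc] := building_subcomplex aA.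
by apply: (fc _ _ As) => [_ -> //|]; exists x.
Qed.

Lemma model_vertices s : K s -> s `<=` vertices K.
Proof. by move=> [p ->] x [_ vx]; apply/vertices_coxeter. Qed.

Lemma chart_exists A : apartment A -> exists f, chart A f.
Proof. by move=> aA; have [f Hf] := building_B0 aA; exists f. Qed.

Lemma chart_vertex A f u : chart A f -> vertices A u -> vertices K (f u).
Proof. by move=> [_ [[H _ _] _ _]]; apply: H. Qed.

Lemma chart_inj A f u v : chart A f -> vertices A u -> vertices A v -> f u = f v -> u = v.
Proof. by move=> [_ [[_ H _] _ _]] Au Av; apply: H; rewrite inE. Qed.

Lemma chart_surj A f p : chart A f -> vertices K p -> exists2 u, vertices A u & f u = p.
Proof. by move=> [_ [[_ _ H] _ _]] /H. Qed.

Lemma chart_simplex A f r : chart A f -> K r ->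
  exists s, [/\ A s, s = [set v | vertices A v /\ r (f v)] & f @` s = r].
Proof.
move=> cf Kr; set s := [set v | vertices A v /\ r (f v)].
have E : f @` s = r.
  apply/seteqP; split=> [_ [v [_ rv] <-]//|p rp].
  have [u Au up] := chart_surj cf (model_vertices Kr rp).
  by exists u => //; split=> //; rewrite up.
exists s; split=> //; have [_ si] := cf.
by apply/(isometry_simplex si); [move=> v []|rewrite E].
Qed.

Lemma chart_edge A f u v : chart A f -> vertices A u -> vertices A v ->
  edge A u v <-> edge K (f u) (f v).
Proof.
move=> cf Au Av; have [_ si] := cf.
have E : f @` [set u; v] = [set f u; f v] by rewrite image_setU !image_set1.
have sub : [set u; v] `<=` vertices A by move=> x [->|->].
split=> -[uv H]; split.
- by move/(chart_inj cf Au Av).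
- by rewrite -E; apply/(isometry_simplex si sub).
- by move=> E'; apply: uv; rewrite E'.
- by apply/(isometry_simplex si sub); rewrite E.
Qed.

Lemma model_face_closed A : apartment A -> face_closed K.
Proof.
move=> aA s r Ks rs r0; have [f cf] := chart_exists aA; have [_ si] := cf.
have [s' [As' s'E fs']] := chart_simplex cf Ks.
pose r' := [set v | vertices A v /\ r (f v)].
have Er : f @` r' = r.
  apply/seteqP; split=> [_ [v [_ rv] <-]//|p rp].
  have [u Au up] := chart_surj cf (model_vertices Ks (rs _ rp)).
  by exists u => //; split=> //; rewrite up.
rewrite -Er; apply/(isometry_simplex si); first by move=> v [].
have [_ fc] := building_subcomplex aA; apply: fc As' _ _.
  by rewrite s'E => v [Av /rs rv]; split.
have [p rp] := r0; move: rp; rewrite -Er => -[v rv _]; by exists v.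
Qed.

Lemma model_euclidean A : apartment A -> piecewise_euclidean K (@edist R n).
Proof.
move=> aA s Ks; have [f cf] := chart_exists aA; have [_ si] := cf.
have [s' [As' s'E <-]] := chart_simplex cf Ks.
have [sub fc] := building_subcomplex aA.
have [m [v [p [s'v free lenE]]]] := building_euclidean (sub _ As').
exists m, (f \o v), p; split=> //; first by rewrite s'v image_comp.
move=> i j; have Av k : vertices A (v k).
  by apply: (apartment_vertices aA As'); rewrite s'v; exists k.
have edist0 (k : nat) (x : 'rV[R]_k) : edist x x = 0.
  by rewrite /edist subrr dot0l sqrtr0.
have [E|ne] := pselect (v i = v j).
  by rewrite -lenE /= E lenE !edist0.
rewrite -lenE /= (isometry_len si)//; split=> //; apply: (fc _ _ As').
  by rewrite s'v => x [->|->]; [exists i|exists j].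
by exists (v i); left.
Qed.

(** Supplies what the comparison of apartments consumes: an alcove for (B2), and in it a special
    vertex at which types can be read. *)
Lemma chart_alcove A f s0 : chart A f -> A s0 -> exists s c z,
  [/\ A s, s0 `<=` s, s #= `I_n.+1, generic Phi c & f @` s = cell_verts c] /\
  [/\ s z & coweight Phi (f z)].
Proof.
move=> cf As0; have [aA si] := cf; have hK := model_euclidean aA.
have s0A := apartment_vertices aA As0.
have [p pE] : K (f @` s0) by apply/(isometry_simplex si).
have [c gc cp] := exists_generic hPhi p.
have [s [As sE fs]] := chart_simplex cf (cell_verts_simplex Phi c).
have [x cx cvx] := generic_coweight hPhi gc.
have [z sz zx] : exists2 z, s z & f z = x by move: cvx; rewrite -fs => -[z ? <-]; exists z.
exists s, c, z; split; last by rewrite zx.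
split=> //.
- rewrite sE => v sv; split; first exact: s0A.
  have : (f @` s0) (f v) by exists v.
  by rewrite pE => -[pv vv]; split=> //; apply: (closed_cell_trans cp).
- have [_ ca] := generic_alcove hPhi hK gc; apply: (card_eq_trans _ ca); rewrite -fs card_eq_sym.
  apply: inj_card_eq => u v /set_mem su /set_mem sv; apply: (chart_inj cf);
  exact: (apartment_vertices aA As).
Qed.

Lemma alcove_chart A f s : chart A f -> A s -> s #= `I_n.+1 ->
  exists2 c, generic Phi c & f @` s = cell_verts c.
Proof.
move=> cf As cs; have [aA si] := cf; have hK := model_euclidean aA.
have sA := apartment_vertices aA As.
have Kfs : K (f @` s) by apply/(isometry_simplex si).
have cfs : f @` s #= `I_n.+1.
  apply: card_eq_trans cs; apply: inj_card_eq => u v /set_mem su /set_mem sv.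
  by apply: (chart_inj cf); apply: sA.
by have [c [v [[gc _] E]]] := card_simplex_generic hPhi hK Kfs cfs; exists c.
Qed.

Lemma chart_iso A A' f' phi : apartment A -> chart A' f' ->
  simplicial_isometry A len A' len phi -> chart A (f' \o phi).
Proof.
move=> aA [aA' si'] si; split=> //; apply: simplicial_isometry_comp si si'.
by move=> s; apply: apartment_vertices.
Qed.

Lemma apartment_iso A A' f' s : apartment A -> chart A' f' -> A s -> A' s -> s #= `I_n.+1 ->
  exists phi, [/\ chart A (f' \o phi), forall v, vertices A v -> vertices A' v -> phi v = v &
    forall v, vertices A v -> vertices A' (phi v)].
Proof.
move=> aA cf' As A's cs; have [aA' _] := cf'.
have [phi [si fix_]] := building_B2 aA aA' As A's cs.
exists phi; split=> //; first exact: chart_iso si.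
by have [[H _ _] _ _] := si.
Qed.

Lemma chart_transition A f g : chart A f -> chart A g -> exists L t,
  [/\ coxeter_automorphism Phi L t, forall u, vertices A u -> g u = f u *m L + t &
    forall b, b \in Phi -> exists a s, [/\ a \in Phi, a *m L = s *: b & s != 0]].
Proof.
move=> cf cg; have [aA sf] := cf; have [_ sg] := cg.
have hK := model_euclidean aA; have hF := model_face_closed aA.
have nonempty : exists x : vert Delta, True.
  have K0 : vertices K 0 by apply/vertices_coxeter/(coweight_vertex hPhi)/coweight0.
  by have [x _ _] := chart_surj cf K0; exists x.
have sub := apartment_vertices aA.
have [f' [sf' f'f ff']] := simplicial_isometry_inv nonempty model_vertices sf.
have [g' [sg' g'g gg']] := simplicial_isometry_inv nonempty model_vertices sg.
have sh : simplicial_isometry K (@edist R n) K (@edist R n) (g \o f').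
  exact: simplicial_isometry_comp model_vertices sf' sg.
have sh' : simplicial_isometry K (@edist R n) K (@edist R n) (f \o g').
  exact: simplicial_isometry_comp model_vertices sg' sf.
have h'h p : vertices K p -> (f \o g') ((g \o f') p) = p.
  move=> Kx /=; rewrite g'g ?ff'//; have [[H _ _] _ _] := sf'; exact: H.
have hh' p : vertices K p -> (g \o f') ((f \o g') p) = p.
  move=> Kx /=; rewrite f'f ?gg'//; have [[H _ _] _ _] := sg'; exact: H.
have [L [t [au hE]]] := rigidity hPhi hK hF sh sh' h'h.
exists L, t; split=> // [u Au|b bP].
  by rewrite -hE /= ?f'f//; apply: chart_vertex Au.
have [L' [t' [au' hE']]] := rigidity hPhi hK hF sh' sh hh'.
have LL := automorphism_orth au.
have L'E : L' = L^T.
  have [c gc _] := exists_generic hPhi 0; have [v ev] := generic_enum hPhi hK gc.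
  have [_ Ec] := ev; apply: (affine_inverse (alcove_enum_nondeg hPhi ev) LL (t := t) (t' := t')) => j.
  have vK : vertices K (v j).
    by apply: (model_vertices (cell_verts_simplex Phi c)); rewrite Ec; exists j.
  rewrite -hE// -hE' ?h'h//; have [[H _ _] _ _] := sh; exact: H.
(* The inverse transition shows that every root direction is hit by [L]. *)
have [a [s [aP E s0]]] := automorphism_root au' bP.
exists a, s^-1; split; rewrite ?invr_eq0//.
have : b = s *: (a *m L) by rewrite scalemxAl -E L'E -mulmxA (mulmx1C LL) mulmx1.
by move=> ->; rewrite scalerA mulVf// scale1r.
Qed.

Lemma coweight_charts A f g u : chart A f -> chart A g -> vertices A u ->
  coweight Phi (f u) -> coweight Phi (g u).
Proof.
by move=> cf cg Au cu; have [L [t [au gE _]]] := chart_transition cf cg;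
  rewrite gE//; apply: (automorphism_coweight au).
Qed.

(** Two apartments need not share an alcove. By (B1) a third one shares an alcove with each, so
    comparisons take two steps. *)
Lemma apartment_link A A' f f' s s' : chart A f -> chart A' f' -> A s -> A' s' ->
  exists B r r', [/\ apartment B, [/\ A r, B r, s `<=` r & r #= `I_n.+1],
    [/\ A' r', B r', s' `<=` r' & r' #= `I_n.+1],
    exists2 z, r z & coweight Phi (f z) & exists2 z, r' z & coweight Phi (f' z)].
Proof.
move=> cf cf' As As'; have [aA _] := cf; have [aA' _] := cf'.
have [r [c [z [[Ar sr cr _ _] [rz cz]]]]] := chart_alcove cf As.
have [r' [c' [z' [[Ar' sr' cr' _ _] [rz' cz']]]]] := chart_alcove cf' As'.
have [sub _] := building_subcomplex aA; have [sub' _] := building_subcomplex aA'.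
have [B [aB Br Br']] := building_B1 (sub _ Ar) (sub' _ Ar').
by exists B, r, r'; split=> //; [exists z|exists z'].
Qed.

(** The alcoves of the linking apartment are chosen to contain [x], so both isomorphisms fix it, and
    [f] is carried back to a chart of [A0] without changing its value at [x]. *)
Lemma special_chart A f x : special x -> chart A f -> vertices A x -> coweight Phi (f x).
Proof.
move=> [A0 [f0 [c0 A0x /(special_coweight hPhi) sx]]] cf Ax.
have [aA0 _] := c0; have [aA _] := cf.
have [B [r [r' [aB [A0r Br xr cr] [Ar' Br' xr' cr'] _ _]]]] := apartment_link c0 cf A0x Ax.
have [phi [cB fixB _]] := apartment_iso aB cf Br' Ar' cr'.
have [phi' [cA0 fixA0 _]] := apartment_iso aA0 cB A0r Br cr.
have Bx : vertices B x by apply: (apartment_vertices aB Br); apply: xr.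
have -> : f x = ((f \o phi) \o phi') x by rewrite /= fixA0// fixB.
exact: (coweight_charts c0 cA0).
Qed.

Lemma chart_special A f x : chart A f -> vertices A x -> coweight Phi (f x) -> special x.
Proof. by move=> cf Ax cx; exists A, f; split=> //; apply/(special_coweight hPhi). Qed.

End Building.

Lemma reflection_orth (R : realType) n (L : 'M[R]_n) a b (s : R) x : L *m L^T = 1%:M ->
  b *m L = s *: a -> s != 0 -> a != 0 -> reflection a (x *m L) = reflection b x *m L.
Proof.
move=> LL E s0 a0; have aa := lt0r_neq0 (dot_gt0 a0).
rewrite /reflection mulmxBl -scalemxAl E scalerA.
rewrite -[dot x b](dot_orth _ _ LL) -[dot b b](dot_orth _ _ LL) E !dot_lin.
by congr (_ - _ *: _); field; rewrite aa s0.
Qed.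

(** * Type-preserving charts *)

Section Labelled.
Variables (R : realType) (n : nat) (Delta : euclidean_building R n).
Variable tau : vert Delta -> vert Delta -> 'I_n.
Hypothesis htau : ordering tau.
Local Notation Phi := (root_set Delta).
Local Notation hPhi := (building_roots Delta).
Local Notation K := (coxeter_complex Phi).
Local Notation cell_verts := (cell_verts Phi).
Local Notation len := (@len _ _ Delta).
Implicit Types (A B : set (set (vert Delta))) (u v x y : vert Delta) (f g : vert Delta -> 'rV[R]_n).

(* A chart in which the types of the edges at special vertices are read off from
   the fixed family [Om] of edge vectors. *)
Definition labelled_chart (Om : 'I_n -> set 'rV[R]_n) A f : Prop :=
  chart A f /\ forall u v l, vertices A u -> vertices A v -> edge A u v ->
    coweight Phi (f u) -> (tau u v = l <-> Om l (f v - f u)).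

Lemma ordering_chart A : apartment A -> exists f Om, labelling Phi Om /\ labelled_chart Om A f.
Proof.
move=> aA; have hK := model_euclidean aA; have hF := model_face_closed aA.
have [f [sig [cf os tauE]]] := htau aA.
exists f, (fun l => [set x | edge K 0 x /\ sig 0 x = l]); split.
  exact: (ordering_labelling hPhi hK hF).
split=> // u v l Au Av /(chart_edge cf Au Av) e cu.
have e0 : edge K 0 (f v - f u).
  by rewrite -(subrr (f u)); apply: edge_translate => //; apply: coweightN.
rewrite tauE//; last exact: (edge_quasi_special hPhi hK).
have -> : sig (f u) (f v) = sig 0 (f v - f u).
  have q0 := edge_quasi_special hPhi hK (@coweight0 _ _ Phi) e0.
  rewrite -(ordering_invariant os (g := fun z => id z + f u) _ q0) ?add0r ?subrK//.
  by exists id, (f u); split=> //; apply: weyl_id.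
by split=> [<-|[_ <-]].
Qed.

(** [ordering] provides one good chart per apartment. For another chart the labelling is transported
    by the linear part of the transition. *)
Lemma relabelled_chart A g : chart A g -> exists Om, labelling Phi Om /\ labelled_chart Om A g.
Proof.
move=> cg; have [aA _] := cg; have hK := model_euclidean aA.
have [f [Om0 [hO0 [cf tf]]]] := ordering_chart aA.
have [L [t [au gE inv]]] := chart_transition cf cg; have LL := automorphism_orth au.
have Linj : injective (fun p : 'rV_n => p *m L).
  by move=> p q /(congr1 (mulmx^~ L^T)); rewrite /= -!mulmxA LL !mulmx1.
have gB u v : vertices A u -> vertices A v -> g v - g u = (f v - f u) *m L.
  by move=> Au Av; rewrite !gE// mulmxBl opprD addrACA subrr addr0.
exists (fun l => [set p *m L | p in Om0 l]); split; last first.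
  split=> // u v l Au Av e cu; rewrite gB//.
  apply: (iff_trans (tf u v l Au Av e (coweight_charts cg cf Au cu))).
  by split=> [Ol|[p Ol /Linj <-//]]; exists (f v - f u).
split.
- move=> l a _ aP [p pl <-]; have [b [s [bP E s0]]] := inv a aP.
  exists (reflection b p); first exact: (labelling_reflection hO0).
  by rewrite (reflection_orth p LL E) ?(root_nz hPhi aP).
- move=> l _ [p /(labelling_edge hO0) ep <-].
  have [_ Kp] := ep; have sub := model_vertices Kp.
  have [u Au u0] := chart_surj cf (sub 0 (or_introl erefl)).
  have [v Av vp] := chart_surj cf (sub p (or_intror erefl)).
  have ev : edge K (g u) (g v).
    by apply/(chart_edge cg Au Av)/(chart_edge cf Au Av); rewrite u0 vp.
  have -> : p *m L = g v - g u by rewrite gB// u0 vp subr0.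
  rewrite -(subrr (g u)); apply: edge_translate => //; apply: coweightN.
  by apply: (coweight_charts cf cg Au); rewrite u0; apply: coweight0.
- by move=> l m _ [p pl <-] [q qm /Linj E]; apply: (labelling_disjoint hO0 pl); rewrite -E.
move=> c gc c0.
(* An alcove at the origin of the new chart is carried to the old one, where its vertex over 0 is
   special and can be translated to the origin. *)
have [s [As sE gs]] := chart_simplex cg (cell_verts_simplex Phi c).
have sA := apartment_vertices aA As.
have cs : s #= `I_n.+1.
  have [_ ca] := generic_alcove hPhi hK gc; apply: (card_eq_trans _ ca).
  rewrite -gs card_eq_sym; apply: inj_card_eq => u v /set_mem su /set_mem sv.
  by apply: (chart_inj cg); apply: sA.
have [c' gc' fs] := alcove_chart cf As cs.
have [u su u0] : (g @` s) 0.
  by rewrite gs; split=> //; apply/(coweight_vertex hPhi)/coweight0.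
have Au := sA _ su.
have cz : coweight Phi (f u) by apply: (coweight_charts cg cf Au); rewrite u0; apply: coweight0.
have cNz := coweightN cz.
have gc'' := generic_translate cNz gc'.
have c''0 : closed_cell Phi (c' + - f u) 0.
  rewrite -(subrr (f u)); apply/(closed_cell_translate _ _ cNz).
  by have [] : cell_verts c' (f u) by rewrite -fs; exists u.
have [e [eE eO]] := labelling_alcove hO0 gc'' c''0.
exists (fun l => e l *m L); split; last by move=> l; exists (e l).
apply/seteqP; split=> p.
  rewrite -gs => -[v sv <-]; have Av := sA _ sv.
  have : cell_verts (c' + - f u) (f v - f u).
    by apply/(cell_verts_translate _ _ cNz); rewrite -fs; exists v.
  have -> : g v = (f v - f u) *m L by rewrite -gB// u0 subr0.
  rewrite eE => -[->|[m _ <-]]; first by left; rewrite mul0mx.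
  by right; exists m.
move=> [->|[m _ <-]]; first by rewrite -gs; exists u.
have : cell_verts (c' + - f u) (e m - f u + f u - 0) by rewrite eE subr0 subrK; right; exists m.
rewrite subr0 addrAC => /(cell_verts_translate _ _ cNz); rewrite -fs => -[v sv vE].
rewrite -gs; exists v => //; have Av := sA _ sv.
by rewrite -[g v]subr0 -u0 gB// vE addrK.
Qed.

(** The pulled back chart has some labelling by [relabelled_chart]. It agrees with [Om] on the edges
    at [z] of the fixed alcove [s], hence everywhere by [labelling_eq]. *)
Lemma labelled_chart_iso Om A A' f' phi s z : labelling Phi Om -> labelled_chart Om A' f' ->
  A s -> A' s -> s #= `I_n.+1 -> s z -> coweight Phi (f' z) ->
  chart A (f' \o phi) -> (forall v, vertices A v -> vertices A' v -> phi v = v) ->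
  labelled_chart Om A (f' \o phi).
Proof.
move=> hO [cf' tf'] As A's cs sz cz cA fix_.
have [aA _] := cA; have [aA' _] := cf'.
have hK := model_euclidean aA; have hF := model_face_closed aA.
have [Om' [hO' [_ tf]]] := relabelled_chart cA.
have sA := apartment_vertices aA As; have sA' := apartment_vertices aA' A's.
have [c gc fs] := alcove_chart cf' A's cs.
have cNz := coweightN cz; have gc' := generic_translate cNz gc.
have c'0 : closed_cell Phi (c + - f' z) 0.
  rewrite -(subrr (f' z)); apply/(closed_cell_translate _ _ cNz).
  by have [] : cell_verts c (f' z) by rewrite -fs; exists z.
have [e [al [fr eO]]] := labelling_frame hPhi hO gc' c'0.
have eO' l : Om' l (e l).
  have : cell_verts (c + - f' z) (e l) by apply: frame_vert fr l.
  have -> : e l = (e l + f' z) + - f' z by rewrite addrK.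
  move=> /(cell_verts_translate _ _ cNz); rewrite -fs => -[v sv vE]; rewrite -vE.
  have vz : z <> v.
    move=> E; have [ne _] := labelling_edge hO (eO l); apply: ne.
    by apply: (addIr (f' z)); rewrite -vE -E add0r.
  have ed B : apartment B -> B s -> edge B z v.
    move=> aB Bs; split=> //; have [_ fc] := building_subcomplex aB.
    by apply: (fc _ _ Bs) => [_ [->|->]//|]; exists z; left.
  have Az := sA _ sz; have Av := sA _ sv; have A'z := sA' _ sz; have A'v := sA' _ sv.
  have : tau z v = l by apply/(tf' z v l A'z A'v (ed _ aA' A's) cz); rewrite vE addrK.
  by move=> /(tf z v l Az Av (ed _ aA As)); rewrite /= !fix_//; exact.
have OE := labelling_eq hPhi hF hO hO' fr eO eO'.
by split=> // u v l Au Av ed cu; rewrite OE; apply: tf.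
Qed.

Lemma labelled_chart_exists Om A A' f : labelling Phi Om -> labelled_chart Om A f ->
  apartment A' -> exists f', labelled_chart Om A' f'.
Proof.
move=> hO lf aA'; have [cf _] := lf; have [aA _] := cf.
have [f' cf'] := chart_exists aA'.
have simp (B : set (set (vert Delta))) g : chart B g -> exists s, B s.
  move=> cg; have [s [Bs _ _]] := chart_simplex cg (cell_verts_simplex Phi 0).
  by exists s.
have [s As] := simp _ _ cf; have [s' As'] := simp _ _ cf'.
have [B [r [r' [aB [Ar Br _ cr] [A'r' Br' _ cr'] [z rz cz] [z' rz' cz']]]]] := apartment_link cf cf' As As'.
have [phi [cB fixB _]] := apartment_iso aB cf Br Ar cr.
have lB := labelled_chart_iso hO lf Br Ar cr rz cz cB fixB.
have [phi' [cA' fixA' _]] := apartment_iso aA' cB A'r' Br' cr'.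
exists ((f \o phi) \o phi').
apply: (labelled_chart_iso hO lB A'r' Br' cr' rz' _ cA' fixA').
have A'z' := apartment_vertices aA' A'r' rz'; have Bz' := apartment_vertices aB Br' rz'.
have := coweight_charts cf' cA' A'z' cz'; by rewrite /= fixA'.
Qed.

Lemma labelled_chart_transition Om A f g : labelling Phi Om ->
  labelled_chart Om A f -> labelled_chart Om A g ->
  exists L t, [/\ coxeter_automorphism Phi L t, forall u, vertices A u -> g u = f u *m L + t &
    forall l p, Om l p -> Om l (p *m L)].
Proof.
move=> hO [cf tf] [cg tg]; have [L [t [au gE _]]] := chart_transition cf cg.
exists L, t; split=> // l p pl; have ep := labelling_edge hO pl.
have [_ Kp] := ep; have sub := model_vertices Kp.
have [u Au u0] := chart_surj cf (sub 0 (or_introl erefl)).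
have [v Av vp] := chart_surj cf (sub p (or_intror erefl)).
have e : edge A u v by apply/(chart_edge cf Au Av); rewrite u0 vp.
have cu : coweight Phi (f u) by rewrite u0; apply: coweight0.
have /(tf u v l Au Av e cu) : Om l (f v - f u) by rewrite u0 vp subr0.
move=> /(tg u v l Au Av e (coweight_charts cf cg Au cu)).
by rewrite !gE// u0 vp mul0mx add0r addrK.
Qed.

Lemma labelled_chart_weyl Om A f w : labelling Phi Om -> labelled_chart Om A f ->
  weyl Phi w -> labelled_chart Om A (w \o f).
Proof.
move=> hO [cf tf] ww; have [aA si] := cf; have hF := model_face_closed aA.
have [siw wB wZ wN wc] := weyl_isometry hPhi hF ww.
split.
  split=> //; apply: simplicial_isometry_comp si siw => s; exact: apartment_vertices.
move=> u v l Au Av e cu; rewrite /= -wB.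
apply: (iff_trans (tf u v l Au Av e ((wc (f u)).1 cu))).
exact: (labelling_weyl hPhi hO).
Qed.

Lemma weyl_adjoint w : weyl Phi w -> exists w', (forall a, a \in Phi -> w' a \in Phi) /\
  forall p q, dot (w p) q = dot p (w' q).
Proof.
elim=> [|a {}w aP _ [w' [w'P w'E]]]; first by exists id.
exists (w' \o reflection a); split=> [b bP|p q]; first by apply: w'P; apply: (root_reflection hPhi).
by rewrite /= -w'E dot_reflection.
Qed.

(** A Weyl group element moves the alcove, translated to the origin, into the chamber of [c]; an
    edge vector of type [i] in that chamber is [e i]. *)
Lemma labelled_chart_normal Om c e al A f x (xs : 'I_n -> vert Delta) :
  labelling Phi Om -> frame Phi c e al -> (forall l, Om l (e l)) ->
  labelled_chart Om A f -> A ([set x] `|` range xs) -> [set x] `|` range xs #= `I_n.+1 ->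
  (forall i, tau x (xs i) = i) -> coweight Phi (f x) ->
  exists2 g, labelled_chart Om A g & forall i, g (xs i) = g x + e i.
Proof.
move=> hO fr eO lf As cs tx cx; have [cf tf] := lf; have [aA _] := cf.
have hK := model_euclidean aA; have hF := model_face_closed aA.
set s := [set x] `|` range xs in As cs.
have sA := apartment_vertices aA As; have sx : s x by left.
have sxs i : s (xs i) by right; exists i.
have [d gd fs] := alcove_chart cf As cs.
have cNx := coweightN cx; have gd' := generic_translate cNx gd.
have vd v : s v -> cell_verts (d + - f x) (f v - f x).
  by move=> sv; apply/(cell_verts_translate _ _ cNx); rewrite -fs; exists v.
have d'0 : closed_cell Phi (d + - f x) 0 by have [] := vd x sx; rewrite subrr.
(* Otherwise the [n.+1] elements of [s] would all be among the values of [xs]. *)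
have xxs i : x <> xs i.
  move=> E; have sE : s = range xs.
    by apply/seteqP; split=> [_ [->|//]|v rv]; [exists i|right].
  have : `I_n.+1 #<= `I_n.
    rewrite -(card_le_eql cs) sE (card_le_trans (card_image_le _ _))//.
    by rewrite -(card_le_eql card_II).
  by rewrite card_le_II ltnn.
have Oi i : Om i (f (xs i) - f x).
  apply/(tf x (xs i) i (sA _ sx) (sA _ (sxs i)) _ cx) => //; split=> //.
  have [_ fc] := building_subcomplex aA.
  by apply: (fc _ _ As) => [_ [->|->]//|]; exists x; left.
have [_ _ /(_ (d + - f x))[w [ww wd _ _]]] := weyl_dominant hPhi hF (generic_regular (frame_generic fr)).
have lw := labelled_chart_weyl hO lf ww; exists (w \o f) => // i.
have [siw wB wZ wN wc] := weyl_isometry hPhi hF ww.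
have [w' [w'P w'E]] := weyl_adjoint ww.
suff -> : e i = w (f (xs i) - f x) by rewrite /= wB addrC subrK.
apply/esym/(labelling_unique hPhi hO fr eO); first exact: (labelling_weyl hPhi hO i _ ww).1.
move=> a aP ca; rewrite w'E; have := wd a aP ca; rewrite w'E => H.
have [H1 _] := vd _ (sxs i); apply: (alcove0_ge d'0 H1 (w'P _ aP)).
by rewrite lt_neqAle H eq_sym (generic_regular gd') ?w'P.
Qed.

End Labelled.

(** * Retractions *)

Section Retraction.
Variables (R : realType) (n : nat) (Delta : euclidean_building R n).
Variable tau : vert Delta -> vert Delta -> 'I_n.
Hypothesis htau : ordering tau.
Local Notation Phi := (root_set Delta).
Local Notation hPhi := (building_roots Delta).
Local Notation K := (coxeter_complex Phi).
Local Notation cell_verts := (cell_verts Phi).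
Local Notation len := (@len _ _ Delta).
Implicit Types (A B : set (set (vert Delta))) (u v x y z : vert Delta) (f g h : vert Delta -> 'rV[R]_n).

Variable Om : 'I_n -> set 'rV[R]_n.
Hypothesis hO : labelling Phi Om.
Local Notation labelled_chart := (labelled_chart tau Om).

(* The value at [v], read in the chart [f'] of the apartment [A'], of the retraction
   onto [A'] centred at its alcove [r]. *)
Definition retracts A' f' (r : set (vert Delta)) v (p : 'rV[R]_n) : Prop :=
  exists B phi, [/\ chart B (f' \o phi), B r, vertices B v,
    forall w, vertices B w -> vertices A' w -> phi w = w & p = f' (phi v)].

Section OneRetraction.
Variables (A' : set (set (vert Delta))) (f' : vert Delta -> 'rV[R]_n) (r : set (vert Delta)).
Hypotheses (lf' : labelled_chart A' f') (A'r : A' r) (cr : r #= `I_n.+1).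
Variable z0 : vert Delta.
Hypotheses (rz0 : r z0) (cz0 : coweight Phi (f' z0)).

(** The isomorphism between the two apartments fixes [r] and [v]. Read in charts it is affine and
    fixes the vertices of an alcove, so it is the identity. *)
Lemma retracts_unique v p q : retracts A' f' r v p -> retracts A' f' r v q -> p = q.
Proof.
have [cf' _] := lf'; have [aA' _] := cf'; have hK := model_euclidean aA'.
move=> [B [phi [cB Br Bv fixB ->]]] [B' [phi' [cB' Br' Bv' fixB' ->]]].
have [aB _] := cB; have [aB' _] := cB'.
have [psi [cpsi fix_ _]] := apartment_iso aB cB' Br Br' cr.
have -> : f' (phi' v) = ((f' \o phi') \o psi) v by rewrite /= fix_.
have [L [t [au gE _]]] := chart_transition cB cpsi; have LL := automorphism_orth au.
have [c gc fs] := alcove_chart cf' A'r cr.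
have [w ew] := generic_enum hPhi hK gc; have [_ Ew] := ew.
have nd := alcove_enum_nondeg hPhi ew.
have E j : w j = w j *m L + t.
  have : cell_verts c (w j) by rewrite Ew; exists j.
  rewrite -fs => -[u ru <-].
  have Bu := apartment_vertices aB Br ru; have B'u := apartment_vertices aB' Br' ru.
  have A'u := apartment_vertices aA' A'r ru.
  by have := gE u Bu; rewrite /= fix_// fixB// fixB'.
have L1 : L^T = 1%:M.
  by apply/esym/(affine_inverse nd LL (t := t) (t' := 0)) => j; rewrite mulmx1 addr0.
have {}L1 : L = 1%:M by rewrite -[L]trmxK L1 trmx1.
have t0 : t = 0.
  have := E ord0; rewrite L1 mulmx1 => /eqP; rewrite -subr_eq0 opprD addrA subrr sub0r.
  by rewrite oppr_eq0 => /eqP.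
by rewrite gE// L1 t0 mulmx1 addr0.
Qed.

Lemma apartment_retracts B : apartment B -> B r -> exists phi,
  [/\ chart B (f' \o phi), forall w, vertices B w -> vertices A' w -> phi w = w &
      forall v, vertices B v -> retracts A' f' r v (f' (phi v))].
Proof.
move=> aB Br; have [cf' _] := lf'.
have [phi [cphi fix_ _]] := apartment_iso aB cf' Br A'r cr.
by exists phi; split=> // v Bv; exists B, phi.
Qed.

Lemma retraction_simplex s : @simplex _ _ Delta s -> exists B phi,
  [/\ apartment B, B r, B s & chart B (f' \o phi)] /\
  [/\ forall w, vertices B w -> vertices A' w -> phi w = w &
      forall v, vertices B v -> retracts A' f' r v (f' (phi v))].
Proof.
move=> Ds; have [[aA' _] _] := lf'; have [sub _] := building_subcomplex aA'.
have [B [aB Br Bs]] := building_B1 (sub _ A'r) Ds.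
by have [phi [cphi fix_ H]] := apartment_retracts aB Br; exists B, phi.
Qed.

Lemma retraction_exists v : exists p, retracts A' f' r v p.
Proof.
have Dv : @simplex _ _ Delta [set v].
  by have : [set: vert Delta] v by []; rewrite -building_vertices.
have [B [phi [[aB _ Bv _] [_ H]]]] := retraction_simplex Dv.
by exists (f' (phi v)); apply: H.
Qed.

Lemma retraction_fix v : vertices A' v -> retracts A' f' r v (f' v).
Proof. by move=> A'v; have [cf' _] := lf'; exists A', id; split. Qed.

(** By (B1) some apartment contains both the edge and [r], so the retraction maps the edge to an
    edge. *)
Lemma retraction_edge u v p q : adjacent u v -> retracts A' f' r u p -> retracts A' f' r v q ->
  root_norm Phi (p - q) <= (size Phi)%:R.
Proof.
move=> [uv Duv] up vq.
have [B [phi [[aB _ Buv cB] [_ H]]]] := retraction_simplex Duv.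
have sB := apartment_vertices aB Buv.
have Bu := sB u (or_introl erefl); have Bv := sB v (or_intror erefl).
rewrite (retracts_unique up (H u Bu)) (retracts_unique vq (H v Bv)).
have e : edge K ((f' \o phi) u) ((f' \o phi) v) by apply/(chart_edge cB Bu Bv).
rewrite -[leRHS]mul1r; apply: root_norm_le => a aP; rewrite dotBl.
exact: (edge_width hPhi e aP).
Qed.

Lemma retraction_dist k u v p q : dist_le (@adjacent _ _ Delta) k u v ->
  retracts A' f' r u p -> retracts A' f' r v q ->
  root_norm Phi (p - q) <= k%:R * (size Phi)%:R.
Proof.
move=> d; move: k u v d p q; apply: dist_le_ind => [x k p q xp xq|x y w k xy IH p q xp wq].
  by rewrite (retracts_unique xp xq) subrr root_norm0 mulr_ge0 ?ler0n.
have [p' yp'] := retraction_exists y.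
have := IH _ _ yp' wq; have := retraction_edge xy xp yp'.
have -> : p - q = (p - p') + (p' - q) by rewrite addrA subrK.
have := root_normD Phi (p - p') (p' - q); rewrite -natr1 mulrDl mul1r; lra.
Qed.

(** Place an alcove of [A] around the edge in one apartment with [r]. On that alcove the retraction
    is a labelled chart of [A], so it differs from [g] by an affine map preserving types. The edge
    need not start at a special vertex: its type is that of its direction [w]. *)
Lemma retraction_step A g u v l (k : R) w p q : labelled_chart A g ->
  edge A u v -> g v - g u = k *: w -> Om l w ->
  retracts A' f' r u p -> retracts A' f' r v q ->
  exists2 w', Om l w' & q - p = k *: w'.
Proof.
move=> lg [uv Auv] gE wl up vq; have [cg _] := lg; have [aA _] := cg.
have [s [_ [z [[As sub cs _ _] [sz cz]]]]] := chart_alcove cg Auv.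
have sA := apartment_vertices aA As; have Az := sA _ sz.
have [subA _] := building_subcomplex aA.
have [B [phi [[aB Br Bs cB] [fixB H]]]] := retraction_simplex (subA _ As).
have sB := apartment_vertices aB Bs; have Bz := sB _ sz.
have lB : labelled_chart B (f' \o phi).
  exact: (labelled_chart_iso htau hO lf' Br A'r cr rz0 cz0 cB fixB).
have [psi [cA fix_ _]] := apartment_iso aA cB As Bs cs.
have czB : coweight Phi ((f' \o phi) z).
  by apply: (special_chart _ cB Bz); apply: (chart_special cg Az cz).
have lA := labelled_chart_iso htau hO lB As Bs cs sz czB cA fix_.
have [L [t [_ LE OL]]] := labelled_chart_transition hO lg lA.
have su : s u by apply: sub; left. have sv : s v by apply: sub; right.
exists (w *m L); first exact: OL.
rewrite (retracts_unique up (H u (sB _ su))) (retracts_unique vq (H v (sB _ sv))).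
have Eu := LE u (sA _ su); have Ev := LE v (sA _ sv).
rewrite /= fix_ in Eu; [|exact: sA|exact: sB].
rewrite /= fix_ in Ev; [|exact: sA|exact: sB].
by rewrite Eu Ev opprD addrACA subrr addr0 -mulmxBl gE scalemxAl.
Qed.

End OneRetraction.

(** * Defects of paths under retraction *)

Section Cone.
Variables (c : 'rV[R]_n) (e al : 'I_n -> 'rV[R]_n) (kap : R).
Hypothesis fr : frame Phi c e al.
Hypothesis eO : forall l, Om l (e l).
Hypothesis kap0 : 0 < kap.
Hypothesis Hkap : forall l p, Om l p ->
  [/\ exists2 w, weyl Phi w & w p = e l,
      forall m, closed_chamber Phi c m -> 0 <= dot m (e l - p) &
      kap * root_norm Phi (e l - p) <= dot c (e l - p)].

(** Dual to the chamber, and uniformly pointed: [dot c] is additive and controls the norm, so a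
    bound on a sum of elements bounds every summand. *)
Definition cone (d : 'rV[R]_n) : Prop :=
  (forall m, closed_chamber Phi c m -> 0 <= dot m d) /\ kap * root_norm Phi d <= dot c d.

Lemma cone0 : cone 0.
Proof. by split=> [m _|]; rewrite dot0r// root_norm0 mulr0. Qed.

Lemma coneD d d' : cone d -> cone d' -> cone (d + d').
Proof.
move=> [H1 H2] [H1' H2']; split=> [m cm|]; first by rewrite dotDr addr_ge0 ?H1 ?H1'.
rewrite dotDr (le_trans (ler_wpM2l (ltW kap0) (root_normD _ _ _)))//.
by rewrite mulrDr lerD.
Qed.

Lemma coneZ (k : R) d : 0 <= k -> cone d -> cone (k *: d).
Proof.
move=> k0 [H1 H2]; split=> [m cm|]; first by rewrite dotZr mulr_ge0 ?H1.
by rewrite root_normZ ger0_norm// dotZr mulrCA ler_wpM2l.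
Qed.

Lemma cone_step l p (k : R) : Om l p -> 0 <= k -> cone (k *: e l - k *: p).
Proof. by move=> xl k0; rewrite -scalerBr; apply: coneZ => //; have [] := Hkap xl. Qed.

Lemma cone_ge0 d : cone d -> 0 <= dot c d.
Proof. by move=> [_]; apply: le_trans; rewrite mulr_ge0 ?root_norm_ge0// ltW. Qed.

Definition frame_step A g u v : Prop :=
  [/\ vertices A u, vertices A v, edge A u v &
    exists l (k : R), 0 <= k /\ g v - g u = k *: e l].

Definition frame_path A g x (P : seq (vert Delta)) : Prop :=
  [/\ labelled_chart A g, vertices A x & path (fun u v => `[< frame_step A g u v >]) x P].

Lemma frame_path_cat A g x P Q : frame_path A g x (P ++ Q) ->
  frame_path A g x P /\ frame_path A g (last x P) Q.
Proof.
move=> [lg Ax]; rewrite cat_path => /andP[pP pQ]; split=> //; split=> //.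
elim: P x Ax pP {pQ} => //= y P IH x Ax /andP[/asboolP[_ Ay _ _]]; exact: IH.
Qed.

Lemma frame_path_last A g x P : frame_path A g x P -> vertices A (last x P).
Proof.
by move=> H; have [_ [_ ? _]] := @frame_path_cat A g x P [::] (ltac:(rewrite cats0; exact: H)).
Qed.

(** The defects of single edges, in the cone by [cone_step], telescope. *)
Lemma frame_path_defect A g x P A' f' r z0 (F : vert Delta -> 'rV[R]_n) :
  frame_path A g x P ->
  labelled_chart A' f' -> A' r -> r #= `I_n.+1 -> r z0 -> coweight Phi (f' z0) ->
  (forall v, retracts A' f' r v (F v)) ->
  cone ((g (last x P) - g x) - (F (last x P) - F x)).
Proof.
move=> [lg Ax pP] lf' A'r cr rz0 cz0 HF; elim: P x Ax pP => [|y P IH] x Ax /=.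
  by move=> _; rewrite !subrr; apply: cone0.
move=> /andP[/asboolP[_ Ay exy [l [k [k0 gE]]]] pP].
have [w wl FE] := retraction_step lf' A'r cr rz0 cz0 lg exy gE (eO l) (HF x) (HF y).
have := coneD (cone_step wl k0) (IH y Ay pP).
rewrite -gE -FE; set a := g _; set b := F (last y P).
congr cone; rewrite [LHS]addrACA; congr (_ + _); first by rewrite addrC addrA subrK.
by rewrite -opprD; congr (- _); rewrite addrC addrA subrK.
Qed.

Lemma frame_norm_bound : exists2 C, 0 < C & forall d (B : R),
  (forall l, `|dot (e l) d| <= B) -> root_norm Phi d <= C * B.
Proof.
pose C a := \sum_l `|dot a (al l) * period e al l|.
exists (1 + \sum_(a <- Phi) C a).
  by rewrite ltr_pwDl// sumr_ge0// => a _; apply: sumr_ge0.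
move=> d B H; have B0 : 0 <= B by apply: le_trans (H (Ordinal (dim_gt0 hPhi))).
rewrite mulrDl mul1r (@le_trans _ _ ((\sum_(a <- Phi) C a) * B))//; last by rewrite lerDr.
rewrite mulr_suml; apply: ler_sum => a _.
rewrite {1}(frame_expand hPhi fr a) dot_sumr mulr_suml.
rewrite (le_trans (ler_norm_sum _ _ _))//; apply: ler_sum => l _.
by rewrite dotZr normrM ler_wpM2l// dotC.
Qed.

(** Each [e l] is dominant, so it pairs nonnegatively with the defect; what remains are the errors
    at the two ends, bounded by [retraction_dist]. *)
Lemma frame_path_one_sided k0 : exists2 C, 0 < C & forall A g x P A' f' x' P',
  frame_path A g x P -> frame_path A' f' x' P' ->
  dist_le (@adjacent _ _ Delta) k0 x x' ->
  dist_le (@adjacent _ _ Delta) k0 (last x P) (last x' P') ->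
  forall l, - C <= dot (e l) ((g (last x P) - g x) - (f' (last x' P') - f' x')).
Proof.
have [C C0 HC] : exists2 C, 0 < C & forall l d, `|dot (e l) d| <= C * root_norm Phi d.
  have /choice[C HC] : forall l, exists C, 0 < C /\ forall d, `|dot d (e l)| <= C * root_norm Phi d.
    by move=> l; have [C C0 H] := dot_bound hPhi (e l); exists C.
  exists (1 + \sum_l C l).
    by rewrite ltr_pwDl// sumr_ge0// => l _; have [/ltW] := HC l.
  move=> l d; have [_ H] := HC l; rewrite dotC (le_trans (H d))// ler_wpM2r ?root_norm_ge0//.
  rewrite (bigD1 l)//= addrCA lerDl addr_ge0// sumr_ge0// => m _.
  by have [/ltW] := HC m.
exists (1 + C * ((k0%:R + k0%:R) * (size Phi)%:R)).
  by rewrite ltr_pwDl// !mulr_ge0 ?addr_ge0// ltW.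
move=> A g x P A' f' x' P' fP fP' dx dz l.
have [lf' A'x' _] := fP'; have [cf' _] := lf'; have A'z' := frame_path_last fP'.
have [r [_ [z0 [[A'r _ cr _ _] [rz0 cz0]]]]] := chart_alcove cf' A'x'.
have /choice[F HF] := retraction_exists lf' A'r cr.
have [D1 _] := frame_path_defect fP lf' A'r cr rz0 cz0 HF.
have Nx := retraction_dist lf' A'r cr dx (HF x) (retraction_fix lf' A'r A'x').
have Nz := retraction_dist lf' A'r cr dz (HF _) (retraction_fix lf' A'r A'z').
have ech : closed_chamber Phi c (e l) by move=> a aP ca; apply: (frame_ge0 fr).
have H := D1 _ ech.
set z := last x P in dz H Nz *; set z' := last x' P' in dz A'z' Nz *.
have E : g z - g x - (f' z' - f' x') =
    (g z - g x - (F z - F x)) + ((F z - f' z') - (F x - f' x')).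
  by apply/rowP => i; rewrite !mxE; ring.
rewrite E dotDr.
have := HC l ((F z - f' z') - (F x - f' x')).
have : C * root_norm Phi ((F z - f' z') - (F x - f' x')) <= C * ((k0%:R + k0%:R) * (size Phi)%:R).
  rewrite ler_pM2l// (le_trans (root_normB _ _ _))// mulrDl; exact: lerD.
rewrite ler_norml => H1 /andP[H2 _]; lra.
Qed.

(** The one-sided bound for both orders of the paths controls the total defect, and this dominates
    the defect of the prefix [P]. Up to bounded errors the true distance of the two intermediate
    points is thus that of their displacements. *)
Lemma frame_path_compare k0 : exists2 C, 0 < C & forall A g x P Q A' f' x' P' Q',
  frame_path A g x (P ++ Q) -> frame_path A' f' x' (P' ++ Q') ->
  dist_le (@adjacent _ _ Delta) k0 x x' -> dist_le (@adjacent _ _ Delta) k0 x' x ->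
  dist_le (@adjacent _ _ Delta) k0 (last x (P ++ Q)) (last x' (P' ++ Q')) ->
  dist_le (@adjacent _ _ Delta) k0 (last x' (P' ++ Q')) (last x (P ++ Q)) ->
  root_norm Phi ((g (last x (P ++ Q)) - g x) - (f' (last x' (P' ++ Q')) - f' x')) <= C /\
  exists B h, [/\ chart B h, vertices B (last x P), vertices B (last x' P') &
    root_norm Phi (h (last x P) - h (last x' P')) <=
    C + root_norm Phi ((g (last x P) - g x) - (f' (last x' P') - f' x'))].
Proof.
have [C1 C10 H1] := frame_path_one_sided k0; have [C2 C20 H2] := frame_norm_bound.
have [C3 C30 H3] := dot_bound hPhi c.
set W := k0%:R * (size Phi)%:R : R.
have W0 : 0 <= W by rewrite mulr_ge0.
(* [C2 * C1 + (W + W)] bounds the norm of the total defect, the two [W] being the errors at the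
   ends; [C3] turns this into a bound on its pairing with [c], and [kap^-1] into one on the norm of
   the prefix defect. *)
set C4 := kap^-1 * (C3 * (C2 * C1 + (W + W))).
have C40 : 0 <= C4.
  by rewrite !mulr_ge0 ?addr_ge0 ?invr_ge0//; rewrite ?mulr_ge0 ?ltW.
exists (C2 * C1 + W + C4) => [|A g x P Q A' f' x' P' Q' fP fP' dx dx' dz dz'].
  by rewrite -addrA ltr_pwDl ?mulr_gt0// addr_ge0.
have nE : root_norm Phi ((g (last x (P ++ Q)) - g x) - (f' (last x' (P' ++ Q')) - f' x')) <= C2 * C1.
  apply: H2 => l; rewrite ler_norml (H1 _ _ _ _ _ _ _ _ fP fP' dx dz)/=.
  have := H1 _ _ _ _ _ _ _ _ fP' fP dx' dz' l.
  by rewrite -[in X in _ <= X -> _]opprB dotNr lerN2.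
split; first by rewrite (le_trans nE)// -addrA lerDl addr_ge0.
have [fP1 fP2] := frame_path_cat fP; have [fP1' _] := frame_path_cat fP'.
set z := last x (P ++ Q) in dz dz' nE; set z' := last x' (P' ++ Q') in dz dz' nE.
have zE : last (last x P) Q = z by rewrite /z last_cat.
set v := last x P in fP2 zE *; set v' := last x' P'.
have [lf' A'x' _] := fP'; have [cf' _] := lf'.
have A'z' := frame_path_last fP'; have A'v' := frame_path_last fP1'.
(* The centre contains [v'], so the apartment [B] through [r] and [v] contains both points, and its
   chart [f' \o phi] is the retraction, which fixes [v']. *)
have [r [_ [z0 [[A'r sv' cr _ _] [rz0 cz0]]]]] := chart_alcove cf' A'v'.
have rv' : r v' by apply: sv'.
have /choice[F HF] := retraction_exists lf' A'r cr.
have D1 := frame_path_defect fP1 lf' A'r cr rz0 cz0 HF.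
have D2 := frame_path_defect fP2 lf' A'r cr rz0 cz0 HF.
rewrite -/v in D1; rewrite zE in D2.
have Nx := retraction_dist lf' A'r cr dx (HF x) (retraction_fix lf' A'r A'x').
have Nz := retraction_dist lf' A'r cr dz (HF _) (retraction_fix lf' A'r A'z').
rewrite -/W -/z -/z' in Nx Nz.
have [B [phi [[aB Br Bv cB] [fixB HB]]]] : exists B phi,
    [/\ apartment B, B r, B [set v] & chart B (f' \o phi)] /\
    [/\ forall w, vertices B w -> vertices A' w -> phi w = w &
      forall w, vertices B w -> retracts A' f' r w (f' (phi w))].
  apply: (retraction_simplex lf' A'r cr).
  by have : [set: vert Delta] v by []; rewrite -building_vertices.
have Bv' := apartment_vertices aB Br rv'.
exists B, (f' \o phi); split=> //.
have -> : (f' \o phi) v = F v by apply: (retracts_unique lf' A'r cr (HB _ Bv) (HF v)).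
have -> : (f' \o phi) v' = f' v' by rewrite /= fixB.
have [_ D1n] := D1; have D2n := cone_ge0 D2.
have dE : (g v - g x - (F v - F x)) + (g z - g v - (F z - F v)) = 
    (g z - g x - (f' z' - f' x')) - ((F z - f' z') - (F x - f' x')).
  by apply/rowP => i; rewrite !mxE; ring.
have nd : root_norm Phi ((g v - g x - (F v - F x)) + (g z - g v - (F z - F v))) <= C2 * C1 + (W + W).
  rewrite dE (le_trans (root_normB _ _ _))// lerD//.
  by rewrite (le_trans (root_normB _ _ _))// lerD.
have D1b : root_norm Phi (g v - g x - (F v - F x)) <= C4.
  rewrite /C4 -ler_pdivrMl ?invr_gt0// invrK (le_trans D1n)//.
  apply: (@le_trans _ _ (dot c ((g v - g x - (F v - F x)) + (g z - g v - (F z - F v))))).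
    by rewrite [leRHS]dotDr lerDl.
  rewrite dotC (le_trans (ler_norm _))// (le_trans (H3 _))// ler_pM2l//.
have vE : F v - f' v' = (F x - f' x') + (g v - g x - (f' v' - f' x')) - (g v - g x - (F v - F x)).
  by apply/rowP => i; rewrite !mxE; ring.
rewrite {1}vE (le_trans (root_normB _ _ _))// (le_trans (lerD (root_normD _ _ _) D1b))//.
have := mulr_gt0 C20 C10; lra.
Qed.

End Cone.
End Retraction.

(** * Positions along a path *)

Lemma path_at_last (T : Type) (x : T) s t : path_at (x, s) t = last x (take t s).
Proof.
by rewrite /path_at /=; elim: s x t => [|y s IH] x [|t] //=; rewrite nth_nil.
Qed.

Lemma last_take_nth (T : Type) (x0 x : T) s i : (i <= size s)%N ->
  last x (take i s) = nth x0 (x :: s) i.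
Proof.
elim: s x i => [|y s IH] x [|i] //=; rewrite ltnS => si; exact: IH.
Qed.

(** * Counting steps along one ray and through several blocks *)

Section Blocks.
Variable R : realType.
Implicit Types (rs : seq R) (m r : R).

Definition enumerates (Rd : R -> Prop) m rs : Prop :=
  path <%R 0 rs /\ forall r, r \in rs <-> Rd r /\ 0 < r <= m.

(** Gaps are at least [d] because all elements are multiples of [d'], and at most [T] because the
    set is stable under adding [T']. The slack lets one pair [d], [T] serve for all directions. *)
Definition uniformly_spaced (Rd : R -> Prop) (d T : R) : Prop :=
  [/\ 0 < d, 0 < T,
    exists2 d', d <= d' & forall r, Rd r -> r / d' \is a Num.int &
    exists2 T', 0 < T' <= T & forall r, r = 0 \/ Rd r -> Rd (r + T')].

Section OneBlock.
Variables (Rd : R -> Prop) (d T : R).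
Hypothesis hRd : uniformly_spaced Rd d T.
Local Notation pos rs i := (nth 0 (0 :: rs) i).

Lemma block_next m rs i r : enumerates Rd m rs -> (i <= size rs)%N ->
  r \in rs -> pos rs i < r -> (i < size rs)%N /\ pos rs i.+1 <= r.
Proof.
move=> [srt _] isz rin lt.
have jsz : ((index r rs).+1 < (size rs).+1)%N by rewrite ltnS index_mem.
have jE : pos rs (index r rs).+1 = r by rewrite /= nth_index.
have ij : (i < (index r rs).+1)%N.
  by rewrite -(lt_sorted_ltn_nth 0 (s := 0 :: rs) srt) ?inE ?jE//= ltnS.
have isz' : (i < size rs)%N by apply: leq_ltn_trans (_ : (index r rs < _)%N); rewrite ?index_mem.
split=> //; rewrite -[leRHS]jE (lt_sorted_leq_nth 0 (s := 0 :: rs) srt)//.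
Qed.

Lemma block_pos m rs i : enumerates Rd m rs -> (i <= size rs)%N ->
  0 <= pos rs i /\ (pos rs i = 0 \/ pos rs i \in rs).
Proof.
move=> [srt H]; case: i => [|i] isz /=; first by split; [|left].
have rin : rs`_i \in rs by apply: mem_nth.
by have /H[_ /andP[/ltW ? _]] := rin; split; [|right].
Qed.

Lemma block_gap m rs i : enumerates Rd m rs -> (i < size rs)%N ->
  d <= pos rs i.+1 - pos rs i <= T.
Proof.
move=> en isz; have [srt H] := en.
have [d0 _ [d' dd' Rint] [T' /andP[T0 TT'] RT]] := hRd.
have {}d0 := lt_le_trans d0 dd'.
have [p0 pin] := block_pos en (ltnW isz).
have lt : pos rs i < pos rs i.+1.
  by rewrite (lt_sorted_ltn_nth 0 (s := 0 :: rs) srt)// inE /= ltnS ltnW.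
have pin' : pos rs i.+1 \in rs by rewrite /=; apply: mem_nth.
have /H[Rp' /andP[_ pm]] := pin'.
have Rp : pos rs i = 0 \/ Rd (pos rs i) by case: pin => [|/H[]]; [left|right].
apply/andP; split.
  apply: (le_trans dd'); have : (pos rs i.+1 - pos rs i) / d' \is a Num.int.
    rewrite mulrBl rpredB ?(Rint _ Rp')//.
    by case: Rp => [->|/Rint//]; rewrite mul0r int_num0.
  move=> /intrP[k kE]; have : 0 < k%:~R :> R by rewrite -kE divr_gt0 ?subr_gt0.
  rewrite -[ltLHS]/(0%:~R) ltr_int => k0.
  rewrite -[leLHS]mul1r -ler_pdivlMr// kE -[leLHS]/(1%:~R) ler_int; lia.
apply: le_trans TT'; rewrite lerBlDl leNgt; apply/negP => lt'.
have inT : pos rs i + T' \in rs.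
  apply/H; split; first exact: RT.
  by rewrite ltr_wpDl//= (le_trans (ltW lt')).
have ltT : pos rs i < pos rs i + T' by rewrite ltrDl.
by have [_] := block_next en (ltnW isz) inT ltT; rewrite leNgt lt'.
Qed.

Lemma block_dist m rs i j : enumerates Rd m rs -> (i <= j <= size rs)%N ->
  d * (j - i)%:R <= pos rs j - pos rs i <= T * (j - i)%:R.
Proof.
move=> en /andP[ij]; rewrite -(subnKC ij); move: (j - i)%N => k {j ij}.
elim: k => [|k IH]; first by rewrite addn0 subrr subnn !mulr0 lexx.
rewrite addnS => isz; have /andP[IH1 IH2] := IH (ltnW isz).
have /andP[g1 g2] := block_gap en isz.
move: IH1 IH2; rewrite subSn ?leq_addr// addKn -natr1 !mulrDr !mulr1 => IH1 IH2.
apply/andP; split; lra.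
Qed.

(** Both lists run through the same set in increasing order; only the stopping points differ. *)
Lemma block_prefix m m' rs rs' i : enumerates Rd m rs -> enumerates Rd m' rs' ->
  m <= m' -> (i <= size rs)%N -> (i <= size rs')%N /\ pos rs i = pos rs' i.
Proof.
move=> en en' mm'; have [srt H] := en; have [srt' H'] := en'.
elim: i => [//|i IH] isz; have [isz' E] := IH (ltnW isz).
have lt : pos rs i < pos rs i.+1.
  by rewrite (lt_sorted_ltn_nth 0 (s := 0 :: rs) srt)// inE /= ltnS ltnW.
have rin : pos rs i.+1 \in rs by rewrite /=; apply: mem_nth.
have /H[Rr /andP[r0 rm]] := rin.
have rin' : pos rs i.+1 \in rs' by apply/H'; rewrite r0 (le_trans rm).
have lt2 : pos rs' i < pos rs i.+1 by rewrite -E.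
have [isz2 le1] := block_next en' isz' rin' lt2; split=> //.
apply/eqP; rewrite eq_le le1 andbT.
have qin : pos rs' i.+1 \in rs' by rewrite /=; apply: mem_nth.
have /H'[Rq /andP[q0 _]] := qin.
have qin' : pos rs' i.+1 \in rs by apply/H; rewrite q0 (le_trans le1).
have lt3 : pos rs i < pos rs' i.+1.
  by rewrite E (lt_sorted_ltn_nth 0 (s := 0 :: rs') srt')// inE /= ltnS ltnW.
by have [] := block_next en (ltnW isz) qin' lt3.
Qed.

Lemma block_compare m m' rs rs' i j : enumerates Rd m rs -> enumerates Rd m' rs' ->
  (i <= size rs)%N -> (j <= size rs')%N ->
  d * `|i%:R - j%:R| <= `|pos rs i - pos rs' j| <= T * `|i%:R - j%:R|.
Proof.
wlog mm' : m m' rs rs' i j / m <= m'.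
  move=> W en en' isz jsz; have [mm'|/ltW m'm] := leP m m'; first exact: (W m m').
  by have := W m' m rs' rs j i m'm en' en jsz isz; rewrite !(distrC j%:R) (distrC (pos rs' j)).
move=> en en' isz jsz; have [isz' ->] := block_prefix en en' mm' isz.
have [d0 T0 _ _] := hRd.
wlog ij : i j isz' jsz {isz} / (i <= j)%N.
  move=> W; have [ij|/ltnW ji] := leqP i j; first exact: W.
  by have := W j i jsz isz' ji; rewrite (distrC j%:R) (distrC (pos rs' j)).
have ijs : (i <= j <= size rs')%N by rewrite ij.
have /andP[H1 H2] := block_dist en' ijs.
have E1 : `|i%:R - j%:R| = (j - i)%:R :> R by rewrite distrC -natrB// ger0_norm.
have E2 : `|pos rs' i - pos rs' j| = pos rs' j - pos rs' i.
  by rewrite distrC ger0_norm//; apply: le_trans H1; rewrite mulr_ge0 ?(ltW d0).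
by rewrite E1 E2 H1 H2.
Qed.

End OneBlock.

Section Offsets.
Variable I : eqType.
Implicit Types (ls : seq I) (kk : I -> nat).

(** The time at which the block of direction [l] begins, when direction [x] takes [kk x] steps. *)
Definition offset ls kk l : nat := \sum_(x <- take (index l ls) ls) kk x.

Lemma offset_cons l0 ls kk l : l != l0 -> offset (l0 :: ls) kk l = (kk l0 + offset ls kk l)%N.
Proof. by move=> /negPf ll0; rewrite /offset /= eq_sym ll0 big_cons. Qed.

Lemma offset_head l0 ls kk : offset (l0 :: ls) kk l0 = 0%N.
Proof. by rewrite /offset /= eqxx big_nil. Qed.

(** The number of steps in direction [x] made up to time [k]; the truncated subtraction gives 0
    before the block begins. *)
Definition truncated ls kk k x : nat := minn (k - offset ls kk x) (kk x).

(** A path stopped at time [k] is the complete path with truncated block lengths, so that prefixes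
    can be compared like complete paths. *)
Lemma truncated_offset ls kk k t l : uniq ls -> l \in ls ->
  minn (minn t k - offset ls kk l) (kk l) =
  minn (t - offset ls (truncated ls kk k) l) (truncated ls kk k l).
Proof.
elim: ls k t => [//|l0 ls IH] k t; rewrite cons_uniq => /andP[l0ls uls]; rewrite inE.
have tl0 : truncated (l0 :: ls) kk k l0 = minn k (kk l0).
  by rewrite /truncated offset_head subn0.
have tl x : x != l0 -> truncated (l0 :: ls) kk k x = truncated ls kk (k - kk l0) x.
  by move=> xl0; rewrite /truncated offset_cons// subnDA.
have [->|ll0] := eqVneq l l0.
  move=> _; rewrite !offset_head tl0; lia.
move=> /= lls; rewrite !offset_cons// tl0 tl//.
have -> : offset ls (truncated (l0 :: ls) kk k) l = offset ls (truncated ls kk (k - kk l0)) l.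
  apply: eq_big_seq => x /mem_take xls; apply: tl.
  by apply: contraNneq l0ls => <-.
have [kle|kge] := leqP (kk l0) k; last first.
  have E : (k - kk l0 = 0)%N by lia.
  by rewrite /truncated E sub0n; lia.
have := IH (k - kk l0)%N (t - kk l0)%N uls lls.
have -> : (minn (t - kk l0) (k - kk l0) - offset ls kk l =
    minn t k - (kk l0 + offset ls kk l))%N by lia.
by move=> ->; rewrite subnDA.
Qed.

Lemma offset_close ls kk kk' E l : (forall x, x \in ls -> kk x <= kk' x + E)%N ->
  (offset ls kk l <= offset ls kk' l + size ls * E)%N.
Proof.
move=> H; rewrite /offset; set s := take _ _.
have sls : {subset s <= ls} by move=> m /mem_take.
have : (size s <= size ls)%N by rewrite size_take; case: ltnP => // /ltnW.
move: (size ls) => N; elim: s N sls => [|m s IH] N sls; first by rewrite !big_nil.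
case: N => [//|N]; rewrite /= ltnS => sN; rewrite !big_cons mulSn.
have := IH N (fun x xs => sls x (mem_behead (s := m :: s) xs)) sN.
have := H m (sls m (mem_head _ _)); lia.
Qed.

End Offsets.

End Blocks.

Section Walks.
Variables (R : realType) (n : nat) (I : eqType).
Implicit Types (ls : seq I) (rs : I -> seq R) (e : I -> 'rV[R]_n) (X : 'rV[R]_n).

(** The coordinate along direction [l] reached at time [t]; the default 0 of [last] covers the times
    before the block begins. *)
Definition walk_coef ls rs t l : R :=
  last 0 (take (t - offset ls (size \o rs) l) (rs l)).

Lemma walk_position ls rs e X (q : I -> seq 'rV[R]_n) : uniq ls ->
  (forall l, l \in ls -> q l =
    [seq X + \sum_(x <- take (index l ls) ls) last 0 (rs x) *: e x + r *: e l | r <- rs l]) ->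
  forall t, last X (take t (flatten [seq q l | l <- ls])) =
    X + \sum_(l <- ls) walk_coef ls rs t l *: e l.
Proof.
elim: ls X => [|l0 ls IH] X /=; first by move=> _ _ [|t]; rewrite big_nil addr0.
move=> /andP[l0ls uls] Hq t; rewrite big_cons.
have q0 : q l0 = [seq X + r *: e l0 | r <- rs l0].
  by rewrite Hq ?mem_head//= eqxx big_nil; apply: eq_map => r; rewrite addr0.
have lastX s : last X [seq X + r *: e l0 | r <- s] = X + last 0 s *: e l0.
  rewrite -[X in last X](addr0 X) -[X in _ + X](scale0r (e l0)).
  exact: (last_map (fun r => X + r *: e l0)).
have nl l : l \in ls -> l != l0 by move=> lls; apply: contraNneq l0ls => <-.
have c0 : walk_coef (l0 :: ls) rs t l0 = last 0 (take t (rs l0)).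
  by rewrite /walk_coef offset_head subn0.
have cl l : l \in ls -> walk_coef (l0 :: ls) rs t l = walk_coef ls rs (t - size (rs l0)) l.
  by move=> lls; rewrite /walk_coef offset_cons ?nl// subnDA.
rewrite c0 (eq_big_seq (fun l => walk_coef ls rs (t - size (rs l0)) l *: e l)); last first.
  by move=> l lls; rewrite cl.
rewrite take_cat; have sq : size (q l0) = size (rs l0) by rewrite q0 size_map.
rewrite sq; case: ltnP => tsz.
  have -> : (t - size (rs l0) = 0)%N by lia.
  rewrite big1 => [|l _]; last by rewrite /walk_coef sub0n take0 scale0r.
  by rewrite addr0 q0 -map_take lastX.
rewrite last_cat q0 lastX (@take_oversize _ t (rs l0))// IH ?addrA// => l lls.
rewrite Hq ?inE ?lls ?orbT//= eq_sym (negPf (nl l lls)) big_cons.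
by apply: eq_map => r; rewrite addrA.
Qed.

Variables (Rd : I -> R -> Prop) (d T : R).
Hypothesis hRd : forall l, uniformly_spaced (Rd l) d T.

(** Close final coordinates give, by the lower spacing [d], block lengths differing by at most [E].
    Blocks then begin within [size ls * E] of each other, so at time [t] the indices inside a block
    differ by at most [(size ls).+1 * E], and the upper spacing [T] turns this back into a
    distance. *)
Lemma walk_coef_compare ls (C : R) : uniq ls -> exists2 C', 0 <= C' &
  forall rs rs' (m m' : I -> R) k k',
  (forall l, l \in ls -> enumerates (Rd l) (m l) (rs l)) ->
  (forall l, l \in ls -> enumerates (Rd l) (m' l) (rs' l)) ->
  (forall l, l \in ls -> `|walk_coef ls rs k l - walk_coef ls rs' k' l| <= C) ->
  forall t l, l \in ls ->
    `|walk_coef ls rs (minn t k) l - walk_coef ls rs' (minn t k') l| <= C'.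
Proof.
move=> uls; have [->|lsn] := eqVneq ls [::]; first by exists 0.
have [l0 l0ls] : exists l0, l0 \in ls by case: ls lsn {uls} => // l0 ls _; exists l0; exact: mem_head.
have [d0 T0 _ _] := hRd l0.
pose E := (Num.truncn (C / d)).+1.
exists (T * ((size ls).+1 * E)%:R); first by rewrite mulr_ge0// ltW.
move=> rs rs' m m' k k' en en' close t l lls.
have coefE (ss : I -> seq R) u x : walk_coef ls ss u x =
    nth 0 (0 :: ss x) (minn (u - offset ls (size \o ss) x) (size (ss x))).
  rewrite /walk_coef -(last_take_nth 0) ?geq_minr//; congr last.
  by rewrite take_min take_size.
pose j := truncated ls (size \o rs) k.
pose j' := truncated ls (size \o rs') k'.
have jE x : x \in ls -> (j x <= j' x + E)%N /\ (j' x <= j x + E)%N.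
  move=> xls; have := close x xls; rewrite !coefE -/(j x) -/(j' x) => cl.
  have /andP[H _] := block_compare (hRd x) (en x xls) (en' x xls) (geq_minr _ _ : (j x <= _)%N)
    (geq_minr _ _ : (j' x <= _)%N).
  have : `|(j x)%:R - (j' x)%:R| < E%:R :> R.
    apply: le_lt_trans (truncnS_gt _); rewrite ler_pdivlMr// mulrC; exact: le_trans cl.
  rewrite ltr_norml ltrBlDr -natrD ltr_nat ltrNl opprB ltrBlDr -natrD ltr_nat; lia.
rewrite !coefE.
have -> := truncated_offset (size \o rs) k t uls lls.
have -> := truncated_offset (size \o rs') k' t uls lls.
rewrite -/(j l) -/(j' l).
set o := offset ls _ l; set o' := offset ls _ l.
have oo' : (o <= o' + size ls * E)%N by apply: offset_close => x /jE[].
have o'o : (o' <= o + size ls * E)%N by apply: offset_close => x /jE[].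
have [jl j'l] := jE l lls.
have s1 : (minn (t - o) (j l) <= size (rs l))%N.
  by apply: leq_trans (geq_minr _ _) (geq_minr _ _).
have s2 : (minn (t - o') (j' l) <= size (rs' l))%N.
  by apply: leq_trans (geq_minr _ _) (geq_minr _ _).
have /andP[_ H] := block_compare (hRd l) (en l lls) (en' l lls) s1 s2.
rewrite (le_trans H)// ler_pM2l//.
have mul : ((size ls).+1 * E = size ls * E + E)%N by rewrite mulSn addnC.
rewrite ler_norml lerBlDr -natrD ler_nat lerNl opprB lerBlDr -natrD ler_nat mul; lia.
Qed.

End Walks.

(** * Combing paths in frame coordinates *)

Section Walk.
Variables (R : realType) (n : nat) (Delta : euclidean_building R n).
Variable tau : vert Delta -> vert Delta -> 'I_n.
Hypothesis htau : ordering tau.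
Local Notation Phi := (root_set Delta).
Local Notation hPhi := (building_roots Delta).
Local Notation K := (coxeter_complex Phi).
Local Notation cell_verts := (cell_verts Phi).
Implicit Types (A B : set (set (vert Delta))) (u v x y z : vert Delta) (f g h : vert Delta -> 'rV[R]_n).
Variable Om : 'I_n -> set 'rV[R]_n.
Hypothesis hO : labelling Phi Om.
Local Notation labelled_chart := (labelled_chart tau Om).
Variables (c : 'rV[R]_n) (e al : 'I_n -> 'rV[R]_n).
Hypothesis fr : frame Phi c e al.
Hypothesis eO : forall l, Om l (e l).
Local Notation frame_path := (frame_path tau Om e).
Local Notation T := (period e al).
Hypothesis lc : forall A, apartment A -> exists f, labelled_chart A f.

Definition corner (X : 'rV[R]_n) (m : 'I_n -> R) (i : nat) : 'rV[R]_n :=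
  X + \sum_(j < n | (j < i)%N) m j *: e j.

Lemma frame_neq0 l : e l != 0.
Proof. by apply/eqP => E; have := frame_dual_gt0 fr l; rewrite E dot0l ltxx. Qed.

Lemma edge_along_transition A f g L t (p q u v : 'rV[R]_n) : chart A f -> chart A g ->
  (forall u, vertices A u -> g u = f u *m L + t) ->
  edge_along Phi p q u v ->
  edge_along Phi (p *m L + t) (q *m L + t) (u *m L + t) (v *m L + t).
Proof.
move=> cf cg gE [[uv Kuv] [s [s' [s0 ss' s1 uE vE]]]]; split; last first.
  exists s, s'; split=> //.
    by rewrite uE opprD addrACA subrr addr0 -mulmxBl scalemxAl mulmxDl addrAC.
  by rewrite vE opprD addrACA subrr addr0 -mulmxBl scalemxAl mulmxDl addrAC.
have sub := model_vertices Kuv.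
have [u' Au' u'E] := chart_surj cf (sub u (or_introl erefl)).
have [v' Av' v'E] := chart_surj cf (sub v (or_intror erefl)).
rewrite -u'E -v'E -!gE//; apply/(chart_edge cg Au' Av')/(chart_edge cf Au' Av').
by rewrite u'E v'E.
Qed.

Lemma combing_normal x y p : special x -> special y -> combing_path tau x y p ->
  exists A g (m : 'I_n -> R) (q : 'I_n -> seq 'rV[R]_n),
  [/\ labelled_chart A g, vertices A x & vertices A y] /\
  [/\ forall i, 0 <= m i & g y = corner (g x) m n] /\
  [/\ forall i : 'I_n, segment_path Phi (corner (g x) m i) (corner (g x) m i.+1) (q i),
      all (fun v => `[< vertices A v >]) p
    & [seq g v | v <- p] = flatten [seq q i | i <- enum 'I_n]].
Proof.
move=> sx sy [A [f [S [xs [m [q]]]]]] /=.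
move=> [[cf Ax Ay] [_ [[As cs _ tx] [[m0 yE] [seg allp pE]]]]].
have [aA _] := cf.
have [f1 lf1] := lc aA.
have [g lg gxs] := labelled_chart_normal hO fr eO lf1 As cs tx (special_chart sx lf1.1 Ax).
have [cg _] := lg; have [L [t [_ gE _]]] := chart_transition cf cg.
have Axs i : vertices A (xs i) by apply: (apartment_vertices aA As); right; exists i.
have eE i : (f (xs i) - f x) *m L = e i.
  have : g (xs i) - g x = e i by rewrite gxs addrC addKr.
  by rewrite !gE// opprD addrACA subrr addr0 -mulmxBl.
have cE i : (f x + \sum_(j < n | (j < i)%N) m j *: (f (xs j) - f x)) *m L + t = corner (g x) m i.
  rewrite /corner gE// mulmxDl addrAC mulmx_suml; congr (_ + _).
  by apply: eq_bigr => j _; rewrite -scalemxAl eE.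
exists A, g, m, (fun i => [seq a *m L + t | a <- q i]); split=> //.
split; first by split=> //; rewrite gE// yE cE.
split=> //.
- move=> i; have [pq lq] := seg i; rewrite -!cE; split; last by rewrite (last_map (fun a => a *m L + t)) lq.
  apply: (homo_path (f := fun a => a *m L + t)) pq => a b /asboolP H; apply/asboolP.
  exact: (edge_along_transition cf cg gE H).
- have -> : [seq g v | v <- p] = [seq a *m L + t | a <- [seq f v | v <- p]].
    elim: p allp {pE} => //= v p IH /andP[/asboolP Av /IH ->]; by rewrite gE.
  by rewrite pE map_flatten -map_comp.
Qed.

Lemma segment_path_radii (X w : 'rV[R]_n) (m : R) q : w != 0 -> 0 <= m ->
  segment_path Phi X (X + m *: w) q ->
  exists rs, [/\ q = [seq X + r *: w | r <- rs], path <%R 0 rs, last 0 rs = m &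
    path (fun r r' => `[< edge K (X + r *: w) (X + r' *: w) >]) 0 rs].
Proof.
move=> w0 m0; rewrite /segment_path.
have winj r r' : X + r *: w = X + r' *: w -> r = r'.
  move=> /addrI /eqP; rewrite -subr_eq0 -scalerBl scaler_eq0 (negPf w0) orbF.
  by rewrite subr_eq0 => /eqP.
suff gen r0 : path (fun a b => `[< edge_along Phi X (X + m *: w) a b >]) (X + r0 *: w) q /\
    last (X + r0 *: w) q = X + m *: w ->
    exists rs, [/\ q = [seq X + r *: w | r <- rs], path <%R r0 rs, last r0 rs = m &
      path (fun r r' => `[< edge K (X + r *: w) (X + r' *: w) >]) r0 rs].
  by have := gen 0; rewrite scale0r addr0.
elim: q r0 => [|v q IH] r0 /=.
  by move=> [_ /winj <-]; exists [::].
move=> [/andP[/asboolP [ev [s [t [s0 st t1 uE vE]]]] pq] lq].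
have uE' : r0 = s * m.
  by apply: winj; rewrite uE addrAC subrr add0r scalerA.
have vE' : v = X + (t * m) *: w by rewrite vE addrAC subrr add0r scalerA.
have mpos : 0 < m.
  rewrite lt_neqAle m0 andbT; apply/eqP => m00; have [] := ev.
  by move=> ne _; apply: ne; rewrite vE' uE' -m00 !mulr0.
rewrite vE' in pq lq; have [rs [qE prs lrs ers]] := IH _ (conj pq lq).
exists (t * m :: rs); split=> //=; first by rewrite vE' qE.
  by rewrite prs uE' ltr_pM2r// st.
by rewrite ers andbT; apply/asboolP; rewrite -vE'.
Qed.

(* The parameters at which the ray along [e l] from a special vertex meets a vertex
   (by periodicity, it does not matter which special vertex). *)
Definition vertex_radius l (r : R) : Prop := cell_vertex Phi (r *: e l).
Definition special_radius l (r : R) : Prop := coweight Phi (r *: e l).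

(** Consecutive points span an edge of the complex, and by [ray_middle] a vertex strictly between
    them is impossible, so no vertex of the ray is skipped. *)
Lemma segment_enumerates X l (m : R) rs : coweight Phi X -> path <%R 0 rs -> last 0 rs = m ->
  path (fun r r' => `[< edge K (X + r *: e l) (X + r' *: e l) >]) 0 rs ->
  enumerates (vertex_radius l) m rs.
Proof.
move=> cX prs lrs ers; split=> // r.
have vE r' : cell_vertex Phi (X + r' *: e l) <-> vertex_radius l r'.
  by rewrite addrC; apply: cell_vertex_translate.
have edges i : (i < size rs)%N -> edge K (X + nth 0 (0 :: rs) i *: e l) (X + nth 0 rs i *: e l).
  by move=> isz; have /pathP-/(_ 0 i isz)/asboolP := ers.
have mono : {in [pred i | (i < (size rs).+1)%N] &, {mono nth 0 (0 :: rs) : i j / (i < j)%N >-> i < j}}.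
  exact: (lt_sorted_ltn_nth 0 (s := 0 :: rs) prs).
have lastE : m = nth 0 (0 :: rs) (size rs) by rewrite -lrs -last_take_nth// take_size.
split.
  move=> rin; have isz : (index r rs < size rs)%N by rewrite index_mem.
  have rE : nth 0 (0 :: rs) (index r rs).+1 = r by rewrite /= nth_index.
  split.
    have [_ Ke] := edges _ isz; rewrite nth_index// in Ke.
    by apply/vE/vertices_coxeter; apply: (model_vertices Ke); right.
  apply/andP; split.
    by rewrite -rE -[ltLHS]/(nth 0 (0 :: rs) 0) mono// inE /= ltnS ltnW.
  rewrite -rE lastE leNgt mono ?inE ?ltnS//.
  by rewrite -ltnNge.
move=> [vr /andP[r0 rm]].
have hasr : has (fun r1 => r <= r1) rs.
  apply/(has_nthP 0); case: rs lrs lastE {prs ers vE edges mono} rm => [|y rs] lrs lastE rm.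
    by move: rm; rewrite -lrs /= leNgt r0.
  by exists (size rs) => //=; rewrite lastE in rm.
set i := find (fun r1 => r <= r1) rs; have isz : (i < size rs)%N by rewrite -has_find.
have ri : r <= rs`_i := nth_find 0 hasr.
have pi : nth 0 (0 :: rs) i < r.
  case E : i => [//|j] /=; rewrite ltNge; apply/negP => rj.
  have jlt : (j < i)%N by rewrite E.
  have := before_find 0 jlt.
  by rewrite /= rj.
move: ri; rewrite le_eqVlt => /orP[/eqP ->|ri]; first exact: mem_nth.
exfalso; have [_ [p pE]] := edges i isz.
have [p1 _] : cell_verts p (X + nth 0 (0 :: rs) i *: e l) by rewrite /cell_verts -pE; left.
have [p2 _] : cell_verts p (X + rs`_i *: e l) by rewrite /cell_verts -pE; right.
exact: (ray_middle hPhi fr p1 ((vE r).2 vr) p2 pi ri).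
Qed.

(** Some wall through a vertex is transversal to [e l]; otherwise its cell would contain a piece of
    the ray. *)
Lemma vertex_tight_root l r : vertex_radius l r -> exists a,
  [/\ a \in Phi, dot (e l) a != 0 & r * dot (e l) a \is a Num.int].
Proof.
move=> vr; apply: contrapT => N; have [d d0 Hd] := nudge Phi (r *: e l) (e l).
have : closed_cell Phi (r *: e l) (r *: e l + d *: e l).
  move=> a k aP; rewrite le_eqVlt => /orP[/eqP E|kz]; last exact/ltW/Hd.
  have [da|da] := eqVneq (dot (e l) a) 0; first by rewrite dotDl !dotZl da !mulr0 addr0 E dotZl da mulr0.
  by case: N; exists a; split=> //; rewrite -dotZl -E intr_int.
rewrite vr /= => /eqP; rewrite -subr_eq0 addrAC subrr add0r scaler_eq0 gt_eqF//=.
exact/negP/frame_neq0.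
Qed.

Lemma radius_spacing : exists d t, forall l,
  uniformly_spaced (vertex_radius l) d t /\ uniformly_spaced (special_radius l) d t.
Proof.
have T0 := period_gt0 fr.
have /choice[D HD] : forall l, exists D, 0 < D /\ forall r, vertex_radius l r -> r / D \is a Num.int.
  (* At a vertex radius [r] the number [r / T l * F a] is integral for some root [a] transversal to
     [e l]. All [F a] are nonzero integers, so their product [M] is a common denominator and the
     radii are multiples of [T l / M]. *)
  move=> l; pose F a := if dot (e l) a == 0 then 1 else T l * dot (e l) a.
  have Fint a : a \in Phi -> F a \is a Num.int.
    move=> aP; rewrite /F; case: ifP => _; first exact: int_num1.
    by rewrite -dotZl; apply: (period_coweight hPhi fr).
  have F0 a : F a != 0.
    by rewrite /F; case: ifPn => [_|H]; rewrite ?oner_eq0// mulf_neq0// gt_eqF.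
  pose M := `|\prod_(a <- Phi) F a|.
  have M0 : 0 < M by rewrite normr_gt0 prodf_seq_neq0; apply/allP => a _; apply/implyP => _; exact: F0.
  exists (T l / M); split; first exact: divr_gt0.
  move=> r /vertex_tight_root[a [aP ea ra]].
  have -> : r / (T l / M) = (r / T l) * M by field; rewrite !gt_eqF.
  have -> : M = `|F a| * `|\prod_(b <- rem a Phi) F b|.
    by rewrite -normrM /M (big_rem a).
  rewrite mulrA rpredM//; last first.
    have Pint : \prod_(b <- rem a Phi) F b \is a Num.int.
      rewrite big_seq; apply: rpred_prod => b /mem_rem; exact: Fint.
    by case: (ler0P (\prod_(b <- rem a Phi) F b)) => _; rewrite ?rpredN.
  have : r / T l * F a \is a Num.int.
    by rewrite /F (negPf ea) mulrA divfK// gt_eqF.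
  by case: (ler0P (F a)) => _; rewrite ?mulrN ?rpredN.
have [|d d0 Hd] := @seq_small R _ (enum 'I_n) (fun l t => t <= D l).
  by move=> l _; exists (D l) => //; have [] := HD l.
have Tsum l : T l <= \sum_l T l.
  by rewrite (bigD1 l)//= lerDl sumr_ge0// => i _; exact/ltW.
have dD l : d <= D l by apply: (Hd l _ d d0 (lexx _)); rewrite mem_enum.
exists d, (\sum_l T l) => l; have sum0 := lt_le_trans (T0 l) (Tsum l).
have [_ Dint] := HD l; have cT := period_coweight hPhi fr l.
split; split=> //.
- by exists (D l).
- exists (T l); first by rewrite T0 Tsum.
  move=> r rR; rewrite /vertex_radius scalerDl; apply/(cell_vertex_translate _ cT).
  by case: rR => [->|//]; rewrite scale0r; apply/(coweight_vertex hPhi)/coweight0.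
- by exists (D l) => // r cr; apply: Dint; apply: (coweight_vertex hPhi).
- exists (T l); first by rewrite T0 Tsum.
  move=> r rR; rewrite /special_radius scalerDl; apply: coweightD => //.
  by case: rR => [->|//]; rewrite scale0r; apply: coweight0.
Qed.

End Walk.

Lemma take_enum_sum (R : realType) n k (F : 'I_n -> 'rV[R]_k) i : (i <= n)%N ->
  \sum_(j <- take i (enum 'I_n)) F j = \sum_(j < n | (j < i)%N) F j.
Proof.
elim: i => [|i IH] ilt; first by rewrite take0 big_nil big_pred0.
rewrite (take_nth (Ordinal ilt)) ?size_enum_ord// -cats1 big_cat big_seq1 /=.
rewrite IH 1?ltnW// (nth_ord_enum _ (Ordinal ilt)) [RHS](bigD1 (Ordinal ilt))//= addrC.
congr (_ + _); apply: eq_bigl => j; rewrite -(inj_eq val_inj) /=.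
by rewrite ltnS [RHS]andbC -ltn_neqAle.
Qed.

Lemma last_filter (T : Type) (a : pred T) x s : a (last x s) -> last x (seq.filter a s) = last x s.
Proof.
by case/lastP: s => // s y; rewrite last_rcons filter_rcons => ->; rewrite last_rcons.
Qed.

(** Trades a time on the special graph for a prefix of the underlying edge path. *)
Lemma filter_prefix (T : Type) (a : pred T) x s t : exists s1 s2,
  s = s1 ++ s2 /\ last x s1 = last x (take t (seq.filter a s)).
Proof.
elim: s x t => [|y s IH] x t; first by exists [::], [::].
case: t => [|t] /=; first by exists [::], (y :: s); rewrite take0.
case: ifP => ay /=.
  by have [s1 [s2 [-> E]]] := IH y t; exists (y :: s1), s2.
have [[|z s1] [s2 [sE E]]] := IH x t.+1; first by exists [::], (y :: s).
by exists (y :: z :: s1), s2; split; [rewrite sE|exact: E].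
Qed.

(** * Fellow travelling *)

Section GraphDistance.
Variables (R : realType) (T : Type) (adj : T -> T -> Prop).

Lemma graph_dist_le k x y : dist_le adj k x y -> (graph_dist R adj x y <= (k%:R)%:E)%E.
Proof.
move=> [p [sp pp lp]]; apply: (@le_trans _ _ ((size p)%:R%:E)%E); last by rewrite lee_fin ler_nat.
by apply: ereal_inf_lbound; exists p.
Qed.

Lemma graph_dist_le1 x y : (graph_dist R adj x y <= 1%:E)%E -> x = y \/ adj x y.
Proof.
(* An infimum below 2 yields a path with fewer than two edges, without knowing that it is
   attained. *)
move=> H; have : (graph_dist R adj x y < 2%:E)%E.
  by apply: (le_lt_trans H); rewrite lte_fin (ltr_nat R 1 2).
move=> /ereal_inf_lt[_ [p [pp lp] <-]]; rewrite lte_fin (ltr_nat R _ 2).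
case: p pp lp => [|z [|z' p]] //=; first by left.
by rewrite andbT => /asboolP xz <- _; right.
Qed.

End GraphDistance.

Section Comparison.
Variables (R : realType) (n : nat) (Delta : euclidean_building R n).
Variable tau : vert Delta -> vert Delta -> 'I_n.
Hypothesis htau : ordering tau.
Local Notation Phi := (root_set Delta).
Local Notation hPhi := (building_roots Delta).
Local Notation K := (coxeter_complex Phi).
Local Notation cell_verts := (cell_verts Phi).
Implicit Types (A B : set (set (vert Delta))) (u v x y z : vert Delta) (f g h : vert Delta -> 'rV[R]_n).
Variable Om : 'I_n -> set 'rV[R]_n.
Hypothesis hO : labelling Phi Om.
Local Notation labelled_chart := (labelled_chart tau Om).
Variables (c : 'rV[R]_n) (e al : 'I_n -> 'rV[R]_n).
Hypothesis fr : frame Phi c e al.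
Hypothesis eO : forall l, Om l (e l).
Hypothesis lc : forall A, apartment A -> exists f, labelled_chart A f.
Hypothesis hK : piecewise_euclidean K (@edist R n).
Hypothesis hF : face_closed K.
Local Notation frame_path := (frame_path tau Om e).
Local Notation T := (period e al).
Local Notation adj := (@adjacent _ _ Delta).

Definition blocks (X : 'rV[R]_n) (rs : 'I_n -> seq R) : seq 'rV[R]_n :=
  flatten [seq [seq X + \sum_(i <- take (index l (enum 'I_n)) (enum 'I_n)) last 0 (rs i) *: e i
    + r *: e l | r <- rs l] | l <- enum 'I_n].

(* [P] is an edge path along the frame, and [W] a sequence of the vertices met on
   it, stopped after [k] steps. *)
Definition walk (Rd : 'I_n -> R -> Prop) A g x P W k : Prop :=
  exists (rs : 'I_n -> seq R) (m : 'I_n -> R),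
  [/\ frame_path A g x P, forall l, enumerates (Rd l) (m l) (rs l),
    map g W = blocks (g x) rs, last x P = last x (take k W) &
    forall t, exists P1 P2, P = P1 ++ P2 /\ last x P1 = last x (take (minn t k) W)].

Lemma blocks_position X rs t : last X (take t (blocks X rs)) =
  X + \sum_(l <- enum 'I_n) walk_coef (enum 'I_n) rs t l *: e l.
Proof. by apply: walk_position => //; apply: enum_uniq. Qed.

Lemma walk_edges (X : 'rV[R]_n) ls (rs : 'I_n -> seq R) (q : 'I_n -> seq 'rV[R]_n) : uniq ls ->
  (forall l, l \in ls -> q l =
    [seq X + \sum_(i <- take (index l ls) ls) last 0 (rs i) *: e i + r *: e l | r <- rs l]) ->
  (forall l, l \in ls -> path <%R 0 (rs l) /\
    path (fun r r' => `[< edge K (X + \sum_(i <- take (index l ls) ls) last 0 (rs i) *: e i + r *: e l)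
      (X + \sum_(i <- take (index l ls) ls) last 0 (rs i) *: e i + r' *: e l) >]) 0 (rs l)) ->
  path (fun a b => `[< edge K a b /\ exists l (k : R), 0 <= k /\ b - a = k *: e l >]) X
    (flatten [seq q l | l <- ls]).
Proof.
elim: ls X => [//|l0 ls IH] X; rewrite cons_uniq => /andP[l0ls uls] Hq Hp /=.
have nl l : l \in ls -> l != l0 by move=> lls; apply: contraNneq l0ls => <-.
have q0 : q l0 = [seq X + r *: e l0 | r <- rs l0].
  by rewrite Hq ?mem_head//= eqxx big_nil; apply: eq_map => r; rewrite addr0.
have [lt0 p0] := Hp l0 (mem_head _ _); rewrite /= eqxx big_nil addr0 in p0.
have lastq : last X (q l0) = X + last 0 (rs l0) *: e l0.
  rewrite q0 -{1}(addr0 X) -(scale0r (e l0)).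
  exact: (last_map (fun r => X + r *: e l0)).
have E l : l \in ls -> X + \sum_(i <- take (index l (l0 :: ls)) (l0 :: ls)) last 0 (rs i) *: e i =
    X + last 0 (rs l0) *: e l0 + \sum_(i <- take (index l ls) ls) last 0 (rs i) *: e i.
  by move=> lls; rewrite /= eq_sym (negPf (nl l lls)) big_cons addrA.
rewrite cat_path lastq; apply/andP; split.
  suff gen s r0 : path <%R r0 s -> path (fun r r' => `[< edge K (X + r *: e l0) (X + r' *: e l0) >]) r0 s ->
      path (fun a b => `[< edge K a b /\ exists l (k : R), 0 <= k /\ b - a = k *: e l >])
        (X + r0 *: e l0) [seq X + r *: e l0 | r <- s].
    by have := gen _ _ lt0 p0; rewrite scale0r addr0 q0.
  elim: s r0 => //= r s IHs r0 /andP[lt lts] /andP[/asboolP ee es].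
  rewrite IHs// andbT; apply/asboolP; split=> //; exists l0, (r - r0).
  by rewrite subr_ge0 (ltW lt) opprD addrACA subrr add0r scalerBl.
apply: IH => // l lls; first by rewrite Hq ?inE ?lls ?orbT// E.
by have := Hp l _; rewrite inE lls orbT => /(_ isT); rewrite E.
Qed.

Lemma combing_walk x y p : special x -> special y -> combing_path tau x y p ->
  exists A g (rs : 'I_n -> seq R) (m : 'I_n -> R),
  [/\ frame_path A g x p, all (fun v => `[< vertices A v >]) p,
    forall l, enumerates (vertex_radius Delta e l) (m l) (rs l),
    map g p = blocks (g x) rs &
    forall l, last 0 (rs l) = m l /\ coweight Phi (m l *: e l)].
Proof.
move=> sx sy cp.
have [A [g [m [q [[lg Ax Ay] [[m0 yE] [seg allp pE]]]]]]] := combing_normal hO fr eO lc sx sy cp.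
have [cg _] := lg; have cx := special_chart sx cg Ax; have cy := special_chart sy cg Ay.
have cornerS (i : 'I_n) : corner e (g x) m i.+1 = corner e (g x) m i + m i *: e i.
  rewrite /corner -addrA; congr (_ + _); rewrite (bigD1 i)//= addrC; congr (_ + _).
  apply: eq_bigl => j; rewrite -(inj_eq val_inj) /=.
  by rewrite ltnS andbC -ltn_neqAle.
(* The end points are special, and pairing their difference with [al l] isolates the coordinate
   [m l]. Hence all corners are special, and each block starts at a special vertex. *)
have cm l : coweight Phi (m l *: e l).
  apply/(coweight_simple hPhi fr) => j; rewrite dotZl; have [->|lj] := eqVneq j l; last first.
    by rewrite (frame_dual fr) 1?eq_sym// mulr0 int_num0.
  have <- : dot (g y - g x) (al l) = m l * dot (e l) (al l).
    rewrite yE /corner addrC addKr -(dot_sum_dual fr).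
    by congr dot; apply: eq_bigl => i; rewrite ltn_ord.
  by apply: (coweightB cy cx); apply: (frame_root fr).
have ccorner i : coweight Phi (corner e (g x) m i).
  apply: coweightD => //; elim/big_rec: _ => [|j d _ cd]; first exact: coweight0.
  exact: coweightD.
have /choice[rs Hrs] : forall l : 'I_n, exists rs, [/\ q l = [seq corner e (g x) m l + r *: e l | r <- rs],
    path <%R 0 rs, last 0 rs = m l &
    path (fun r r' => `[< edge K (corner e (g x) m l + r *: e l) (corner e (g x) m l + r' *: e l) >]) 0 rs].
  move=> l; apply: segment_path_radii; [exact: (frame_neq0 fr)|exact: m0|].
  by rewrite -cornerS; apply: seg.
have lastE l : last 0 (rs l) = m l by have [] := Hrs l.
have cornerE (l : 'I_n) : corner e (g x) m l =
    g x + \sum_(i <- take (index l (enum 'I_n)) (enum 'I_n)) last 0 (rs i) *: e i.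
  rewrite index_enum_ord take_enum_sum 1?ltnW// /corner; congr (_ + _).
  by apply: eq_bigr => i _; rewrite lastE.
have qE : flatten [seq q i | i <- enum 'I_n] = blocks (g x) rs.
  rewrite /blocks; congr flatten; apply: eq_map => l; have [-> _ _ _] := Hrs l.
  by rewrite cornerE.
exists A, g, rs, m; split=> //.
- split=> //.
  have : path (fun a b => `[< edge K a b /\ exists l (k : R), 0 <= k /\ b - a = k *: e l >]) (g x) (map g p).
    rewrite pE; apply: (walk_edges (rs := rs)); first exact: enum_uniq.
      by move=> l _; have [-> _ _ _] := Hrs l; rewrite cornerE.
    by move=> l _; rewrite -cornerE; have [_ ? _ ?] := Hrs l.
  elim: p x Ax allp {cp sx pE cx cornerS yE ccorner Hrs cornerE qE seg} => //= v p IH x Ax /andP[/asboolP Av allp].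
  move=> /andP[/asboolP [ee st] pp]; rewrite IH// andbT; apply/asboolP; split=> //.
  exact/(chart_edge cg Ax Av).
- move=> l; have [_ lt0 lE ed] := Hrs l.
  exact: (segment_enumerates fr (ccorner l) lt0 lE ed).
- by rewrite pE.
Qed.

Lemma combing_walk_all d : combing tau d -> exists A g W k,
  [/\ walk (vertex_radius Delta e) A g d.1 d.2 W k &
    forall t, path_at d t = last d.1 (take (minn t k) W)].
Proof.
case: d => x P /= [y [p [k [/= sx sy cp ->]]]].
have [A [g [rs [m [fp _ en pE _]]]]] := combing_walk sx sy cp.
have fp' : frame_path A g x (take k p).
  by have := fp; rewrite -{1}(cat_take_drop k p) => /frame_path_cat[].
exists A, g, p, k; split; last by move=> t; rewrite path_at_last take_min.
exists rs, m; split=> // t; exists (take t (take k p)), (drop t (take k p)).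
by rewrite cat_take_drop take_min.
Qed.

Lemma combing_walk_special d : combing_spec tau d -> exists A g P W k,
  [/\ walk (special_radius Delta e) A g d.1 P W k, last d.1 P = last d.1 d.2,
    special d.1, forall t, special (path_at d t) &
    forall t, path_at d t = last d.1 (take (minn t k) W)].
Proof.
move=> [[x P] [[y [p [k [/= sx sy cp ->]]]] _ sl] <- /=].
set a := fun v => `[< special v >].
have [A [g [rs [m [fp allp en pE mE]]]]] := combing_walk sx sy cp.
have [lg Ax _] := fp; have [cg _] := lg.
have fp' : frame_path A g x (take k p).
  by have := fp; rewrite -{1}(cat_take_drop k p) => /frame_path_cat[].
have fE : seq.filter a p = seq.filter a (take k p) ++ seq.filter a (drop k p).
  by rewrite -filter_cat cat_take_drop.
(* Cutting the edge path after [k] steps cuts its sequence of special vertices after [N]. *)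
set N := size (seq.filter a (take k p)).
have tN : take N (seq.filter a p) = seq.filter a (take k p) by rewrite fE take_size_cat.
have lE : last x (seq.filter a (take k p)) = last x (take k p).
  by apply: last_filter; apply/asboolP.
exists A, g, (take k p), (seq.filter a p), N; split=> //; last 2 first.
- move=> t; rewrite path_at_last.
  set s := take k p; have : all a (seq.filter a s) by apply: filter_all.
  move: (seq.filter a s) => s'; elim: s' x sx t {cp sl pE fp Ax fp' lE} => [|z s' IH] x sx [|t] //=.
  by move=> /andP[/asboolP sz al']; apply: IH.
- by move=> t; rewrite path_at_last take_min tN.
pose rs' l := seq.filter (fun r => `[< special_radius Delta e l r >]) (rs l).
(* Blocks end at special corners, so dropping the other vertices moves no corner. *)
have lastE l : last 0 (rs' l) = last 0 (rs l).
  by apply: last_filter; apply/asboolP; rewrite /special_radius; have [-> ] := mE l.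
exists rs', m; split=> //.
- move=> l; have [lt0 H] := en l; split.
    exact: (subseq_path lt_trans (filter_subseq _ _) lt0).
  move=> r; rewrite mem_filter; split=> [/andP[/asboolP sr /H[]]//|[sr rm]].
  apply/andP; split; first exact/asboolP.
  by apply/H; split=> //; apply: (coweight_vertex hPhi).
- have -> : [seq g v | v <- seq.filter a p] = seq.filter (fun b => `[< coweight Phi b >]) [seq g v | v <- p].
    elim: p allp {cp sl pE fp fp' lE fE N tN} => //= v p IH /andP[/asboolP Av /IH {}IH].
    have -> : `[< coweight Phi (g v) >] = a v.
      apply/asboolP/asboolP => H; first exact: (chart_special cg Av).
      exact: (special_chart H cg Av).
    by case: (a v) => /=; rewrite IH.
  rewrite pE /blocks filter_flatten -map_comp; congr flatten; apply: eq_map => l /=.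
  rewrite filter_map /rs'; set X := g x + _; set X' := g x + _.
  have XE : X = X'.
    by congr (_ + _); apply: eq_bigr => i _; rewrite -/(rs' i) lastE.
  have cX : coweight Phi X.
    apply: coweightD; first exact: (special_chart sx cg Ax).
    elim/big_rec: _ => [|j b _ cb]; first exact: coweight0.
    by apply: coweightD => //; have [-> ] := mE j.
  rewrite -XE; congr map; apply: eq_filter => r /=.
  apply/asboolP/asboolP => H; last exact: coweightD.
  by rewrite /special_radius -[_ *: _](addKr X) addrC; apply: coweightB.
- by rewrite tN lE.
- move=> t; rewrite take_min tN; have [s1 [s2 [E1 E2]]] := filter_prefix a x (take k p) t.
  by exists s1, s2.
Qed.

Lemma walks_close (Rd : 'I_n -> R -> Prop) (d t0 : R) k0 :
  (forall l, uniformly_spaced (Rd l) d t0) -> exists C, forall A g x P W k A' g' x' P' W' k',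
  walk Rd A g x P W k -> walk Rd A' g' x' P' W' k' ->
  dist_le adj k0 x x' -> dist_le adj k0 x' x ->
  dist_le adj k0 (last x P) (last x' P') -> dist_le adj k0 (last x' P') (last x P) ->
  forall t, exists B h, [/\ chart B h, vertices B (last x (take (minn t k) W)),
    vertices B (last x' (take (minn t k') W')) &
    root_norm Phi (h (last x (take (minn t k) W)) - h (last x' (take (minn t k') W'))) <= C].
Proof.
move=> spaced; have [kap kap0 Hkap] := labelling_conj hPhi hF hO fr eO.
have [C1 C10 H1] := frame_path_compare htau hO fr eO kap0 Hkap k0.
have T0 := period_gt0 fr.
pose ST := \sum_l T l.
have Tsum l : T l <= ST.
  by rewrite /ST (bigD1 l)//= lerDl sumr_ge0// => i _; exact/ltW.
(* The final displacements differ by at most [C1]; pairing with [al l] and multiplying by the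
   period, at most [ST], bounds the difference of each final coordinate. *)
have [C2 C20 H2] := walk_coef_compare spaced (C1 * ST) (enum_uniq 'I_n).
exists (C1 + \sum_(l <- enum 'I_n) C2 * root_norm Phi (e l)).
move=> A g x P W k A' g' x' P' W' k' [rs [m [fP en gW lP sP]]] [rs' [m' [fP' en' gW' lP' sP']]].
move=> dx dx' dz dz' t.
have posE s : g (last x (take s W)) - g x = \sum_(l <- enum 'I_n) walk_coef (enum 'I_n) rs s l *: e l.
  by rewrite -last_map map_take gW blocks_position addrC addKr.
have posE' s : g' (last x' (take s W')) - g' x' = \sum_(l <- enum 'I_n) walk_coef (enum 'I_n) rs' s l *: e l.
  by rewrite -last_map map_take gW' blocks_position addrC addKr.
have [P1 [P2 [PE P1E]]] := sP t; have [P1' [P2' [PE' P1E']]] := sP' t.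
rewrite PE in fP dz dz' lP; rewrite PE' in fP' dz dz' lP'.
have [Hend [B [h [cB Bv Bv' Hh]]]] := H1 _ _ _ _ _ _ _ _ _ _ fP fP' dx dx' dz dz'.
rewrite P1E P1E' in Bv Bv' Hh; exists B, h; split=> //.
apply: (le_trans Hh); rewrite lerD2l posE posE' -sumrB.
rewrite (le_trans (root_norm_sum _ _ _ _))//; apply: ler_sum => l _.
rewrite -scalerBl root_normZ ler_wpM2r ?root_norm_ge0//.
apply: (H2 rs rs' m m' k k') => //; [|by rewrite mem_enum] => {}l _.
move: Hend; rewrite lP lP' posE posE' -sumrB => Hend.
have E : dot (\sum_(i <- enum 'I_n) (walk_coef (enum 'I_n) rs k i *: e i - walk_coef (enum 'I_n) rs' k' i *: e i)) (al l) =
    (walk_coef (enum 'I_n) rs k l - walk_coef (enum 'I_n) rs' k' l) * dot (e l) (al l).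
  rewrite big_enum /= -(dot_sum_dual fr (fun i => walk_coef (enum 'I_n) rs k i - walk_coef (enum 'I_n) rs' k' i)).
  by congr dot; apply: eq_bigr => i _; rewrite scalerBl.
have := root_norm_ge (\sum_(i <- enum 'I_n) (walk_coef (enum 'I_n) rs k i *: e i - walk_coef (enum 'I_n) rs' k' i *: e i)) (frame_root fr l).
rewrite E normrM (gtr0_norm (frame_dual_gt0 fr l))// => H.
have {}H := le_trans H Hend.
rewrite -ler_pdivlMr ?(frame_dual_gt0 fr)// in H; rewrite (le_trans H)// ler_pM2l//.
exact: Tsum.
Qed.

Lemma chart_dist_le B h k u v : chart B h -> vertices B u -> vertices B v ->
  dist_le (edge K) k (h u) (h v) -> dist_le adj k u v.
Proof.
move=> ch Bu Bv; have [aB sh] := ch; have [subB _] := building_subcomplex aB.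
have [h' [sh' h'h hh']] := simplicial_isometry_inv (ex_intro _ u I) (@model_vertices _ _ Delta) sh.
have [[h'K _ _] _ _] := sh'.
rewrite -{2}(h'h u Bu) -{2}(h'h v Bv).
apply: (dist_le_map (P := vertices K)); last exact: (chart_vertex ch Bu).
move=> a b Ka ab; have Kb : vertices K b.
  by have [_ Kab] := ab; apply: (model_vertices Kab); right.
split=> //; have [ne Be] : edge B (h' a) (h' b).
  by apply/(chart_edge ch (h'K _ Ka) (h'K _ Kb)); rewrite !hh'.
by split=> //; apply: subB.
Qed.

Lemma chart_special_dist_le B h k u v : chart B h -> vertices B u -> vertices B v ->
  coweight Phi (h u) -> dist_le (special_adj Phi) k (h u) (h v) ->
  dist_le (@adjacent_spec _ _ Delta) k u v.
Proof.
move=> ch Bu Bv cu; have [aB sh] := ch.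
have [h' [sh' h'h hh']] := simplicial_isometry_inv (ex_intro _ u I) (@model_vertices _ _ Delta) sh.
have [[h'K _ _] _ _] := sh'.
rewrite -{2}(h'h u Bu) -{2}(h'h v Bv).
have cK a : coweight Phi a -> vertices K a by move=> ca; apply/vertices_coxeter/(coweight_vertex hPhi).
apply: (dist_le_map (P := coweight Phi)) => // a b ca [ab ss nosp].
have cb : coweight Phi b by apply/(special_coweight hPhi); case: ss.
split=> //; split; first by move=> E; apply: ab; rewrite -(hh' a (cK _ ca)) -(hh' b (cK _ cb)) E.
by exists B, h; rewrite (hh' a (cK _ ca)) (hh' b (cK _ cb)); split=> //; apply: h'K; apply: cK.
Qed.

Lemma adjacent_sym u v : adj u v -> adj v u.
Proof. by move=> [uv H]; split; [exact: nesym|rewrite setUC]. Qed.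

Lemma fellow_traveller_combing : fellow_traveller R adj (combing tau).
Proof.
have [d [t0 spaced]] := radius_spacing fr.
have [C HC] := walks_close 1 (fun l => (spaced l).1).
have [k Hk] := vertex_dist_bound hPhi hK hF C.
exists k.+1%:R; split; first by rewrite ltr0n.
have near u v : (graph_dist R adj u v <= 1%:E)%E -> dist_le adj 1 u v /\ dist_le adj 1 v u.
  move=> /(@graph_dist_le1 _ _ _ u v)[->|uv]; first by split; apply: dist_le_refl.
  by split; apply: dist_le_step; last exact: adjacent_sym.
move=> a b ca cb /near[dx dx'] /near[dz dz'] t.
have [A [g [W [j [wa pa]]]]] := combing_walk_all ca.
have [A' [g' [W' [j' [wb pb]]]]] := combing_walk_all cb.
have [B [h [ch Bu Bv Hh]]] := HC _ _ _ _ _ _ _ _ _ _ _ _ wa wb dx dx' dz dz' t.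
apply: graph_dist_le; apply: (dist_le_mono (leqnSn k)); rewrite pa pb.
by apply: (chart_dist_le ch Bu Bv); apply: Hk => //; apply: (chart_vertex ch).
Qed.

(** End points adjacent in the special graph are at most [k0] apart in the 1-skeleton, where the
    retraction estimates apply; the resulting bound returns to the special graph by
    [coweight_dist_bound]. *)
Lemma fellow_traveller_combing_spec : fellow_traveller R (@adjacent_spec _ _ Delta) (combing_spec tau).
Proof.
have [d [t0 spaced]] := radius_spacing fr.
have [C0 HC0] := special_adj_bound hPhi hK hF.
have [k0 Hk0] := vertex_dist_bound hPhi hK hF C0.
have [C HC] := walks_close k0 (fun l => (spaced l).2).
have [k Hk] := coweight_dist_bound hPhi hK C.
exists k.+1%:R; split; first by rewrite ltr0n.
have near u v : (graph_dist R (@adjacent_spec _ _ Delta) u v <= 1%:E)%E ->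
    dist_le adj k0 u v /\ dist_le adj k0 v u.
  move=> /(@graph_dist_le1 _ _ _ u v)[->|[uv [B [h [ch Bu Bv ss nosp]]]]]; first by split; apply: dist_le_refl.
  have N : root_norm Phi (h u - h v) <= C0.
    by apply: HC0; split=> // /(chart_inj ch Bu Bv).
  have Ku := chart_vertex ch Bu; have Kv := chart_vertex ch Bv.
  split; apply: (chart_dist_le ch) => //; apply: Hk0 => //.
  by rewrite -root_normN opprB.
move=> a b ca cb /near[dx dx'] /near[dz dz'] t.
have [A [g [P [W [j [wa la sa spa pa]]]]]] := combing_walk_special ca.
have [A' [g' [P' [W' [j' [wb lb sb spb pb]]]]]] := combing_walk_special cb.
rewrite -la -lb in dz dz'.
have [B [h [ch Bu Bv Hh]]] := HC _ _ _ _ _ _ _ _ _ _ _ _ wa wb dx dx' dz dz' t.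
apply: graph_dist_le; apply: (dist_le_mono (leqnSn k)).
rewrite -pa in Bu Hh *; rewrite -pb in Bv Hh *.
have cu := special_chart (spa t) ch Bu; have cv := special_chart (spb t) ch Bv.
exact: (chart_special_dist_le ch Bu Bv cu (Hk _ _ cu cv Hh)).
Qed.

End Comparison.

Lemma fellow_traveller_of_apartment (R : realType) (n : nat) (Delta : euclidean_building R n)
    (tau : vert Delta -> vert Delta -> 'I_n) (A : set (set (vert Delta))) : ordering tau -> apartment A ->
  fellow_traveller R (@adjacent R n Delta) (combing tau) /\
  fellow_traveller R (@adjacent_spec R n Delta) (combing_spec tau).
Proof.
move=> htau aA; have hPhi := building_roots Delta.
have hK := model_euclidean aA; have hF := model_face_closed aA.
have [f [Om [hO lf]]] := ordering_chart htau aA.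
have lc B : apartment B -> exists g, labelled_chart tau Om B g.
  exact: (labelled_chart_exists htau hO lf).
have [c [gc c0 _]] := chamber_of hPhi 0.
have [e [al [fr eO]]] := labelling_frame hPhi hO gc c0.
split; first exact: (fellow_traveller_combing htau hO fr eO lc hK hF).
exact: (fellow_traveller_combing_spec htau hO fr eO lc hK hF).
Qed.

Theorem mainTheorem2 (R : realType) (n : nat) (Delta : euclidean_building R n)
    (tau : vert Delta -> vert Delta -> 'I_n) (htau : ordering tau) :
  fellow_traveller R (@adjacent R n Delta) (combing tau) /\
  fellow_traveller R (@adjacent_spec R n Delta) (combing_spec tau).
Proof.
(* The facts on the model are pulled back from an apartment. Without one there are no combing paths,
   and any constant will do. *)
have [[A aA]|noA] := pselect (exists A : set (set (vert Delta)), apartment A).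
  exact: (fellow_traveller_of_apartment htau aA).
have none c : ~ combing tau c.
  move=> [y [p [k [_ _ [A [f [S [xs [m [q [[[aA _] _ _] _]]]]]]] _]]]].
  by apply: noA; exists A.
split; exists 1; split=> // c d; first by move=> /none.
by move=> [c' [/none]].
Qed.
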